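(* Let $\alpha\in\mathbb{C}\setminus\mathbb{Q}$, $n\in\mathbb{N}$, and $LG_{n+1}(\alpha)=\mathrm{End}_{U_q(sl(2|1))}\big(V(0,\alpha)^{\otimes(n+1)}\big)$. 1) (Matrix unit basis for $LG_{n+1}(\alpha)$) There is an algebra isomorphism which makes the correspondence between a basis of projectors onto simple components from $LG_{n+1}(\alpha)$ and an algebra of elementary matrices indexed by symmetric planar curves: $$LG_{n+1}(\alpha)\ \simeq\ \big\langle\, \sigma\subseteq\mathbb{R}^2 \ \big|\ \sigma \text{ is a simple closed curve containing } (0,0) \text{ and } (n+1,n+1), \text{ constructed with the moves } M_2 \text{ or } M_3 \,\big\rangle_{\mathbb{C}}^{*}.$$ 2) (Identification of projectors onto isotypic components) For any $(x,y)\in\Delta_n$, let $p^{n+1}_{x,y}\in LG_{n+1}(\alpha)$ be the projector onto the isotypic component of $V\big(x,(n+1)\alpha+y\big)$ inside $V(0,\alpha)^{\otimes(n+1)}$. Then there is a one to one correspondence between this set of projectors and the following family of symmetric planar curves: $$p^{n+1}_{x,y}\ \longleftrightarrow\ \sum_{\sigma\in S^{ref}_{n+1}(x+y+1,\,y)}\sigma^{*},\qquad \forall (x,y)\in\Delta_n.$$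
   Context: Here $\mathbb{N}=\{0,1,2,\dots\}$, $\hbar$ is an indeterminate, the ground field is $\Bbbk=\mathbb{C}((\hbar))$ and $q=e^{\hbar/2}$. All objects are $\mathbb{Z}/2$-graded, with super-commutator $[x,y]=xy-(-1)^{\bar x\bar y}yx$. With $(a_{ij})=\begin{pmatrix}2&-1\\-1&0\end{pmatrix}$, $U_q(sl(2|1))$ is the Hopf superalgebra over $\Bbbk$ generated by $E_i,F_i,h_i$ ($i=1,2$), where $E_2,F_2$ are odd and the other generators are even, with relations $[h_i,h_j]=0$, $[h_i,E_j]=a_{ij}E_j$, $[h_i,F_j]=-a_{ij}F_j$, $[E_i,F_j]=\delta_{ij}\frac{q^{h_i}-q^{-h_i}}{q-q^{-1}}$, $E_2^2=F_2^2=0$, $E_1^2E_2-(q+q^{-1})E_1E_2E_1+E_2E_1^2=0$, $F_1^2F_2-(q+q^{-1})F_1F_2F_1+F_2F_1^2=0$, and coproduct $\Delta(E_i)=E_i\otimes1+q^{-h_i}\otimes E_i$, $\Delta(F_i)=F_i\otimes q^{h_i}+1\otimes F_i$, $\Delta(h_i)=h_i\otimes1+1\otimes h_i$. For $(\alpha_1,\alpha_2)\in\mathbb{N}\times\mathbb{C}$, $V(\alpha_1,\alpha_2)$ is the simple module generated by a highest weight vector $v$ of weight $(\alpha_1,\alpha_2)$, i.e. $h_iv=\alpha_iv$ and $E_iv=0$ for $i=1,2$. For $\alpha\notin\mathbb{Q}$, the tensor power $V(0,\alpha)^{\otimes(n+1)}$ is semi-simple and its simple components are of the form $V(x,(n+1)\alpha+y)$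 with $(x,y)\in\Delta_n$. $\Delta_n\subseteq\mathbb{R}^2$ is the standard simplex with edge of length $n$; the points $(x,y)\in\Delta_n$ considered are those with integer coordinates, i.e. $x,y\in\mathbb{N}$, $x+y\le n$. The moves are $M_2:(x',y')\to(x'+1,y')$ and $M_3:(x',y')\to(x',y'+1)$. A simple closed curve containing $(0,0)$ and $(n+1,n+1)$ and constructed with these moves is the union of two lattice paths from $(0,0)$ to $(n+1,n+1)$, made of unit right and up steps, that meet only at their endpoints. The secondary diagonal is the diagonal of the square $[0,n+1]^2$ joining $(n+1,0)$ and $(0,n+1)$. $S^{ref}_{n+1}(a,b)$ is the set of such simple closed curves which are symmetric with respect to the secondary diagonal and cut it in the two points $(n+1-a,a)$ and $(n+1-b,b)$. $\langle\cdot\rangle_{\mathbb{C}}^{*}$ denotes the algebra of elementary matrices indexed by the listed curves, and $\sigma^{*}$ is the element indexed by $\sigma$. The indexing comes from cutting a curve along the secondary diagonal: the curves cutting the diagonal in two given points are in bijection with pairs of elements of one and the same set of half-curves (the second half being reflected across the diagonal).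
   Formalization: The algebra of elementary matrices indexed by curves is taken over the ground field C((ħ)) instead of C, since LG_{n+1}(α) is a C((ħ))-algebra; over C the isomorphism fails already for n=0, where LG_1 = C((ħ)) and there is one curve. *)

(* Defs.v *)
From HB Require Import structures.
From mathcomp Require Import all_boot all_order all_algebra.
From mathcomp Require Import complex mxtens.
From mathcomp Require Import boolp reals zify ring.
Set Implicit Arguments. Unset Strict Implicit. Unset Printing Implicit Defensive.
Import Order.TTheory GRing.Theory Num.Theory.
Local Open Scope ring_scope.

Definition fps (F : fieldType) := nat -> F.

Section PowerSeries.
Variable F : fieldType.
Implicit Types f g h : fps F.

HB.instance Definition _ := gen_eqMixin (fps F).
HB.instance Definition _ := gen_choiceMixin (fps F).

Definition fps_zero : fps F := fun=> 0.
Definition fps_opp f : fps F := fun n => - f n.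
Definition fps_add f g : fps F := fun n => f n + g n.
Definition fps_one : fps F := fun n => (n == 0)%:R.
Definition fps_mul f g : fps F := fun n => \sum_(i < n.+1) f i * g (n - i)%N.

Fact fps_addA : associative fps_add.
Proof. by move=> f g h; apply/funext => n; apply: addrA. Qed.
Fact fps_addC : commutative fps_add.
Proof. by move=> f g; apply/funext => n; apply: addrC. Qed.
Fact fps_add0 : left_id fps_zero fps_add.
Proof. by move=> f; apply/funext => n; apply: add0r. Qed.
Fact fps_addN : left_inverse fps_zero fps_opp fps_add.
Proof. by move=> f; apply/funext => n; apply: addNr. Qed.
HB.instance Definition _ :=
  GRing.isZmodule.Build (fps F) fps_addA fps_addC fps_add0 fps_addN.

Let agree n f (p : {poly F}) := forall m, (m <= n)%N -> f m = p`_m.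
Let trunc n f : {poly F} := \poly_(i < n.+1) f i.
Let agree_trunc n f : agree n f (trunc n f).
Proof. by move=> m le_mn; rewrite coef_poly ltnS le_mn. Qed.
Let agreeM n f g p r : agree n f p -> agree n g r -> agree n (fps_mul f g) (p * r).
Proof.
move=> fp gr m le_mn; rewrite coefM; apply: eq_bigr => i _.
rewrite fp ?gr ?(leq_trans (leq_subr _ _)) //.
by rewrite (leq_trans _ le_mn) // -ltnS.
Qed.

Fact fps_mulA : associative fps_mul.
Proof.
move=> f g h; apply/funext => n.
have [[fp gp] hp] := (@agree_trunc n f, @agree_trunc n g, @agree_trunc n h).
rewrite (agreeM fp (agreeM gp hp) (leqnn n)).
rewrite (agreeM (agreeM fp gp) hp (leqnn n)).
by rewrite mulrA.
Qed.
Fact fps_mulC : commutative fps_mul.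
Proof.
move=> f g; apply/funext => n.
rewrite (agreeM (@agree_trunc n f) (@agree_trunc n g) (leqnn n)) mulrC.
by rewrite -(agreeM (@agree_trunc n g) (@agree_trunc n f) (leqnn n)).
Qed.
Fact fps_mul1 : left_id fps_one fps_mul.
Proof.
move=> f; apply/funext => n.
rewrite /fps_mul big_ord_recl /fps_one mul1r subn0 big1 ?addr0 // => i _.
by rewrite mul0r.
Qed.
Fact fps_mulDl : left_distributive fps_mul fps_add.
Proof.
move=> f g h; apply/funext => n; rewrite /fps_add /fps_mul -big_split.
by apply: eq_bigr => i _; rewrite mulrDl.
Qed.
Fact fps_oner_neq0 : fps_one != 0.
Proof. by apply/eqP => /(congr1 (fun f : fps F => f 0%N))/eqP; rewrite oner_eq0. Qed.
HB.instance Definition _ := GRing.Zmodule_isComNzRing.Build (fps F)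
  fps_mulA fps_mulC fps_mul1 fps_mulDl fps_oner_neq0.

Definition fps_unit : pred (fps F) := [pred f | `[< exists g, g * f = 1 >]].
Definition fps_inv f : fps F :=
  if pselect (exists g, g * f = 1) is left ex_g then projT1 (cid ex_g) else f.
Fact fps_mulV : {in fps_unit, left_inverse 1 fps_inv *%R}.
Proof.
move=> f /asboolP f_unit; rewrite /fps_inv; case: pselect => // ex_g.
exact: projT2 (cid ex_g).
Qed.
Fact fps_unitP f g : g * f = 1 -> fps_unit f.
Proof. by move=> gf1; apply/asboolP; exists g. Qed.
Fact fps_inv_out : {in [predC fps_unit], fps_inv =1 id}.
Proof.
by move=> f /asboolP f_nunit; rewrite /fps_inv; case: pselect.
Qed.
HB.instance Definition _ := GRing.ComNzRing_hasMulInverse.Build (fps F)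
  fps_mulV fps_unitP fps_inv_out.

Fact fps_integral f g : f * g = 0 -> (f == 0) || (g == 0).
Proof.
have ord (h : fps F) : h != 0 ->
    exists2 n, h n != 0 & forall m, (m < n)%N -> h m = 0.
  move=> h_neq0; have ex_n : exists n, h n != 0.
    apply: contrapT => nex; case/eqP: h_neq0; apply/funext => n.
    by apply: contrapT => /eqP hn; case: nex; exists n.
  case: (ex_minnP ex_n) => n hn min_n; exists n => // m lt_mn.
  by apply: contraTeq lt_mn => /min_n; rewrite -leqNgt.
move=> fg0; case: eqVneq => //= /ord[a fa lt_a]; apply: contraT => /ord[b gb lt_b].
have := congr1 (fun f : fps F => f (a + b)%N) fg0.
rewrite {1}/GRing.mul /= /fps_mul.
have lt_aab : (a < (a + b).+1)%N by rewrite ltnS leq_addr.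
rewrite (bigD1 (Ordinal lt_aab)) //= addKn big1 ?addr0 => [/eqP|i neq_ia].
  by rewrite mulf_eq0 (negPf fa) (negPf gb).
have [lt_ia|] := ltnP i a; first by rewrite lt_a ?mul0r.
rewrite leq_eqVlt => /predU1P[eq_ai|lt_ai]; last first.
  rewrite lt_b ?mulr0 // ltn_subLR ?ltn_add2r //.
  by rewrite -ltnS.
by case/eqP: neq_ia; apply: val_inj.
Qed.
HB.instance Definition _ := GRing.ComUnitRing_isIntegral.Build (fps F) fps_integral.

End PowerSeries.

(* C((hbar)), as the field of fractions of C[[hbar]] *)
Notation ground_field R := {fraction (fps R[i])}.

Section Curves.
Variable N : nat.

(* A lattice path from (0,0) is the word of its steps: false is M_2 (right),
   true is M_3 (up). *)
Definition point (w : seq bool) (k : nat) : nat * nat :=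
  (count negb (take k w), count id (take k w)).

(* A simple closed curve is encoded by its two arcs, the one starting with M_3
   first.  After k steps both arcs are on the line x + y = k, so they can only
   meet after the same number of steps. *)
Definition is_curve (w : N.*2.-tuple bool * N.*2.-tuple bool) : bool :=
  [&& head false w.1, point w.1 N.*2 == (N, N), point w.2 N.*2 == (N, N)
    & [forall k : 'I_N.*2, (0 < k)%N ==> (point w.1 k != point w.2 k)]].

Definition curve := {w : N.*2.-tuple bool * N.*2.-tuple bool | is_curve w}.
HB.instance Definition _ := Finite.on curve.
HB.instance Definition _ := SubType.on curve.

Definition upper (s : curve) : seq bool := (val s).1.
Definition lower (s : curve) : seq bool := (val s).2.

(* The reflection (x, y) |-> (N - y, N - x) reverses a path and exchanges the
   two kinds of steps. *)
Definition reflect_path (w : seq bool) : seq bool := rev (map negb w).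

Definition symmetric_curve (s : curve) : bool :=
  (reflect_path (upper s) == upper s) && (reflect_path (lower s) == lower s).

Definition cuts (a b : nat) (s : curve) : bool :=
  perm_eq [:: point (upper s) N; point (lower s) N]
          [:: (N - a, a); (N - b, b)]%N.

Definition Sref (a b : nat) : {set curve} :=
  [set s | symmetric_curve s && cuts a b s].

Definition lhalf (s : curve) : seq bool * seq bool :=
  (take N (upper s), take N (lower s)).
Definition rhalf (s : curve) : seq bool * seq bool :=
  (take N (reflect_path (upper s)), take N (reflect_path (lower s))).

Implicit Types s t u : curve.

Let size_up s : size (upper s) = N.*2. Proof. exact: size_tuple. Qed.
Let size_lo s : size (lower s) = N.*2. Proof. exact: size_tuple. Qed.
Let le_N2 : (N <= N.*2)%N. Proof. by rewrite -addnn leq_addr. Qed.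
Let subN2 : (N.*2 - N = N)%N. Proof. by rewrite -addnn addnK. Qed.

Lemma curveP s :
  [/\ head false (upper s), point (upper s) N.*2 = (N, N),
      point (lower s) N.*2 = (N, N)
    & forall k, (0 < k < N.*2)%N -> point (upper s) k != point (lower s) k].
Proof.
have /and4P[hd /eqP pu /eqP pl /forallP neq] := valP s; split=> // k.
by case/andP=> k0 kN; have /implyP/(_ k0) := neq (Ordinal kN).
Qed.

Lemma mk_curve (a b : seq bool) :
  size a = N.*2 -> size b = N.*2 -> head false a ->
  point a N.*2 = (N, N) -> point b N.*2 = (N, N) ->
  (forall k, (0 < k < N.*2)%N -> point a k != point b k) ->
  exists s, upper s = a /\ lower s = b.
Proof.
move=> /eqP sa /eqP sb hd pa pb neq.
have c : is_curve (Tuple sa, Tuple sb).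
  rewrite /is_curve /= hd pa pb eqxx /=; apply/forallP=> k; apply/implyP=> k0.
  by apply: neq; rewrite k0 /=.
by exists (exist (fun w => is_true (is_curve w)) _ c).
Qed.

Let reflect_take (w : seq bool) k : size w = N.*2 ->
  take k (reflect_path w) = reflect_path (drop (N.*2 - k) w).
Proof. by move=> sw; rewrite /reflect_path take_rev size_map sw map_drop. Qed.

Let count_reflect p (w : seq bool) :
  count p (reflect_path w) = count (fun b => p (~~ b)) w.
Proof. by rewrite /reflect_path count_rev count_map. Qed.

Let reflect_pathK : involutive reflect_path.
Proof. by move=> w; rewrite /reflect_path map_rev revK mapK //; exact: negbK. Qed.

Let point_drop (w : seq bool) k : size w = N.*2 -> point w N.*2 = (N, N) ->
  count negb (drop k w) = (N - count negb (take k w))%N /\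
  count id (drop k w) = (N - count id (take k w))%N.
Proof.
rewrite /point => sw; rewrite take_oversize ?sw // => -[cn ci]; split.
  by rewrite -[in RHS]cn -[in X in (X - _)%N](cat_take_drop k w) count_cat addKn.
by rewrite -[in RHS]ci -[in X in (X - _)%N](cat_take_drop k w) count_cat addKn.
Qed.

Let count_take_le (w : seq bool) k : size w = N.*2 -> point w N.*2 = (N, N) ->
  (count negb (take k w) <= N)%N /\ (count id (take k w) <= N)%N.
Proof.
rewrite /point => sw; rewrite take_oversize ?sw // => -[cn ci]; split.
  by rewrite -[X in (_ <= X)%N]cn -{2}(cat_take_drop k w) count_cat leq_addr.
by rewrite -[X in (_ <= X)%N]ci -{2}(cat_take_drop k w) count_cat leq_addr.
Qed.

Let point_reflect (w : seq bool) k : size w = N.*2 -> point w N.*2 = (N, N) ->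
  point (reflect_path w) k =
    (N - (point w (N.*2 - k)).2, N - (point w (N.*2 - k)).1)%N.
Proof.
move=> sw pw; rewrite /point reflect_take // !count_reflect /=.
have [cn ci] := point_drop (N.*2 - k) sw pw; rewrite -cn -ci.
by congr (_, _); apply: eq_count => b; rewrite negbK.
Qed.

Let upper_above s k :
  (k.+1 < N.*2)%N -> ((point (lower s) k.+1).2 < (point (upper s) k.+1).2)%N.
Proof.
have [hd _ _ neq] := curveP s.
have countC (w : seq bool) : count negb w = (size w - count id w)%N.
  by rewrite -(count_predC id w) addKn.
have neq2 j : (0 < j < N.*2)%N ->
    count id (take j (upper s)) != count id (take j (lower s)).
  move=> jN; apply: contra (neq j jN) => /eqP e; rewrite /point !countC e.
  by rewrite !size_take size_up size_lo.
have take1 (w : seq bool) j : size w = N.*2 -> (j < N.*2)%N ->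
    count id (take j.+1 w) = (count id (take j w) + nth false w j)%N.
  move=> sw jN; rewrite (take_nth false) ?sw // -cats1 count_cat /=.
  by rewrite addn0.
elim: k => [|k IHk] kN /=.
  have := neq2 1%N; rewrite kN => /(_ isT).
  rewrite !take1 ?size_up ?size_lo ?(ltnW kN) // !take0 /= !add0n nth0 hd.
  by case: (nth _ _ _).
have := neq2 k.+2; rewrite kN => /(_ isT).
have := IHk (ltnW kN); rewrite /= (take1 _ k.+1) ?size_lo ?(ltnW kN) //.
rewrite (take1 _ k.+1) ?size_up ?(ltnW kN) //.
move: (count id (take k.+1 (upper s))) (count id (take k.+1 (lower s))) => x y.
by case: (nth _ _ _); case: (nth _ _ _) => /=; rewrite ?addn0 ?addn1; lia.
Qed.

Definition cut s := (point (upper s) N, point (lower s) N).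

Let lhalf_cut s t : lhalf s = lhalf t -> cut s = cut t.
Proof. by rewrite /lhalf /cut /point => -[-> ->]. Qed.

Let rhalfE s : rhalf s = (reflect_path (drop N (upper s)),
                          reflect_path (drop N (lower s))).
Proof. by rewrite /rhalf !reflect_take ?size_up ?size_lo // subN2. Qed.

Let rhalf_cut s t : rhalf s = rhalf t -> cut s = cut t.
Proof.
rewrite !rhalfE => -[/(can_inj reflect_pathK) du /(can_inj reflect_pathK) dl].
have [_ pus pls _] := curveP s; have [_ put plt _] := curveP t.
have half (w : seq bool) : size w = N.*2 -> point w N.*2 = (N, N) ->
    point w N = (N - count negb (drop N w), N - count id (drop N w))%N.
  move=> sw pw; have [-> ->] := point_drop N sw pw.
  have [? ?] := count_take_le N sw pw.
  by rewrite !subKn.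
by rewrite /cut !half ?size_up ?size_lo // du dl.
Qed.

Lemma half_inj s t : lhalf s = lhalf t -> rhalf s = rhalf t -> s = t.
Proof.
rewrite !rhalfE => -[tu tl].
case=> [/(can_inj reflect_pathK) du /(can_inj reflect_pathK) dl].
apply: val_inj; case E: (val s) => [a b]; case E' : (val t) => [a' b'].
congr (_, _); apply: val_inj.
  have -> : val a = upper s by rewrite /upper E.
  have -> : val a' = upper t by rewrite /upper E'.
  by rewrite -(cat_take_drop N (upper s)) tu du cat_take_drop.
have -> : val b = lower s by rewrite /lower E.
have -> : val b' = lower t by rewrite /lower E'.
by rewrite -(cat_take_drop N (lower s)) tl dl cat_take_drop.
Qed.

Let exists_reflect s :
  exists t, [/\ lhalf t = rhalf s, rhalf t = lhalf s & cut t = cut s].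
Proof.
have [hd pu pl neq] := curveP s.
have [||||||t [ut lt]] := @mk_curve (reflect_path (upper s)) (reflect_path (lower s)).
- by rewrite size_rev size_map size_up.
- by rewrite size_rev size_map size_lo.
- have N0 : (0 < N)%N.
    by move: hd (size_up s); case: (upper s) => // b w _ /=; case: (N).
  have N1 : (N.*2.-1.+1 = N.*2)%N by rewrite prednK // double_gt0.
  have N2 : (N.*2.-2.+1 = N.*2.-1)%N by case: (N) N0.
  have := @upper_above s N.*2.-2; rewrite N2 N1 leqnn => /(_ isT) /=.
  have [_ cu] := point_drop N.*2.-1 (size_up s) pu.
  have [_ cl] := point_drop N.*2.-1 (size_lo s) pl.
  have [_ le_u] := count_take_le N.*2.-1 (size_up s) pu.
  have [_ le_l] := count_take_le N.*2.-1 (size_lo s) pl.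
  have last1 w : size w = N.*2 -> drop N.*2.-1 w = [:: last false w].
    move=> sw; rewrite (drop_nth false) ?sw ?N1 // drop_oversize ?sw ?N1 //.
    by rewrite -nth_last sw.
  move: cu cl; rewrite !last1 ?size_up ?size_lo //= !addn0 => cu cl lt_lu.
  rewrite /reflect_path -nth0 nth_rev size_map size_up ?double_gt0 //.
  rewrite subn1 (nth_map false) ?size_up ?N1 //.
  have -> : nth false (upper s) N.*2.-1 = last false (upper s).
    by rewrite -nth_last size_up.
  by move: cu cl; do 2!case: (last _ _) => /=; lia.
- by rewrite point_reflect ?size_up // subnn /point !take0 /= subn0.
- by rewrite point_reflect ?size_lo // subnn /point !take0 /= subn0.
- move=> k kN; rewrite !point_reflect ?size_up ?size_lo //.
  have kN' : (0 < N.*2 - k < N.*2)%N by lia.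
  apply: contra (neq _ kN') => /eqP[e1 e2].
  have [? ?] := count_take_le (N.*2 - k) (size_up s) pu.
  have [? ?] := count_take_le (N.*2 - k) (size_lo s) pl.
  by apply/eqP; congr (_, _); lia.
exists t; rewrite /lhalf /rhalf /cut ut lt; split=> //.
  by rewrite !reflect_pathK.
have half (w : seq bool) : size w = N.*2 -> point w N.*2 = (N, N) ->
    point (reflect_path w) N = point w N.
  move=> sw pw; rewrite point_reflect // subN2 /point /=.
  have := count_predC id (take N w); rewrite size_takel ?sw //.
  have -> : count (predC id) (take N w) = count negb (take N w) by apply: eq_count.
  by move=> e; congr (_, _); lia.
by rewrite !half ?size_up ?size_lo.
Qed.

Let exists_glue s t : cut s = cut t ->
  exists u, lhalf u = lhalf s /\ rhalf u = rhalf t.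
Proof.
case=> un ui ln li.
have [hds pus pls neqs] := curveP s; have [hdt put plt neqt] := curveP t.
have N0 : (0 < N)%N.
  by move: hds (size_up s); case: (upper s) => // b w _ /=; case: (N).
pose g (v w : seq bool) := take N v ++ drop N w.
have sg v w : size v = N.*2 -> size w = N.*2 -> size (g v w) = N.*2.
  by move=> sv sw; rewrite size_cat size_take size_drop sv sw; case: ltnP; lia.
have stake v : size v = N.*2 -> size (take N v) = N.
  by move=> sv; rewrite size_takel ?sv.
have takel v w k : size v = N.*2 -> (k <= N)%N -> take k (g v w) = take k v.
  by move=> sv kN; rewrite takel_cat ?stake // take_takel.
have pg v w k : size v = N.*2 -> size w = N.*2 -> point v N = point w N ->
    point (g v w) k = if (k <= N)%N then point v k else point w k.
  move=> sv sw [en ei]; case: leqP => kN; first by rewrite /point takel.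
  rewrite /point /g take_cat stake // ltnNge (ltnW kN) /= !count_cat en ei.
  rewrite -!count_cat; have -> : take N w ++ take (k - N) (drop N w) = take k w.
    by rewrite -takeD subnKC // ltnW.
  by [].
have eu : point (upper s) N = point (upper t) N by rewrite /point un ui.
have el : point (lower s) N = point (lower t) N by rewrite /point ln li.
have [||||||u [uu lu]] := @mk_curve (g (upper s) (upper t)) (g (lower s) (lower t)).
- by rewrite sg ?size_up.
- by rewrite sg ?size_lo.
- by move: hds; rewrite -!nth0 /g nth_cat stake ?size_up // N0 nth_take.
- by rewrite pg ?size_up //; case: leqP.
- by rewrite pg ?size_lo //; case: leqP.
- move=> k kN; rewrite !pg ?size_up ?size_lo //.
  by case: leqP => _; [apply: neqs | apply: neqt].
exists u; rewrite !rhalfE /lhalf uu lu; split.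
  by rewrite !takel ?size_up ?size_lo.
by rewrite /g !drop_size_cat ?stake ?size_up ?size_lo.
Qed.

Lemma symmetric_halves s : symmetric_curve s = (lhalf s == rhalf s).
Proof.
have half w : size w = N.*2 ->
    (reflect_path w == w) = (take N w == take N (reflect_path w)).
  move=> sw; apply/eqP/eqP => [->//|e].
  rewrite -[LHS](cat_take_drop N) -[RHS](cat_take_drop N) -e; congr (_ ++ _).
  move: e; rewrite reflect_take // subN2 => e.
  rewrite -[RHS]reflect_pathK -e /reflect_path drop_rev size_map sw subN2.
  by rewrite map_take.
by rewrite /symmetric_curve !half ?size_up ?size_lo.
Qed.

(* [glue s t] has the left half of s and the right half of t. *)
Definition glue s t : curve :=
  odflt s [pick u | (lhalf u == lhalf s) && (rhalf u == rhalf t)].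

Lemma glueP s t : rhalf s = lhalf t ->
  lhalf (glue s t) = lhalf s /\ rhalf (glue s t) = rhalf t.
Proof.
move=> e; rewrite /glue; case: pickP => [u /andP[/eqP ? /eqP ?] //|none].
have [s' [ls' _ cs']] := exists_reflect s.
have [|u [lu ru]] := @exists_glue s t; last by have := none u; rewrite lu ru !eqxx.
by rewrite -cs'; apply: lhalf_cut; rewrite ls'.
Qed.

Lemma glue_unique s t u : rhalf s = lhalf t ->
  (lhalf u == lhalf s) && (rhalf u == rhalf t) = (u == glue s t).
Proof.
move=> /glueP[lg rg]; apply/andP/eqP => [[/eqP lu /eqP ru]|->].
  by apply: half_inj; rewrite ?lg ?rg.
by rewrite lg rg !eqxx.
Qed.

Lemma exists_symmetric s : exists u, lhalf u = lhalf s /\ rhalf u = lhalf s.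
Proof.
have [s' [ls' rs' _]] := exists_reflect s.
by exists (glue s s'); rewrite -{2}rs'; apply: glueP; rewrite ls'.
Qed.

Lemma exists_symmetric_r s : exists u, lhalf u = rhalf s /\ rhalf u = rhalf s.
Proof.
have [s' [ls' _ _]] := exists_reflect s.
by have := exists_symmetric s'; rewrite ls'.
Qed.

End Curves.

Definition curve_alg (K : fieldType) (N : nat) := {ffun curve N -> K}.

Section CurveAlgebra.
Variables (K : fieldType) (N : nat).
Local Notation CA := (curve_alg K N).
Implicit Types (f g h : CA) (s t u : curve N).

HB.instance Definition _ := GRing.Zmodule.on CA.

Definition curve_scale (a : K) f : CA := [ffun s => a * f s].
Fact curve_scaleA a b f :
  curve_scale a (curve_scale b f) = curve_scale (a * b) f.
Proof. by apply/ffunP => s; rewrite !ffunE mulrA. Qed.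
Fact curve_scale1 : left_id 1 curve_scale.
Proof. by move=> f; apply/ffunP => s; rewrite ffunE mul1r. Qed.
Fact curve_scaleDr : right_distributive curve_scale +%R.
Proof. by move=> a f g; apply/ffunP => s; rewrite !ffunE mulrDr. Qed.
Fact curve_scaleDl f : {morph curve_scale^~ f : a b / a + b}.
Proof. by move=> a b; apply/ffunP => s; rewrite !ffunE mulrDl. Qed.
HB.instance Definition _ := GRing.Zmodule_isLmodule.Build K CA
  curve_scaleA curve_scale1 curve_scaleDr curve_scaleDl.

Definition star s : CA := [ffun u => (u == s)%:R].

(* Cutting s along the secondary diagonal and reflecting its second half turns
   s into the pair (lhalf s, rhalf s); with respect to these pairs of indices
   this is the product of matrices. *)
Definition curve_mul f g : CA :=
  [ffun u => \sum_s \sum_(t | [&& lhalf s == lhalf u, rhalf s == lhalf t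
                                & rhalf t == rhalf u]) f s * g t].

Definition curve_one : CA := \sum_(s | symmetric_curve s) star s.

Lemma curve_mulE f g u : curve_mul f g u =
  \sum_s \sum_(t | rhalf s == lhalf t) f s * g t * (u == glue s t)%:R.
Proof.
rewrite ffunE; apply: eq_bigr => s _.
rewrite [LHS]big_mkcond [RHS]big_mkcond; apply: eq_bigr => t _ /=.
have [e|_] := eqVneq (rhalf s) (lhalf t); last by rewrite andbF.
rewrite -(glue_unique u e) eq_sym [rhalf t == _]eq_sym /=.
by case: ifP; rewrite (mulr1, mulr0).
Qed.

Lemma sum_curve_mul f g (H : curve N -> K) :
  \sum_u curve_mul f g u * H u =
  \sum_s \sum_(t | rhalf s == lhalf t) f s * g t * H (glue s t).
Proof.
under eq_bigr => u _ do rewrite curve_mulE mulr_suml.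
rewrite exchange_big; apply: eq_bigr => s _ /=.
under eq_bigr => u _ do rewrite mulr_suml.
rewrite exchange_big; apply: eq_bigr => t _ /=.
rewrite (bigD1 (glue s t)) //= eqxx mulr1 big1 ?addr0 // => u /negPf->.
by rewrite mulr0 mul0r.
Qed.

Lemma curve_mulA : associative curve_mul.
Proof.
move=> f g h; apply/ffunP => u.
pose T s t v := f s * g t * h v *
  [&& rhalf s == lhalf t, rhalf t == lhalf v, lhalf s == lhalf u
    & rhalf v == rhalf u]%:R.
transitivity (\sum_s \sum_t \sum_v T s t v).
  rewrite curve_mulE; apply: eq_bigr => s _.
  transitivity (\sum_t curve_mul g h t * (f s * ((rhalf s == lhalf t) && (u == glue s t))%:R)).
    rewrite big_mkcond; apply: eq_bigr => t _; case: ifP => _.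
      by rewrite mulrA [_ * f s]mulrC.
    by rewrite !mulr0.
  rewrite sum_curve_mul; apply: eq_bigr => t _; rewrite big_mkcond.
  apply: eq_bigr => v _; rewrite /T; case: eqP => [e|_]; last first.
    by rewrite andbF mulr0.
  have [lg rg] := glueP e; rewrite lg /=.
  have [e'|_] := eqVneq (rhalf s) (lhalf t); last by rewrite !mulr0.
  rewrite -(@glue_unique _ s (glue t v)) ?lg // rg /=.
  by rewrite [_ == lhalf s]eq_sym [_ == rhalf v]eq_sym; ring.
symmetry; rewrite curve_mulE.
transitivity (\sum_s curve_mul f g s *
   \sum_v h v * ((rhalf s == lhalf v) && (u == glue s v))%:R).
  apply: eq_bigr => s _; rewrite big_mkcond mulr_sumr.
  by apply: eq_bigr => v _; case: ifP => _; rewrite ?mulr0 // mulrA.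
rewrite sum_curve_mul; apply: eq_bigr => s _; rewrite big_mkcond.
apply: eq_bigr => t _ /=; case: eqP => [e|ne]; last first.
  by rewrite big1 // => v _; rewrite /T; case: eqP ne => //= _ _; rewrite mulr0.
rewrite mulr_sumr; apply: eq_bigr => v _; rewrite /T e eqxx /=.
have [lg rg] := glueP e; rewrite rg.
case: eqP => [e'|_] /=; last by rewrite !mulr0.
rewrite -glue_unique ?rg // lg.
by rewrite [_ == lhalf s]eq_sym [_ == rhalf v]eq_sym; ring.
Qed.

Lemma curve_oneE u : curve_one u = (symmetric_curve u)%:R.
Proof.
rewrite sum_ffunE; under eq_bigr => s _ do rewrite ffunE.
have [su|nsu] := boolP (symmetric_curve u).
  rewrite (bigD1 u) //= eqxx big1 ?addr0 // => s /andP[_ /negPf].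
  by rewrite eq_sym => ->.
by rewrite big1 // => s ss; case: eqP ss nsu => // -> ->.
Qed.

Lemma curve_mul1 : left_id curve_one curve_mul.
Proof.
move=> f; apply/ffunP => u; rewrite ffunE.
have [s0 [ls0 rs0]] := exists_symmetric u.
have ss0 : symmetric_curve s0 by rewrite symmetric_halves ls0 rs0.
rewrite (bigD1 s0) //= [X in _ + X]big1 ?addr0 => [|s ns].
  rewrite (bigD1 u) ?ls0 ?rs0 ?eqxx //= big1 ?addr0 => [|t].
    by rewrite curve_oneE ss0 mul1r.
  case/andP=> /andP[/eqP e /eqP e'] /negP[].
  by apply/eqP/half_inj.
rewrite big1 // => t /and3P[/eqP ls _ _]; rewrite curve_oneE.
rewrite symmetric_halves; case: eqP => [e|_]; last by rewrite mul0r.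
by case/eqP: ns; apply: half_inj; rewrite -?e ls ?ls0 ?rs0.
Qed.

Lemma curve_mulr1 : right_id curve_one curve_mul.
Proof.
move=> f; apply/ffunP => u; rewrite ffunE.
have [s0 [ls0 rs0]] := exists_symmetric_r u.
have ss0 : symmetric_curve s0 by rewrite symmetric_halves ls0 rs0.
rewrite (exchange_big_dep xpredT) //= (bigD1 s0) //= [X in _ + X]big1 ?addr0 => [|s ns].
  rewrite (bigD1 u) ?ls0 ?rs0 ?eqxx //= big1 ?addr0 => [|t].
    by rewrite curve_oneE ss0 mulr1.
  case/andP=> /and3P[/eqP e /eqP e' _] /negP[].
  by apply/eqP/half_inj.
rewrite big1 // => t /and3P[_ _ /eqP rs]; rewrite curve_oneE.
rewrite symmetric_halves; case: eqP => [e|_]; last by rewrite mulr0.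
by case/eqP: ns; apply: half_inj; rewrite ?e rs ?ls0 ?rs0.
Qed.

Lemma curve_mulDl : left_distributive curve_mul +%R.
Proof.
move=> f g h; apply/ffunP => u; rewrite !ffunE -big_split; apply: eq_bigr => s _.
by rewrite -big_split; apply: eq_bigr => t _; rewrite ffunE mulrDl.
Qed.

Lemma curve_mulDr : right_distributive curve_mul +%R.
Proof.
move=> f g h; apply/ffunP => u; rewrite !ffunE -big_split; apply: eq_bigr => s _.
by rewrite -big_split; apply: eq_bigr => t _; rewrite ffunE mulrDr.
Qed.

HB.instance Definition _ := GRing.Zmodule_isPzRing.Build CA
  curve_mulA curve_mul1 curve_mulr1 curve_mulDl curve_mulDr.

Lemma star_mul s t :
  star s * star t = if rhalf s == lhalf t then star (glue s t) else 0.
Proof.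
apply/ffunP => u; rewrite [LHS]curve_mulE (bigD1 s) //= [X in _ + X]big1; last first.
  by move=> s' /negPf ns; rewrite big1 // => t' _; rewrite ffunE ns !mul0r.
rewrite addr0 big_mkcond (bigD1 t) //= big1 ?addr0; last first.
  move=> t' /negPf nt; case: ifP => // _.
  by rewrite [star t _]ffunE nt mulr0 mul0r.
by case: ifP => _; rewrite !ffunE // !eqxx !mul1r.
Qed.

End CurveAlgebra.

Section QuantumGroup.
Variable R : realType.
Local Notation C := R[i].
Local Notation K := (ground_field R).

Definition ground_const (c : C) : K := tofrac ((fun m => if m is 0%N then c else 0) : fps C).

(* q ^ c = exp (c hbar / 2) *)
Definition qpow (c : C) : K := tofrac ((fun m => (c / 2%:R) ^+ m / m`!%:R) : fps C).

Definition q_hbar : K := qpow 1.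

(* In an index i : 'I_2, 0 and 1 stand for the generators numbered 1 and 2. *)
Definition cartan (i j : 'I_2) : K :=
  if i == j then (if i == 0 then 2%:R else 0) else - 1.
Definition odd_gen (i : 'I_2) : bool := i == 1.

(* Q is q^X = exp (hbar X / 2), which is only given a meaning for X
   diagonalizable with eigenvalues in C: it then acts as q^c on the
   eigenspace of the eigenvalue c. *)
Definition is_qpow_mx d (X Q : 'M[K]_d) : Prop :=
  exists (S : 'M[K]_d) (c : 'I_d -> C),
    [/\ S \in unitmx,
        X = S *m diag_mx (\row_j ground_const (c j)) *m invmx S
      & Q = S *m diag_mx (\row_j qpow (c j)) *m invmx S].

(* Operators on the space of column vectors: the generators E_i, F_i, h_i, the
   operators q^(h_i), and the parity v |-> (-1)^|v| v. *)
Record uq_data := UqData {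
  uq_dim : nat;
  uq_E : 'I_2 -> 'M[K]_uq_dim;
  uq_F : 'I_2 -> 'M[K]_uq_dim;
  uq_h : 'I_2 -> 'M[K]_uq_dim;
  uq_q : 'I_2 -> 'M[K]_uq_dim;
  uq_par : 'M[K]_uq_dim }.

Definition sbracket d (odd_both : bool) (A B : 'M[K]_d) : 'M[K]_d :=
  A *m B - (-1) ^+ odd_both *: (B *m A).

Definition serre d (A B : 'M[K]_d) : 'M[K]_d :=
  A *m A *m B - (q_hbar + q_hbar^-1) *: (A *m B *m A) + B *m A *m A.

Record is_uq_module (M : uq_data) : Prop := IsUqModule {
  uq_parK : uq_par M *m uq_par M = 1%:M;
  uq_parE i : uq_par M *m uq_E M i = (-1) ^+ odd_gen i *: (uq_E M i *m uq_par M);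
  uq_parF i : uq_par M *m uq_F M i = (-1) ^+ odd_gen i *: (uq_F M i *m uq_par M);
  uq_parh i : uq_par M *m uq_h M i = uq_h M i *m uq_par M;
  uq_qh i : is_qpow_mx (uq_h M i) (uq_q M i);
  uq_hh i j : sbracket false (uq_h M i) (uq_h M j) = 0;
  uq_hE i j : sbracket false (uq_h M i) (uq_E M j) = cartan i j *: uq_E M j;
  uq_hF i j : sbracket false (uq_h M i) (uq_F M j) = - cartan i j *: uq_F M j;
  uq_EF i j : sbracket (odd_gen i && odd_gen j) (uq_E M i) (uq_F M j) =
    if i == j then (q_hbar - q_hbar^-1)^-1 *: (uq_q M i - invmx (uq_q M i)) else 0;
  uq_E2 : uq_E M 1 *m uq_E M 1 = 0;
  uq_F2 : uq_F M 1 *m uq_F M 1 = 0;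
  uq_serreE : serre (uq_E M 0) (uq_E M 1) = 0;
  uq_serreF : serre (uq_F M 0) (uq_F M 1) = 0 }.

(* The coproduct, acting by (x # y) (v # w) = (-1)^(|y| |v|) x v # y w
   (# being the tensor product): [koszul M i] is the sign (-1)^|v| when the
   right-hand factor y is odd. *)
Definition koszul (M : uq_data) (i : 'I_2) : 'M[K]_(uq_dim M) :=
  if odd_gen i then uq_par M else 1%:M.

Definition uq_tens (M N : uq_data) : uq_data := {|
  uq_dim := uq_dim M * uq_dim N;
  uq_E := fun i => uq_E M i *t 1%:M
                 + (invmx (uq_q M i) *m koszul M i) *t uq_E N i;
  uq_F := fun i => uq_F M i *t uq_q N i + koszul M i *t uq_F N i;
  uq_h := fun i => uq_h M i *t 1%:M + 1%:M *t uq_h N i;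
  uq_q := fun i => uq_q M i *t uq_q N i;
  uq_par := uq_par M *t uq_par N |}.

(* n.+1 tensor factors *)
Fixpoint uq_tpow (M : uq_data) (n : nat) : uq_data :=
  if n is m.+1 then uq_tens (uq_tpow M m) M else M.

Section Module.
Variable M : uq_data.
Local Notation d := (uq_dim M).
Implicit Types (v : 'cV[K]_d) (W U : {vspace 'cV[K]_d}).

Definition submodule W : Prop := forall v, v \in W ->
  [/\ uq_par M *m v \in W, forall i, uq_E M i *m v \in W,
      forall i, uq_F M i *m v \in W & forall i, uq_h M i *m v \in W].

Definition simple_submodule W : Prop :=
  [/\ submodule W, W != 0%VS
    & forall U, submodule U -> (U <= W)%VS -> U = 0%VS \/ U = W].

Definition highest_weight_vector (a : 'I_2 -> C) v : Prop :=
  [/\ v != 0, uq_par M *m v = v \/ uq_par M *m v = - v,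
      forall i, uq_h M i *m v = ground_const (a i) *: v & forall i, uq_E M i *m v = 0].

(* W is a copy of V(a1, a2): a simple module generated by a highest weight
   vector of weight (a1, a2).  The parity of that vector is not prescribed. *)
Definition is_V (a1 a2 : C) W : Prop :=
  simple_submodule W /\
  exists v, [/\ v \in W,
    highest_weight_vector (fun i => if i == 0 then a1 else a2) v
    & forall U, submodule U -> v \in U -> (W <= U)%VS].

(* U is the sum of all submodules that are copies of V(a1, a2). *)
Definition is_isotypic_component (a1 a2 : C) U : Prop :=
  (forall W, is_V a1 a2 W -> (W <= U)%VS) /\
  forall U', (forall W, is_V a1 a2 W -> (W <= U')%VS) -> (U <= U')%VS.

Definition uq_equivariant : {pred 'M[K]_d} := [pred f : 'M[K]_d |
  [&& f *m uq_par M == uq_par M *m f,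
      [forall i, f *m uq_E M i == uq_E M i *m f],
      [forall i, f *m uq_F M i == uq_F M i *m f]
    & [forall i, f *m uq_h M i == uq_h M i *m f]]].

Lemma uq_equivariantP (f : 'M[K]_d) :
  reflect [/\ f *m uq_par M = uq_par M *m f,
      forall i, f *m uq_E M i = uq_E M i *m f,
      forall i, f *m uq_F M i = uq_F M i *m f
    & forall i, f *m uq_h M i = uq_h M i *m f]
  (f \in uq_equivariant).
Proof.
apply: (iffP and4P).
  by case=> /eqP p /forallP e /forallP f' /forallP h; split=> // i; apply/eqP.
by case=> p e f' h; split; [apply/eqP| | |]; try (apply/forallP => i; apply/eqP).
Qed.

Fact uq_equivariant_subring : subring_closed uq_equivariant.
Proof.
split=> [|f g /uq_equivariantP[fp fE fF fh] /uq_equivariantP[gp gE gF gh]|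
          f g /uq_equivariantP[fp fE fF fh] /uq_equivariantP[gp gE gF gh]].
- by apply/uq_equivariantP; split=> *; rewrite -?idmxE mul1mx mulmx1.
- by apply/uq_equivariantP; split=> *;
    rewrite mulmxBl mulmxBr ?fp ?gp ?fE ?gE ?fF ?gF ?fh ?gh.
apply/uq_equivariantP; rewrite -mulmxE; split=> [|i|i|i]; rewrite -mulmxA.
- by rewrite gp mulmxA fp mulmxA.
- by rewrite gE mulmxA fE mulmxA.
- by rewrite gF mulmxA fF mulmxA.
- by rewrite gh mulmxA fh mulmxA.
Qed.

Fact uq_equivariant_submod : submod_closed uq_equivariant.
Proof.
split=> [|a f g /uq_equivariantP[fp fE fF fh] /uq_equivariantP[gp gE gF gh]].
  by apply/uq_equivariantP; split=> *; rewrite mul0mx mulmx0.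
apply/uq_equivariantP; split=> *; rewrite mulmxDl mulmxDr -scalemxAl -scalemxAr.
- by rewrite fp gp.
- by rewrite fE gE.
- by rewrite fF gF.
- by rewrite fh gh.
Qed.

Definition uqEnd := {f : 'M[K]_d | f \in uq_equivariant}.
HB.instance Definition _ := SubChoice.on uqEnd.
HB.instance Definition _ := GRing.SubChoice_isSubPzRing.Build
  'M[K]_d uq_equivariant uqEnd uq_equivariant_subring.
HB.instance Definition _ := GRing.SubZmodule_isSubLmodule.Build
  K 'M[K]_d uq_equivariant uqEnd uq_equivariant_submod.

Definition uq_image (f : uqEnd) : {vspace 'cV[K]_d} := limg (linfun (mulmx (val f))).

(* In a semisimple module an isotypic component has only one stable complement,
   so that this determines p. *)
Definition is_isotypic_projector (a1 a2 : C) (p : uqEnd) : Prop :=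
  p * p = p /\ is_isotypic_component a1 a2 (uq_image p).

End Module.
End QuantumGroup.

(* Main.v *)
(* The module V = V(0, alpha) is four-dimensional, with lowest vector vl = F2 F1 F2 v.
   For every module M, m |-> E2 E1 E2 (m (x) vl) is injective from M to M (x) V, and
   it maps the vectors killed by E1 to highest weight vectors.  A typical component
   V(x, a) of M contains, up to scalars, the vectors w, F2 w, F2 F1 F2 w and, if
   x > 0, [x] F1 F2 w - [x + 1] F2 F1 w killed by E1, which gives highest weight
   vectors of M (x) V with highest weights shifted by the four pairs of steps of two
   lattice paths that do not meet.  By typicality the highest weight vectors so
   obtained in the tensor power generate independent simple submodules, which fill
   the space by a dimension count.  They are indexed by pairs of half-paths, so that
   the intertwiners are matrices indexed by pairs of halves with the same end points,
   that is, by curves. *)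
Require Import Defs.
From mathcomp Require Import all_boot all_order all_algebra.
From mathcomp Require Import complex reals.
From mathcomp Require Import boolp mxtens ring zify.
Set Implicit Arguments. Unset Strict Implicit. Unset Printing Implicit Defensive.
Import Order.TTheory GRing.Theory Num.Theory.
Local Open Scope ring_scope.

(** * Weights and the quantum group action *)

(** No decomposition theorem is available: semisimplicity, the dimension 4 (x + 1) of a typical V(x,
    a), and even the dimension of V(0, alpha) must come out of explicit vectors. The tool is the
    pair Om = E2 E1 E2, OmF = F2 F1 F2. As E2 squares to zero, the Serre relation makes Om commute
    with E1, and E2 Om = 0; this is why Om turns vectors killed by E1 into highest weight vectors.
    Moreover Om OmF multiplies a highest weight vector of weight (b, c) by [c] [b + c + 1]. For the
    weights (x, (n + 1) alpha + y) this scalar is nonzero, alpha being irrational, and this one fact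
    yields the independence of the 4 (x + 1) vectors, the simplicity of the module they span, and
    the determination of all highest weight vectors of a given weight. The last point shows that an
    intertwiner is no more than a matrix for each weight. *)

Lemma basis_of_free (F : fieldType) d d' (J : eqType) (s : seq J) (b : J -> 'cV[F]_d) :
  size s = d ->
  (forall c, \sum_(j <- s) c j *: b j = 0 -> {in s, forall j, c j = 0}) -> uniq s ->
  (forall u, exists c, u = \sum_(j <- s) c j *: b j) /\
  (forall g : J -> 'cV[F]_d', exists f : 'M_(d', d), {in s, forall j, f *m b j = g j}).
Proof.
case: s => [|j0 s0] sd free Us.
  subst d; split=> [u|g]; last by exists 0.
  by exists (fun=> 0); rewrite big_nil; apply/colP => -[].
set s := j0 :: s0 in sd free Us *.
pose B : 'M_d := \matrix_(i, j) b (nth j0 s j) i 0.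
have BE (y : 'cV_d) : B *m y = \sum_(j < d) y j 0 *: b (nth j0 s j).
  apply/colP => i; rewrite !mxE summxE; apply: eq_bigr => j _.
  by rewrite !mxE mulrC.
have sumE (y : 'cV_d) : B *m y =
    \sum_(j <- s) (if insub (index j s) is Some i then y i 0 else 0) *: b j.
  rewrite BE (big_nth j0) big_mkord.
  rewrite sd; apply: eq_bigr => j _; rewrite index_uniq ?sd //.
  by rewrite valK.
have Bu : B \in unitmx.
  rewrite -unitmx_tr -row_free_unit; apply: inj_row_free => y yB.
  have := free _ (esym (etrans (esym _) (sumE y^T))).
  rewrite -[B *m _]trmxK trmx_mul trmxK yB trmx0 => /(_ erefl) y0.
  apply/rowP => j; rewrite mxE.
  have := y0 (nth j0 s j); rewrite mem_nth ?sd // => /(_ isT).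
  by rewrite index_uniq ?sd // valK mxE.
split=> [u|g].
  by rewrite -[u](mulKVmx Bu) sumE; eexists.
exists ((\matrix_(i, j) g (nth j0 s j) i 0) *m invmx B) => j js.
have lt_j : (index j s < d)%N by rewrite -sd index_mem.
have -> : b j = col (Ordinal lt_j) B.
  by apply/colP => i; rewrite !mxE nth_index.
rewrite -mulmxA colE mulKmx // -colE; apply/colP => i.
by rewrite !mxE nth_index.
Qed.

(* Weights live in C and operators over F: gc embeds the weights into the scalars
   and qp c is q ^ c. *)
Record qnum (C : numFieldType) (F : fieldType) := QNum {
  gc : C -> F;
  qp : C -> F;
  gcD : {morph gc : b c / b + c};
  gc1 : gc 1 = 1;
  gc_inj : injective gc;
  qpD : forall b c, qp (b + c) = qp b * qp c;
  qp0 : qp 0 = 1;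
  qp_inj : injective qp }.

(** The q-number [c], for complex c. *)
Definition br (C : numFieldType) (F : fieldType) (Q : qnum C F) (c : C) : F :=
  (qp Q 1 - (qp Q 1)^-1)^-1 * (qp Q c - (qp Q c)^-1).

Section QNumTheory.
Variables (C : numFieldType) (F : fieldType) (Q : qnum C F).
Local Notation gc := (gc Q).
Local Notation qp := (qp Q).
Local Notation br := (br Q).

Lemma qp_neq0 c : qp c != 0.
Proof.
by apply: contra_eq_neq (qp0 Q) => c0; rewrite -(subrr c) qpD c0 mul0r eq_sym oner_eq0.
Qed.

Lemma qpN c : qp (- c) = (qp c)^-1.
Proof. by apply: (mulfI (qp_neq0 c)); rewrite -qpD subrr qp0 divff // qp_neq0. Qed.

(** Here q not being a root of unity enters: [qp] is injective, so q^c = q^-c forces 2 c = 0. Hence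
    [c] vanishes only at c = 0. *)
Lemma qp_subV_eq0 c : (qp c - (qp c)^-1 == 0) = (c == 0).
Proof.
rewrite -qpN subr_eq0 (inj_eq (@qp_inj _ _ Q)) -addr_eq0 -mulr2n.
by rewrite mulrn_eq0.
Qed.

Let q1 : qp 1 - (qp 1)^-1 != 0. Proof. by rewrite qp_subV_eq0 oner_eq0. Qed.

Lemma br_eq0 c : (br c == 0) = (c == 0).
Proof. by rewrite mulf_eq0 invr_eq0 (negPf q1) qp_subV_eq0. Qed.

Lemma br0 : br 0 = 0. Proof. by apply/eqP; rewrite br_eq0. Qed.

Lemma brN c : br (- c) = - br c.
Proof. by rewrite /br qpN invrK -mulrN opprB. Qed.

Lemma br1 : br 1 = 1. Proof. by rewrite /br mulVf. Qed.

Lemma br2 : br 2%:R = qp 1 + (qp 1)^-1.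
Proof. by rewrite /br -[2%:R]/(1 + 1) qpD invfM -!expr2 subr_sqr mulKf. Qed.

Lemma br2_neq0 : br 2%:R != 0. Proof. by rewrite br_eq0 pnatr_eq0. Qed.

(** Source of both the sl(2) recursion [br_string] and the typicality scalar of [Om_OmF]. *)
Lemma br_cross b c : br (b + 1) * br (c + 1) - br b * br c = br (b + c + 1).
Proof.
rewrite /br !qpD; move: q1 (qp_neq0 1) (qp_neq0 b) (qp_neq0 c).
move: (qp 1) (qp b) (qp c) => q x y d0 q0 x0 y0; field; rewrite x0 y0 q0 /=.
apply: contraNneq d0 => d0; have -> : q - q^-1 = (q * q - 1) / q by field.
by rewrite d0 mul0r.
Qed.

Lemma gcB b c : gc (b - c) = gc b - gc c.
Proof. by apply: (addIr (gc c)); rewrite subrK -gcD subrK. Qed.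

Lemma gc0 : gc 0 = 0. Proof. by rewrite -(subrr 0) gcB subrr. Qed.

Lemma gc2 : gc 2%:R = 2%:R. Proof. by rewrite -[2%:R]/(1 + 1) gcD gc1. Qed.

Lemma br_string (b : C) (k : nat) :
  br k.+1%:R * br (b - k%:R) + br (b - 2%:R * k.+1%:R) =
  br k.+2%:R * br (b - k.+1%:R).
Proof.
have := br_cross k.+1%:R (k%:R - b).
have -> : k.+1%:R + 1 = k.+2%:R :> C by rewrite natr1.
have -> : k%:R - b + 1 = - (b - k.+1%:R) :> C by rewrite -natr1; ring.
have -> : k%:R - b = - (b - k%:R) :> C by ring.
have -> : k.+1%:R - (b - k%:R) + 1 = - (b - 2%:R * k.+1%:R) :> C.
  by rewrite -natr1; ring.
rewrite !brN => e. apply: (addIr (- br (b - 2%:R * k.+1%:R))); rewrite addrK -e; ring.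
Qed.
End QNumTheory.

(* The indices 0 and 1 stand for the even and the odd simple root.  The brackets
   [E_i, F_i] are only recorded through their action on weight vectors, where
   q ^ h_i is a scalar. *)
Record qmod (C : numFieldType) (F : fieldType) (Q : qnum C F) d := QMod {
  E0 : 'M[F]_d; E1 : 'M[F]_d; F0 : 'M[F]_d; F1 : 'M[F]_d;
  H0 : 'M[F]_d; H1 : 'M[F]_d; Pa : 'M[F]_d;
  PaK : Pa *m Pa = 1%:M;
  PaE0 : Pa *m E0 = E0 *m Pa;
  PaE1 : Pa *m E1 = - (E1 *m Pa);
  PaF0 : Pa *m F0 = F0 *m Pa;
  PaF1 : Pa *m F1 = - (F1 *m Pa);
  H0E0 : H0 *m E0 = E0 *m H0 + 2%:R *: E0;
  H0E1 : H0 *m E1 = E1 *m H0 - E1;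
  H1E0 : H1 *m E0 = E0 *m H1 - E0;
  H1E1 : H1 *m E1 = E1 *m H1;
  H0F0 : H0 *m F0 = F0 *m H0 - 2%:R *: F0;
  H0F1 : H0 *m F1 = F1 *m H0 + F1;
  H1F0 : H1 *m F0 = F0 *m H1 + F0;
  H1F1 : H1 *m F1 = F1 *m H1;
  E0F0 : forall (u : 'cV_d) b, H0 *m u = gc Q b *: u ->
    E0 *m (F0 *m u) = F0 *m (E0 *m u) + br Q b *: u;
  E1F1 : forall (u : 'cV_d) c, H1 *m u = gc Q c *: u ->
    E1 *m (F1 *m u) = - (F1 *m (E1 *m u)) + br Q c *: u;
  E0F1 : E0 *m F1 = F1 *m E0;
  E1F0 : E1 *m F0 = F0 *m E1;
  E1E1 : E1 *m E1 = 0;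
  F1F1 : F1 *m F1 = 0;
  serreEm : E0 *m E0 *m E1 - br Q 2%:R *: (E0 *m E1 *m E0) + E1 *m E0 *m E0 = 0;
  serreFm : F0 *m F0 *m F1 - br Q 2%:R *: (F0 *m F1 *m F0) + F1 *m F0 *m F0 = 0;
  H0_fin : exists c : 'I_d -> C, forall (u : 'cV_d) b, u != 0 ->
    H0 *m u = gc Q b *: u -> exists j, c j = b }.

Section Module.
Variables (C : numFieldType) (F : fieldType) (Q : qnum C F) (d : nat).
Variable M : qmod Q d.
Local Notation gc := (gc Q).
Local Notation br := (br Q).
Local Notation E0 := (E0 M).
Local Notation E1 := (E1 M).
Local Notation F0 := (F0 M).
Local Notation F1 := (F1 M).
Local Notation H0 := (H0 M).
Local Notation H1 := (H1 M).
Local Notation Pa := (Pa M).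
Implicit Types (u w : 'cV[F]_d) (b c : C).

Definition wt b c u := H0 *m u = gc b *: u /\ H1 *m u = gc c *: u.
Definition hwv b c w := [/\ wt b c w, E0 *m w = 0 & E1 *m w = 0].

Lemma wtE0 b c u : wt b c u -> wt (b + 2%:R) (c - 1) (E0 *m u).
Proof.
case=> h0 h1; split.
  by rewrite mulmxA H0E0 mulmxDl -mulmxA h0 -scalemxAr -scalemxAl -scalerDl gcD gc2.
by rewrite mulmxA H1E0 mulmxBl -mulmxA h1 -scalemxAr gcB gc1 scalerBl scale1r.
Qed.

Lemma wtE1 b c u : wt b c u -> wt (b - 1) c (E1 *m u).
Proof.
case=> h0 h1; split; last by rewrite mulmxA H1E1 -mulmxA h1 -scalemxAr.
by rewrite mulmxA H0E1 mulmxBl -mulmxA h0 -scalemxAr gcB gc1 scalerBl scale1r.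
Qed.

Lemma wtF0 b c u : wt b c u -> wt (b - 2%:R) (c + 1) (F0 *m u).
Proof.
case=> h0 h1; split.
  by rewrite mulmxA H0F0 mulmxBl -mulmxA h0 -scalemxAr -scalemxAl -scalerBl gcB gc2.
by rewrite mulmxA H1F0 mulmxDl -mulmxA h1 -scalemxAr gcD gc1 scalerDl scale1r.
Qed.

Lemma wtF1 b c u : wt b c u -> wt (b + 1) c (F1 *m u).
Proof.
case=> h0 h1; split; last by rewrite mulmxA H1F1 -mulmxA h1 -scalemxAr.
by rewrite mulmxA H0F1 mulmxDl -mulmxA h0 -scalemxAr gcD gc1 scalerDl scale1r.
Qed.

Lemma wt_lin b c k u v : wt b c u -> wt b c v -> wt b c (k *: u + v).
Proof.
case=> u0 u1 [v0 v1]; split; rewrite mulmxDr -scalemxAr.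
  by rewrite u0 v0 scalerDr !scalerA mulrC.
by rewrite u1 v1 scalerDr !scalerA mulrC.
Qed.

Lemma wt_F0X b c k u : wt b c u -> wt (b - 2%:R * k%:R) (c + k%:R) (F0 ^+ k *m u).
Proof.
move=> hu; elim: k => [|k /wtF0].
  by rewrite expr0 -idmxE mul1mx mulr0 subr0 addr0.
have -> : c + k.+1%:R = c + k%:R + 1 by rewrite -addrA natr1.
rewrite exprS -mulmxE -mulmxA.
by have -> : b - 2%:R * k.+1%:R = b - 2%:R * k%:R - 2%:R by rewrite -[k.+1%:R]natr1; ring.
Qed.

(* By the Serre relations Om and OmF are, up to a scalar, the products of the two
   positive, resp. negative, odd root vectors; they commute with E0, resp. F0. *)
Definition Om := E1 *m E0 *m E1.
Definition OmF := F1 *m F0 *m F1.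

(** Multiplying the Serre relation by E1 on either side kills one outer term, because E1 squares to
    zero; both products, times [2], are then equal to E1 E0 E0 E1. *)
Lemma E0Om : E0 *m Om = Om *m E0.
Proof.
have e1 : br 2%:R *: (E0 *m E1 *m E0 *m E1) = E1 *m E0 *m E0 *m E1.
  have := congr1 (mulmx^~ E1) (serreEm M); rewrite mul0mx !mulmxDl mulNmx.
  rewrite -mulmxA E1E1 mulmx0 add0r -scalemxAl addrC => /eqP.
  by rewrite subr_eq0 => /eqP.
have e2 : br 2%:R *: (E1 *m E0 *m E1 *m E0) = E1 *m E0 *m E0 *m E1.
  have := congr1 (mulmx E1) (serreEm M); rewrite mulmx0 !mulmxDr mulmxN.
  rewrite !mulmxA E1E1 !mul0mx addr0 -scalemxAr => /eqP.
  by rewrite subr_eq0 !mulmxA => /eqP.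
by apply: (scalerI (br2_neq0 Q)); rewrite /Om !mulmxA e1 e2.
Qed.

Lemma F0OmF : F0 *m OmF = OmF *m F0.
Proof.
have e1 : br 2%:R *: (F0 *m F1 *m F0 *m F1) = F1 *m F0 *m F0 *m F1.
  have := congr1 (mulmx^~ F1) (serreFm M); rewrite mul0mx !mulmxDl mulNmx.
  rewrite -mulmxA F1F1 mulmx0 add0r -scalemxAl addrC => /eqP.
  by rewrite subr_eq0 => /eqP.
have e2 : br 2%:R *: (F1 *m F0 *m F1 *m F0) = F1 *m F0 *m F0 *m F1.
  have := congr1 (mulmx F1) (serreFm M); rewrite mulmx0 !mulmxDr mulmxN.
  rewrite !mulmxA F1F1 !mul0mx addr0 -scalemxAr => /eqP.
  by rewrite subr_eq0 !mulmxA => /eqP.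
by apply: (scalerI (br2_neq0 Q)); rewrite /OmF !mulmxA e1 e2.
Qed.

Lemma E1Om : E1 *m Om = 0.
Proof. by rewrite /Om !mulmxA E1E1 !mul0mx. Qed.
Lemma F1OmF : F1 *m OmF = 0.
Proof. by rewrite /OmF !mulmxA F1F1 !mul0mx. Qed.
Lemma OmFF1 : OmF *m F1 = 0.
Proof. by rewrite /OmF -mulmxA F1F1 mulmx0. Qed.

(** F0 commutes with E1, and commuting it past E0 costs a scalar on a weight vector, so the
    correction contains E1 E1 = 0. *)
Lemma Om_F0 b c u : wt b c u -> Om *m (F0 *m u) = F0 *m (Om *m u).
Proof.
move=> hu; have h1 := wtE1 hu.
rewrite /Om -!mulmxA [E1 *m (F0 *m u)]mulmxA E1F0 -mulmxA.
rewrite (E0F0 h1.1) mulmxDr -scalemxAr [E1 *m (E1 *m u)]mulmxA E1E1.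
by rewrite mul0mx scaler0 addr0 !mulmxA E1F0.
Qed.

Lemma E1_OmF b c u : wt b c u -> E1 *m u = 0 ->
  E1 *m (OmF *m u) = br (c + 1) *: (F0 *m (F1 *m u)) - br c *: (F1 *m (F0 *m u)).
Proof.
move=> hu e; have h3 := wtF0 (wtF1 hu).
rewrite /OmF -!mulmxA (E1F1 h3.2) [E1 *m (F0 *m _)]mulmxA E1F0 -mulmxA.
by rewrite (E1F1 hu.2) e mulmx0 oppr0 add0r -!scalemxAr addrC.
Qed.

(* The scalar vanishes exactly when the weight (b, c) is atypical. *)
Lemma Om_OmF b c w : hwv b c w -> Om *m (OmF *m w) = (br c * br (b + c + 1)) *: w.
Proof.
case=> hw e0 e1; have h1 := wtF1 hw.
rewrite /Om -2!mulmxA (E1_OmF hw e1) mulmxBr -!scalemxAr (E0F0 h1.1).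
rewrite [E0 *m (F1 *m (F0 *m w))]mulmxA E0F1 -mulmxA (E0F0 hw.1) e0 mulmx0 add0r.
rewrite [E0 *m (F1 *m w)]mulmxA E0F1 -mulmxA e0 !mulmx0 add0r -!scalemxAr !scalerA.
rewrite -scalerBl -scalemxAr (E1F1 hw.2) e1 mulmx0 oppr0 add0r scalerA.
congr (_ *: _); rewrite [b + c]addrC -br_cross; ring.
Qed.

Lemma OmF_F0X k u : OmF *m (F0 ^+ k *m u) = F0 ^+ k *m (OmF *m u).
Proof.
elim: k => [|k IHk]; first by rewrite expr0 -idmxE !mul1mx.
rewrite exprS -mulmxE -[F0 *m _ *m u]mulmxA -[F0 *m _ *m (OmF *m u)]mulmxA -IHk.
by rewrite [OmF *m (F0 *m _)]mulmxA -F0OmF -[F0 *m OmF *m _]mulmxA.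
Qed.

Lemma Om_OmF_F0X b c k w : hwv b c w ->
  Om *m (OmF *m (F0 ^+ k *m w)) = (br c * br (b + c + 1)) *: (F0 ^+ k *m w).
Proof.
move=> hw; rewrite OmF_F0X.
elim: k => [|k IHk]; first by rewrite expr0 -idmxE !mul1mx (Om_OmF hw).
have [h _ _] := hw.
have := Om_F0 (wt_F0X k (wtF1 (wtF0 (wtF1 h)))).
rewrite /OmF -!mulmxA in IHk *; rewrite exprS -mulmxE -!mulmxA => ->.
by rewrite IHk -scalemxAr.
Qed.

Lemma E1_F0X k w : E1 *m w = 0 -> E1 *m (F0 ^+ k *m w) = 0.
Proof.
move=> e; elim: k => [|k IHk]; first by rewrite expr0 -idmxE mul1mx.
by rewrite exprS -mulmxE -mulmxA mulmxA E1F0 -mulmxA IHk mulmx0.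
Qed.

(** The usual sl(2) formula. At k = 0 the coefficient [0] makes the default value of [k.-1]
    harmless. *)
Lemma E0_F0X b c k w : hwv b c w ->
  E0 *m (F0 ^+ k *m w) = (br k%:R * br (b - k%:R + 1)) *: (F0 ^+ k.-1 *m w).
Proof.
case=> hw e0 e1; elim: k => [|k IHk].
  by rewrite expr0 -idmxE mul1mx e0 br0 mul0r scale0r.
rewrite exprS -mulmxE -mulmxA (E0F0 (wt_F0X k hw).1) IHk -scalemxAr.
case: k {IHk} => [|k].
  rewrite br0 mul0r scale0r add0r mulr0 subr0 br1 mul1r subrK.
  by [].
rewrite mulmxA mulmxE -exprS -scalerDl; congr (_ *: _).
have e n : b - n.+1%:R + 1 = b - n%:R by rewrite -natr1; ring.
by rewrite !e -br_string.
Qed.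

(** The product [k]! [b] [b - 1] ... [b - k + 1], nonzero as long as the string of a natural b has
    not ended. *)
Definition strc b k := \prod_(i < k) (br i.+1%:R * br (b - i%:R)).

Lemma E0X_F0X b c k w : hwv b c w -> E0 ^+ k *m (F0 ^+ k *m w) = strc b k *: w.
Proof.
move=> hw; elim: k => [|k IHk].
  by rewrite !expr0 -!idmxE !mul1mx /strc big_ord0 scale1r.
rewrite exprSr -mulmxE -mulmxA (E0_F0X _ hw) -scalemxAr IHk scalerA.
rewrite /strc big_ord_recr /= mulrC; congr (_ * (_ * br _) *: _).
by rewrite -natr1; ring.
Qed.

Lemma E0X_F0X_lt b c k m w : hwv b c w -> (k < m)%N -> E0 ^+ m *m (F0 ^+ k *m w) = 0.
Proof.
move=> hw km; rewrite -(subnK (ltnW km)) exprD -mulmxE -mulmxA (E0X_F0X _ hw).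
case: (m - k)%N (subn_gt0 k m) => [|j _]; first by rewrite km.
rewrite exprSr -mulmxE -mulmxA -scalemxAr; case: hw => _ -> _.
by rewrite scaler0 mulmx0.
Qed.

Lemma strc_neq0 (x k : nat) : (k <= x)%N -> strc x%:R k != 0.
Proof.
move=> kx; apply/prodf_neq0 => i _; have ix : (i < x)%N := leq_trans (ltn_ord i) kx.
by rewrite mulf_neq0 // br_eq0 -?natrB ?pnatr_eq0 ?subn_eq0 -?ltnNge // ltnW.
Qed.

(** If F0 ^ k w were nonzero for some k > x, no later power could vanish: applying E0 brings back
    the previous vector with the coefficient [j + 1] [x - j], which is nonzero for j > x. This would
    give d + 1 distinct eigenvalues of H0, against [H0_fin]. *)
Lemma F0X_eq0 (x k : nat) c w : hwv x%:R c w -> (x < k)%N -> F0 ^+ k *m w = 0.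
Proof.
move=> hw xk; apply/eqP; apply: contraT => nz.
have nz1 j : F0 ^+ (k + j) *m w != 0.
  elim: j => [|j IHj]; first by rewrite addn0.
  apply: contraNneq IHj => z.
  have := E0_F0X (k + j).+1 hw; rewrite addnS in z *; rewrite z mulmx0 => /esym/eqP.
  rewrite scaler_eq0 mulf_eq0 !br_eq0 pnatr_eq0 /= => /orP[|//].
  rewrite -natr1 opprD addrA subrK subr_eq0 eqr_nat => /eqP xkj.
  by move: xk; rewrite xkj ltnNge leq_addr.
have [e he] := H0_fin M; have [hwt _ _] := hw.
have ch j : exists i : 'I_d, e i == x%:R - 2%:R * (k + j)%:R.
  by have [i ei] := he _ _ (nz1 j) (wt_F0X (k + j) hwt).1; exists i; apply/eqP.
have inj : injective (fun j : 'I_d.+1 => xchoose (ch j)).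
  move=> i j ij; have := eqP (xchooseP (ch i)); rewrite ij (eqP (xchooseP (ch j))).
  move/(addrI (x%:R : C))/oppr_inj/(mulfI _); rewrite pnatr_eq0 => /(_ isT)/eqP.
  by rewrite eqr_nat eqn_add2l => /eqP/esym/val_inj.
by have := leq_card _ inj; rewrite !card_ord ltnn.
Qed.

End Module.

(** * The modules generated by highest weight vectors *)

Section Strings.
Variables (C : numFieldType) (F : fieldType) (Q : qnum C F) (d : nat).
Variable M : qmod Q d.
Local Notation gc := (gc Q).
Local Notation br := (br Q).
Local Notation E0 := (E0 M).
Local Notation E1 := (E1 M).
Local Notation F0 := (F0 M).
Local Notation F1 := (F1 M).
Local Notation H0 := (H0 M).
Local Notation H1 := (H1 M).
Local Notation Pa := (Pa M).
Local Notation Om := (Om M).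
Local Notation OmF := (OmF M).
Local Notation wt := (wt M).
Local Notation hwv := (hwv M).
Implicit Types (u w : 'cV[F]_d) (b c : C).

(* For a typical highest weight vector w of weight (x, a), with x natural, the
   kv i k w with i < 4 and k <= x form a basis of the module generated by w. *)
Definition kv i k w : 'cV[F]_d :=
  match i with
  | 0 => F0 ^+ k *m w
  | 1 => F1 *m (F0 ^+ k *m w)
  | 2 => F0 *m (F1 *m (F0 ^+ k *m w))
  | _ => F1 *m (F0 *m (F1 *m (F0 ^+ k *m w)))
  end.

Inductive gen := gE0 | gE1 | gF0 | gF1 | gH0 | gH1 | gPa.

Definition op X : 'M[F]_d :=
  match X with
  | gE0 => E0 | gE1 => E1 | gF0 => F0 | gF1 => F1 | gH0 => H0 | gH1 => H1 | gPa => Pa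
  end.

(* On kv i k w every generator acts by universal coefficients, which depend only on
   the weight (b, c) and on the parity s of w. *)
Definition act_coef b c (s : F) X i k : seq (F * (nat * nat)) :=
  match X, i with
  | gE0, 2 => [:: (br k%:R * br (b - k%:R + 1), (2%N, k.-1)); (br (b - 2%:R * k%:R + 1), (1%N, k))]
  | gE0, _ => [:: (br k%:R * br (b - k%:R + 1), (i, k.-1))]
  | gE1, 0 => [::]
  | gE1, 1 => [:: (br (c + k%:R), (0%N, k))]
  | gE1, 2 => [:: (br (c + k%:R), (0%N, k.+1))]
  | gE1, _ => [:: (br (c + k%:R + 1), (2%N, k)); (- br (c + k%:R), (1%N, k.+1))]
  | gF0, 1 => [:: (1, (2%N, k))]
  | gF0, 2 => [:: (br 2%:R, (2%N, k.+1)); (-1, (1%N, k.+2))]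
  | gF0, _ => [:: (1, (i, k.+1))]
  | gF1, 0 => [:: (1, (1%N, k))]
  | gF1, 2 => [:: (1, (3%N, k))]
  | gF1, _ => [::]
  | gH0, 0 => [:: (gc (b - 2%:R * k%:R), (i, k))]
  | gH0, 1 => [:: (gc (b - 2%:R * k%:R + 1), (i, k))]
  | gH0, 2 => [:: (gc (b - 2%:R * k%:R + 1 - 2%:R), (i, k))]
  | gH0, _ => [:: (gc (b - 2%:R * k%:R + 1 - 2%:R + 1), (i, k))]
  | gH1, 0 => [:: (gc (c + k%:R), (i, k))]
  | gH1, 1 => [:: (gc (c + k%:R), (i, k))]
  | gH1, _ => [:: (gc (c + k%:R + 1), (i, k))]
  | gPa, 0 => [:: (s, (i, k))]
  | gPa, 1 => [:: (- s, (i, k))]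
  | gPa, 2 => [:: (- s, (i, k))]
  | gPa, _ => [:: (s, (i, k))]
  end.

Lemma F0X k w : F0 *m (F0 ^+ k *m w) = F0 ^+ k.+1 *m w.
Proof. by rewrite exprS -mulmxE mulmxA. Qed.

Lemma OmFE w : F1 *m (F0 *m (F1 *m w)) = OmF *m w.
Proof. by rewrite !mulmxA. Qed.

(** The right-hand side may contain F0 ^ j w with j > x, which is zero. Such terms are kept so that
    the coefficients have one shape for all k, and two modules of the same weight and parity can be
    compared term by term. *)
Lemma act_kv b c s X i k w : hwv b c w -> Pa *m w = s *: w -> (i < 4)%N ->
  op X *m kv i k w = \sum_(t <- act_coef b c s X i k) t.1 *: kv t.2.1 t.2.2 w.
Proof.
move=> hw ps; have [hwt e0 e1] := hw; have h := wt_F0X k hwt.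
have h1 := wtF1 h; have h2 := wtF0 h1; have h3 := wtF1 h2.
have F11 v : F1 *m (F1 *m v) = 0 by rewrite mulmxA F1F1 mul0mx.
have sum1 (a : F * (nat * nat)) : \sum_(t <- [:: a]) t.1 *: kv t.2.1 t.2.2 w =
    a.1 *: kv a.2.1 a.2.2 w by rewrite big_seq1.
have sum2 (a a' : F * (nat * nat)) : \sum_(t <- [:: a; a']) t.1 *: kv t.2.1 t.2.2 w =
    a.1 *: kv a.2.1 a.2.2 w + a'.1 *: kv a'.2.1 a'.2.2 w.
  by rewrite big_cons big_seq1.
have sum0 : \sum_(t <- [::]) t.1 *: kv t.2.1 t.2.2 w = 0 by rewrite big_nil.
have pk : Pa *m (F0 ^+ k *m w) = s *: (F0 ^+ k *m w).
  elim: k {h h1 h2 h3} => [|k IHk]; first by rewrite expr0 -idmxE mul1mx.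
  by rewrite -F0X mulmxA PaF0 -mulmxA IHk -scalemxAr.
have pk1 : Pa *m (F1 *m (F0 ^+ k *m w)) = - s *: (F1 *m (F0 ^+ k *m w)).
  by rewrite mulmxA PaF1 mulNmx -mulmxA pk -scalemxAr scaleNr.
have pk2 : Pa *m (F0 *m (F1 *m (F0 ^+ k *m w))) = - s *: (F0 *m (F1 *m (F0 ^+ k *m w))).
  by rewrite mulmxA PaF0 -mulmxA pk1 -scalemxAr.
have ek := E0_F0X k hw; have ek1 := E1_F0X k e1.
have E0F1v v : E0 *m (F1 *m v) = F1 *m (E0 *m v) by rewrite !mulmxA E0F1.
have E1F0v v : E1 *m (F0 *m v) = F0 *m (E1 *m v) by rewrite !mulmxA E1F0.
case: X; case: i => [|[|[|[|//]]]] _ /=; rewrite ?sum0 ?sum1 ?sum2 /= ?scale1r //.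
- by rewrite E0F1v ek -scalemxAr.
- by rewrite (E0F0 h1.1) E0F1v ek -!scalemxAr.
- by rewrite E0F1v (E0F0 h1.1) E0F1v ek mulmxDr -!scalemxAr F11 scaler0 addr0.
- by rewrite (E1F1 h.2) ek1 mulmx0 oppr0 add0r.
- by rewrite E1F0v (E1F1 h.2) ek1 mulmx0 oppr0 add0r -scalemxAr F0X.
- by rewrite OmFE (E1_OmF h ek1) F0X scaleNr.
- by rewrite F0X.
(* The Serre relation rewrites F0 F0 F1 as [2] F0 F1 F0 - F1 F0 F0, which brings F0 ([kv 2 k w])
   back to the family [kv]. *)
- have := congr1 (mulmx^~ (F0 ^+ k *m w)) (serreFm M).
  rewrite mul0mx !mulmxDl mulNmx -scalemxAl -!mulmxA !F0X => /eqP.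
  by rewrite addrAC subr_eq0 => /eqP <-; rewrite scaleN1r addrK.
- by rewrite -F0X !OmFE [F0 *m (OmF *m _)]mulmxA F0OmF -[OmF *m F0 *m _]mulmxA.
- exact: h.1.
- exact: h1.1.
- exact: h2.1.
- exact: h3.1.
- exact: h.2.
- exact: h1.2.
- exact: h2.2.
- exact: h3.2.
- by rewrite mulmxA PaF1 mulNmx -mulmxA pk2 -scalemxAr scaleNr opprK.
Qed.

Section Families.
Variables (I : eqType) (P : seq I) (x : I -> nat) (a : I -> C) (w : I -> 'cV[F]_d).
Hypothesis hw : {in P, forall p, hwv (x p)%:R (a p) (w p)}.
Hypothesis indep : forall c : I -> F, \sum_(p <- P) c p *: w p = 0 -> {in P, forall p, c p = 0}.

(* Applying E0 ^+ k, for the largest k involved, brings the relation back to the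
   independence of the highest weight vectors. *)
Lemma strings_free (c : I -> nat -> F) :
  \sum_(p <- P) \sum_(k < (x p).+1) c p k *: (F0 ^+ k *m w p) = 0 ->
  {in P, forall p k, (k <= x p)%N -> c p k = 0}.
Proof.
move=> s0; pose N := (\max_(p <- P) x p).+1.
suff H m p k : p \in P -> (k <= x p)%N -> (N <= k + m)%N -> c p k = 0.
  by move=> p pP k kx; apply: (H N) => //; rewrite leq_addl.
elim: m p k => [|m IHm] p k pP kx.
  by rewrite addn0 leqNgt ltnS (leq_trans kx) //; apply: leq_bigmax_seq.
rewrite leq_eqVlt addnS ltnS => /predU1P[eN|]; last exact: IHm.
have z q j : q \in P -> (j <= x q)%N -> (k < j)%N -> c q j = 0.
  by move=> qP jx kj; apply: IHm => //; rewrite eN -addSn leq_add2r.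
have := congr1 (mulmx (E0 ^+ k)) s0; rewrite mulmx0 mulmx_sumr.
have e q : q \in P ->
    E0 ^+ k *m (\sum_(j < (x q).+1) c q j *: (F0 ^+ j *m w q)) =
    (if (k <= x q)%N then c q k * strc Q (x q)%:R k else 0) *: w q.
  move=> qP; rewrite mulmx_sumr.
  have t (j : 'I_(x q).+1) : j != k :> nat ->
      E0 ^+ k *m (c q j *: (F0 ^+ j *m w q)) = 0.
    rewrite -scalemxAr; case: ltngtP => // jk _.
      by rewrite (E0X_F0X_lt (hw qP)) // scaler0.
    by rewrite z ?scale0r // -ltnS.
  case: leqP => kq; last first.
    rewrite scale0r big1 // => j _; apply: t.
    by rewrite neq_ltn (leq_trans (ltn_ord j)).
  rewrite (bigD1 (Ordinal (kq : (k < (x q).+1)%N))) //= big1 => [|j jk]; last exact: t.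
  by rewrite addr0 -scalemxAr (E0X_F0X _ (hw qP)) scalerA.
rewrite (eq_big_seq _ e) => /indep/(_ p pP); rewrite kx => /eqP.
by rewrite mulf_eq0 (negPf (strc_neq0 _ kx)) orbF => /eqP.
Qed.

Hypothesis typ : {in P, forall p, (a p != 0) && ((x p)%:R + a p + 1 != 0)}.

Let kappa p := br (a p) * br ((x p)%:R + a p + 1).

Lemma kappa_neq0 p : p \in P -> kappa p != 0.
Proof. by move/typ=> /andP[a0 b0]; rewrite mulf_neq0 // br_eq0. Qed.

(** Om OmF acts on the whole string of w p by the scalar [kappa p], nonzero by typicality; so OmF is
    injective on the span of the strings. *)
Lemma OmF_free (c : I -> nat -> F) :
  OmF *m (\sum_(p <- P) \sum_(k < (x p).+1) c p k *: (F0 ^+ k *m w p)) = 0 ->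
  {in P, forall p k, (k <= x p)%N -> c p k = 0}.
Proof.
move=> /(congr1 (mulmx Om)); rewrite mulmx0 !mulmx_sumr.
under eq_big_seq => p pP.
  rewrite !mulmx_sumr; under eq_bigr => k _.
    rewrite -!scalemxAr (Om_OmF_F0X _ (hw pP)) scalerA -/(kappa p); over.
  over.
move/(@strings_free (fun p k => c p k * kappa p)) => z p pP k kx.
have /eqP := z p pP k kx.
by rewrite mulf_eq0 (negPf (kappa_neq0 pP)) orbF => /eqP.
Qed.

Let L (c : I -> nat -> F) := \sum_(p <- P) \sum_(k < (x p).+1) c p k *: (F0 ^+ k *m w p).

Lemma sum_kvE (c : I -> nat -> nat -> F) :
  \sum_(p <- P) \sum_(k < (x p).+1) \sum_(i < 4) c p k i *: kv i k (w p) =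
  L (fun p k => c p k 0%N) + F1 *m L (fun p k => c p k 1%N)
  + F0 *m (F1 *m L (fun p k => c p k 2%N)) + OmF *m L (fun p k => c p k 3%N).
Proof.
rewrite /L !mulmx_sumr -!big_split; apply: eq_bigr => p _.
rewrite /= !mulmx_sumr -!big_split; apply: eq_bigr => k _.
by rewrite !big_ord_recl big_ord0 /= addr0 -!scalemxAr OmFE !addrA.
Qed.

(** The four layers are separated by operators that leave OmF applied to one of them. OmF isolates
    layer 0, since OmF F1 = 0 and OmF commutes with F0; then F1 isolates layer 2, since F1 F1 = F1
    OmF = 0; then F1 F0 isolates layer 1, and layer 3 is left. Each time [OmF_free] concludes. *)
Lemma kv_free (c : I -> nat -> nat -> F) :
  \sum_(p <- P) \sum_(k < (x p).+1) \sum_(i < 4) c p k i *: kv i k (w p) = 0 ->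
  {in P, forall p k i, (k <= x p)%N -> (i < 4)%N -> c p k i = 0}.
Proof.
rewrite sum_kvE; set l0 := L _; set l1 := L _; set l2 := L _; set l3 := L _ => s0.
have FF v : F1 *m (F1 *m v) = 0 by rewrite mulmxA F1F1 mul0mx.
have FO v : F1 *m (OmF *m v) = 0 by rewrite mulmxA F1OmF mul0mx.
have Lz (c' : I -> nat -> F) : OmF *m L c' = 0 ->
    {in P, forall p k, (k <= x p)%N -> c' p k = 0} /\ L c' = 0.
  move=> /OmF_free z; split=> //; rewrite /L big_seq big1 // => p pP.
  by rewrite big1 // => k _; rewrite z ?scale0r // -ltnS.
have OF1 v : OmF *m (F1 *m v) = 0 by rewrite mulmxA OmFF1 mul0mx.
have OF0 v : OmF *m (F0 *m v) = F0 *m (OmF *m v) by rewrite mulmxA -F0OmF -mulmxA.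
have /Lz[z0 l00] : OmF *m l0 = 0.
  move: (congr1 (mulmx OmF) s0); rewrite mulmx0 !mulmxDr OF1 OF0 OF1 -(OmFE l3) OF1.
  by rewrite mulmx0 !addr0.
have /Lz[z2 l20] : OmF *m l2 = 0.
  move: (congr1 (mulmx F1) s0).
  by rewrite [l0]l00 mulmx0 add0r !mulmxDr FF FO add0r addr0 OmFE.
have /Lz[z1 l10] : OmF *m l1 = 0.
  move: (congr1 (mulmx F1) (congr1 (mulmx F0) s0)).
  rewrite [l0]l00 [l2]l20 !mulmx0 add0r addr0 !mulmxDr OmFE.
  by rewrite -OF0 FO addr0.
have /Lz[z3 _] : OmF *m l3 = 0.
  by move: s0; rewrite [l0]l00 [l1]l10 [l2]l20 !mulmx0 !add0r.
move=> p pP k [|[|[|[|//]]]] kx _; [exact: z0|exact: z1|exact: z2|exact: z3].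
Qed.

End Families.
End Strings.

(** * Simplicity of the module generated by a typical highest weight vector *)

Section Simple.
Variables (C : numFieldType) (F : fieldType) (Q : qnum C F) (d : nat).
Variable M : qmod Q d.
Local Notation br := (br Q).
Local Notation E0 := (E0 M).
Local Notation E1 := (E1 M).
Local Notation F0 := (F0 M).
Local Notation F1 := (F1 M).
Local Notation Om := (Om M).
Local Notation OmF := (OmF M).
Local Notation hwv := (hwv M).
Local Notation kv := (kv M).
Implicit Types u : 'cV[F]_d.

Variables (x : nat) (a : C) (w : 'cV[F]_d).
Hypotheses (hw : hwv x%:R a w) (typ : (a != 0) && (x%:R + a + 1 != 0)) (w0 : w != 0).

Let P := [:: tt].
Let hwP : {in P, forall p : unit, hwv x%:R a w}. Proof. by []. Qed.
Let indep (c : unit -> F) : \sum_(p <- P) c p *: w = 0 -> {in P, forall p, c p = 0}.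
Proof.
rewrite big_seq1 => /eqP; rewrite scaler_eq0 (negPf w0) orbF => /eqP c0.
by move=> [].
Qed.
Let typP : {in P, forall p : unit, (a != 0) && (x%:R + a + 1 != 0)}. Proof. by []. Qed.

Let kappa := br a * br (x%:R + a + 1).
Let kappa0 : kappa != 0. Proof. by case/andP: typ => ? ?; rewrite mulf_neq0 // br_eq0. Qed.

Let L (c : nat -> F) := \sum_(k < x.+1) c k *: (F0 ^+ k *m w).

Let stable (U : {vspace 'cV[F]_d}) := forall X u, u \in U -> op M X *m u \in U.

Lemma kv_stable U i k : stable U -> w \in U -> kv i k w \in U.
Proof.
move=> sU wU; have F0U v : v \in U -> F0 *m v \in U by apply: (sU gF0).
have F1U v : v \in U -> F1 *m v \in U by apply: (sU gF1).
have kU : F0 ^+ k *m w \in U.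
  elim: k => [|k IHk]; first by rewrite expr0 -idmxE mul1mx.
  by rewrite -F0X F0U.
by case: i => [|[|[|i]]] /=; auto.
Qed.

(** Om brings OmF (L c) back to a nonzero multiple of L c; then E0 ^ k, for the largest k with c k
    nonzero, leaves a nonzero multiple of w. *)
Let OmF_hit U c : stable U -> OmF *m L c \in U -> OmF *m L c != 0 -> w \in U.
Proof.
move=> sU OU O0; have E0U v : v \in U -> E0 *m v \in U by apply: (sU gE0).
have E1U v : v \in U -> E1 *m v \in U by apply: (sU gE1).
have lU : L c \in U.
  have : Om *m (OmF *m L c) \in U by rewrite -2!mulmxA; auto.
  have -> : Om *m (OmF *m L c) = kappa *: L c.
    rewrite !mulmx_sumr scaler_sumr; apply: eq_bigr => k _.
    by rewrite -!scalemxAr (Om_OmF_F0X _ hw) !scalerA mulrC.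
  by move/(memvZ kappa^-1); rewrite scalerA mulVf // scale1r.
have exk : exists k, (k < x.+1)%N && (c k != 0).
  have [k ck|cz] := pickP (fun k : 'I_x.+1 => c k != 0); first by exists k; rewrite ltn_ord.
  case/eqP: O0; rewrite /L big1 ?mulmx0 // => k _.
  by have /negbFE/eqP-> := cz k; rewrite scale0r.
have bnd k : (k < x.+1)%N && (c k != 0) -> (k <= x)%N by case/andP.
case: (ex_maxnP exk bnd) => k /andP[kx ck] kmax.
have : E0 ^+ k *m L c \in U.
  elim: k {kx ck kmax} => [|k IHk]; first by rewrite expr0 -idmxE mul1mx.
  by rewrite exprS -mulmxE -mulmxA E0U.
have -> : E0 ^+ k *m L c = (c k * strc Q x%:R k) *: w.
  rewrite mulmx_sumr (bigD1 (Ordinal kx)) //= big1 => [|j jk].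
    by rewrite addr0 -scalemxAr (E0X_F0X _ hw) scalerA.
  rewrite -scalemxAr; have [jk'|kj|jk'] := ltngtP j k.
  - by rewrite (E0X_F0X_lt hw) // scaler0.
  - have [->|cj] := eqVneq (c j) 0; first by rewrite scale0r.
    by have := kmax j; rewrite ltn_ord cj leqNgt kj => /(_ isT).
  - by case/eqP: jk; apply: val_inj.
move/(memvZ (c k * strc Q x%:R k)^-1); rewrite scalerA mulVf ?scale1r //.
by rewrite mulf_neq0 // strc_neq0.
Qed.

(** The separation of layers used in [kv_free], run inside U: the layers are treated in the order 0,
    2, 1, 3, and the first nonzero one puts a nonzero OmF (L c) into U. *)
Lemma hw_in_stable U (c : nat -> nat -> F) :
  let u := \sum_(k < x.+1) \sum_(i < 4) c k i *: kv i k w in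
  stable U -> u \in U -> u != 0 -> w \in U.
Proof.
move=> u sU; have := sum_kvE M P (fun=> x) (fun=> w) (fun=> c).
rewrite !big_seq1 -/u; set l0 := \sum_(_ < _) _ *: _; set l1 := \sum_(_ < _) _ *: _.
set l2 := \sum_(_ < _) _ *: _; set l3 := \sum_(_ < _) _ *: _ => uE uU u0.
have F0U v : v \in U -> F0 *m v \in U by apply: (sU gF0).
have F1U v : v \in U -> F1 *m v \in U by apply: (sU gF1).
have FF v : F1 *m (F1 *m v) = 0 by rewrite mulmxA F1F1 mul0mx.
have FO v : F1 *m (OmF *m v) = 0 by rewrite mulmxA F1OmF mul0mx.
have OF1 v : OmF *m (F1 *m v) = 0 by rewrite mulmxA OmFF1 mul0mx.
have OF0 v : OmF *m (F0 *m v) = F0 *m (OmF *m v) by rewrite mulmxA -F0OmF -mulmxA.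
have Lz (c' : nat -> F) : OmF *m L c' \in U -> w \in U \/ L c' = 0.
  move=> OU; have [z|nz] := eqVneq (OmF *m L c') 0; last by left; apply: OmF_hit OU nz.
  right; have := @OmF_free _ _ _ _ M _ P (fun=> x) (fun=> a) (fun=> w) hwP indep typP (fun=> c').
  rewrite big_seq1 => /(_ z tt isT) cz; rewrite /L big1 // => k _.
  by rewrite cz ?scale0r // -ltnS.
have [//|l00] : w \in U \/ l0 = 0.
  apply: (Lz (c^~ 0%N)).
  have -> : OmF *m L (c^~ 0%N) = OmF *m u.
    by rewrite uE !mulmxDr OF1 OF0 OF1 -(OmFE _ l3) OF1 mulmx0 !addr0.
  by rewrite -OmFE; auto.
have [//|l20] : w \in U \/ l2 = 0.
  apply: (Lz (c^~ 2%N)).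
  have -> : OmF *m L (c^~ 2%N) = F1 *m u; last by auto.
  by rewrite uE l00 add0r !mulmxDr FF FO add0r addr0 OmFE.
have [//|l10] : w \in U \/ l1 = 0.
  apply: (Lz (c^~ 1%N)).
  have -> : OmF *m L (c^~ 1%N) = F1 *m (F0 *m u); last by auto.
  by rewrite uE l00 l20 !mulmx0 add0r addr0 !mulmxDr OmFE -OF0 FO addr0.
have [//|l30] : w \in U \/ l3 = 0.
  apply: (Lz (c^~ 3%N)).
  have -> : OmF *m L (c^~ 3%N) = u; last by [].
  by rewrite uE l00 l10 l20 !mulmx0 !add0r.
by case/eqP: u0; rewrite uE l00 l10 l20 l30 !mulmx0 !addr0.
Qed.
End Simple.

(** * Modules decomposed into typical components: basis, matrix units, highest weight vectors *)

Section Decomposed.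
Variables (C : numFieldType) (F : fieldType) (Q : qnum C F) (d : nat).
Variable M : qmod Q d.
Local Notation br := (br Q).
Local Notation E0 := (E0 M).
Local Notation E1 := (E1 M).
Local Notation F0 := (F0 M).
Local Notation F1 := (F1 M).
Local Notation H0 := (H0 M).
Local Notation H1 := (H1 M).
Local Notation Pa := (Pa M).
Local Notation Om := (Om M).
Local Notation OmF := (OmF M).
Local Notation wt := (wt M).
Local Notation hwv := (hwv M).
Local Notation kv := (kv M).
Implicit Types u : 'cV[F]_d.

Variables (I : eqType) (P : seq I) (x : I -> nat) (a : I -> C) (s : I -> F) (w : I -> 'cV[F]_d).
Hypothesis uP : uniq P.
Hypothesis hw : {in P, forall p, hwv (x p)%:R (a p) (w p)}.
Hypothesis par : {in P, forall p, Pa *m w p = s p *: w p}.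
Hypothesis indep : forall c : I -> F, \sum_(p <- P) c p *: w p = 0 -> {in P, forall p, c p = 0}.
Hypothesis typ : {in P, forall p, (a p != 0) && ((x p)%:R + a p + 1 != 0)}.
Hypothesis dimP : (\sum_(p <- P) 4 * (x p).+1 = d)%N.

Let Js := [seq (p, ki) | p <- P, ki <- [seq (k, i) | k <- iota 0 (x p).+1, i <- iota 0 4]].

Let sumJ (V : nmodType) (f : I -> nat -> nat -> V) :
  \sum_(j <- Js) f j.1 j.2.1 j.2.2 = \sum_(p <- P) \sum_(k < (x p).+1) \sum_(i < 4) f p k i.
Proof.
rewrite big_allpairs_dep; apply: eq_bigr => p _; rewrite big_allpairs_dep /=.
rewrite -(big_mkord xpredT (fun k => \sum_(i < 4) f p k i)) /index_iota subn0.
by apply: eq_bigr => k _; rewrite -(big_mkord xpredT (f p k)) /index_iota subn0.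
Qed.

Let mem_J p k i : ((p, (k, i)) \in Js) = [&& p \in P, (k <= x p)%N & (i < 4)%N].
Proof.
apply/allpairsPdep/and3P => [[q [_ [qP /allpairsP[[k' i'] [kx i4 ->]]]]]|[pP kx i4]].
  case=> -> -> ->; rewrite !mem_iota /= in kx i4 *; split=> //; lia.
exists p, (k, i); split=> //; apply/allpairsP; exists (k, i).
by split=> //; rewrite mem_iota /=; lia.
Qed.

Let JsP : uniq Js /\ size Js = d.
Proof.
split.
  apply: allpairs_uniq_dep => // [p _|[p1 k1] [p2 k2] _ _ [-> ->] //].
  by apply: allpairs_uniq; rewrite ?iota_uniq // => -[? ?] [? ?] _ _ [-> ->].
rewrite size_allpairs_dep -dimP sumnE big_map; apply: eq_bigr => p _.
by rewrite size_allpairs !size_iota mulnC.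
Qed.

(** Independence and the count [dimP] make the [kv] a basis of the whole space; this replaces any
    appeal to semisimplicity. *)
Lemma kv_basis d' :
  (forall u, exists c : I -> nat -> nat -> F,
     u = \sum_(p <- P) \sum_(k < (x p).+1) \sum_(i < 4) c p k i *: kv i k (w p)) /\
  (forall g : I -> nat -> nat -> 'cV[F]_d', exists f : 'M_(d', d),
     {in P, forall p k i, (k <= x p)%N -> (i < 4)%N -> f *m kv i k (w p) = g p k i}).
Proof.
have [uJ sJ] := JsP.
have [] := @basis_of_free _ d d' _ Js (fun j => kv j.2.2 j.2.1 (w j.1)) sJ _ uJ.
  move=> c c0 [p [k i]]; rewrite mem_J => /and3P[pP kx i4].
  apply: (kv_free hw indep typ (c := fun p k i => c (p, (k, i))) _ pP kx i4).
  rewrite -(sumJ (fun p k i => c (p, (k, i)) *: kv i k (w p))) -[RHS]c0.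
  by apply: eq_bigr => -[? [? ?]].
move=> sp ext; split=> [u|g].
  have [c uE] := sp u; exists (fun p k i => c (p, (k, i))); rewrite uE.
  rewrite -(sumJ (fun p k i => c (p, (k, i)) *: kv i k (w p))).
  by apply: eq_bigr => -[p [k i]].
have [f fE] := ext (fun j => g j.1 j.2.1 j.2.2); exists f => p pP k i kx i4.
by have := fE (p, (k, i)); rewrite mem_J pP kx i4 => /(_ isT).
Qed.

Lemma kv_spanning (A B : 'M[F]_d) :
  {in P, forall p k i, (i < 4)%N -> A *m kv i k (w p) = B *m kv i k (w p)} -> A = B.
Proof.
move=> AB; have ABu (u : 'cV_d) : A *m u = B *m u.
  have [sp _] := kv_basis 0; have [c ->] := sp u; rewrite !mulmx_sumr.
  apply: eq_big_seq => p pP; rewrite !mulmx_sumr; apply: eq_bigr => k _.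
  rewrite !mulmx_sumr; apply: eq_bigr => i _.
  by rewrite -!scalemxAr AB.
apply/matrixP => i j; have := congr1 (fun v : 'cV_d => v i 0) (ABu (delta_mx j 0)).
by rewrite -!colE !mxE.
Qed.

Lemma mul_kv (f : 'M[F]_d) i k u : (forall X, f *m op M X = op M X *m f) ->
  f *m kv i k u = kv i k (f *m u).
Proof.
move=> fX; have f0 v : f *m (F0 *m v) = F0 *m (f *m v) by rewrite !mulmxA (fX gF0).
have f1 v : f *m (F1 *m v) = F1 *m (f *m v) by rewrite !mulmxA (fX gF1).
have fk : f *m (F0 ^+ k *m u) = F0 ^+ k *m (f *m u).
  elim: k => [|k IHk]; first by rewrite !expr0 -idmxE !mul1mx.
  by rewrite -F0X f0 IHk F0X.
by case: i => [|[|[|i]]] /=; rewrite ?(f0, f1) fk.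
Qed.

Lemma equivariant_ext (f g : 'M[F]_d) : (forall X, f *m op M X = op M X *m f) ->
  (forall X, g *m op M X = op M X *m g) -> {in P, forall p, f *m w p = g *m w p} -> f = g.
Proof.
move=> fX gX fg; apply: kv_spanning => p pP k i _.
by rewrite !mul_kv // fg.
Qed.

(** The map that carries the basis of the component of h to that of g and kills the other components
    is an intertwiner, because [act_coef] only depends on weight and parity, which agree for g and
    h. *)
Lemma exists_matrix_unit g h : g \in P -> h \in P -> x g = x h -> a g = a h -> s g = s h ->
  exists f : 'M[F]_d, (forall X, f *m op M X = op M X *m f) /\
  {in P, forall p k i, (i < 4)%N -> f *m kv i k (w p) = (p == h)%:R *: kv i k (w g)}.
Proof.
move=> gP hP xgh agh sgh; have [_ ext] := kv_basis d.
have [f fE0] := ext (fun p k i => (p == h)%:R *: kv i k (w g)).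
have fE p k i : p \in P -> (i < 4)%N -> f *m kv i k (w p) = (p == h)%:R *: kv i k (w g).
  move=> pP i4; have [kx|xk] := leqP k (x p); first exact: fE0.
  (* The action can produce indices k beyond x p, outside the basis; there both sides vanish. *)
  have kv0 q : q \in P -> (x q < k)%N -> kv i k (w q) = 0.
    move=> qP xqk; have z := F0X_eq0 (hw qP) xqk.
    by case: i {i4} => [|[|[|i]]] /=; rewrite z ?mulmx0.
  rewrite kv0 // mulmx0; have [ph|_] := eqVneq p h; last by rewrite scale0r.
  by rewrite kv0 ?scaler0 // xgh -ph.
exists f; split=> [X|p pP k i]; last exact: fE.
apply: kv_spanning => p pP k i i4; rewrite -!mulmxA fE //.
rewrite (act_kv X k (hw pP) (par pP) i4) mulmx_sumr.
have lt4 b c r t : t \in act_coef Q b c r X i k -> (t.2.1 < 4)%N.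
  case: X; case: i i4 => [|[|[|[|//]]]] _ //=; rewrite !inE;
  by do ?[case/orP]; move=> /eqP ->.
under eq_big_seq => t tX do rewrite -scalemxAr fE ?(lt4 _ _ _ _ tX) //.
rewrite -scalemxAr; have [->|_] := eqVneq p h; last first.
  by rewrite scale0r big1 // => t _; rewrite scale0r scaler0.
rewrite scale1r (act_kv X k (hw gP) (par gP) i4) xgh agh sgh.
by apply: eq_bigr => t _; rewrite scale1r.
Qed.

(** Om kills the first three layers and sends the last one back to the first; this is how it
    projects the module onto the strings of the w p. *)
Lemma Om_kv p k i : p \in P -> (i < 4)%N -> Om *m kv i k (w p) =
  (if i == 3 then br (a p) * br ((x p)%:R + a p + 1) else 0) *: (F0 ^+ k *m w p).
Proof.
move=> pP; have [hp e0 e1] := hw pP; have h := wt_F0X k hp; have e1k := E1_F0X k e1.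
have Om1 : Om *m (F1 *m (F0 ^+ k *m w p)) = 0.
  rewrite -2!mulmxA (E1F1 h.2) e1k mulmx0 oppr0 add0r -!scalemxAr (E0_F0X _ (hw pP)).
  by rewrite -scalemxAr E1_F0X // !scaler0.
case: i => [|[|[|[|//]]]] _ /=; rewrite ?scale0r //.
- by rewrite -mulmxA e1k mulmx0.
- by rewrite (Om_F0 (wtF1 h)) Om1 mulmx0.
- by rewrite OmFE (Om_OmF_F0X _ (hw pP)).
Qed.

(* u is a multiple of Om (OmF u), and Om maps the whole module into the span of the
   F0 ^+ k *m w p, where E0 only kills the terms with k = 0. *)
Lemma hwv_span b c u : hwv b c u -> c != 0 -> b + c + 1 != 0 ->
  exists y : I -> F, u = \sum_(p <- P) y p *: w p /\
    {in P, forall p, y p != 0 -> (x p)%:R = b /\ a p = c}.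
Proof.
move=> hu c0 bc0; have [sp _] := kv_basis 0.
have kap0 : br c * br (b + c + 1) != 0 by rewrite mulf_neq0 // br_eq0.
have [z uE] : exists z : I -> nat -> F,
    u = \sum_(p <- P) \sum_(k < (x p).+1) z p k *: (F0 ^+ k *m w p).
  have [y OuE] := sp (OmF *m u).
  have := congr1 (mulmx Om) OuE; rewrite (Om_OmF hu) => /(congr1 (GRing.scale (br c * br (b + c + 1))^-1)).
  rewrite scalerA mulVf // scale1r => ->.
  exists (fun p k => (br c * br (b + c + 1))^-1 * (y p k 3%N * (br (a p) * br ((x p)%:R + a p + 1)))).
  rewrite mulmx_sumr scaler_sumr; apply: eq_big_seq => p pP.
  rewrite mulmx_sumr scaler_sumr; apply: eq_bigr => k _.
  rewrite mulmx_sumr (bigD1 (inord 3)) //= big1 => [|i i3].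
    by rewrite addr0 inordK // -scalemxAr (Om_kv k pP) //= !scalerA !mulrA.
  rewrite -scalemxAr Om_kv // ifN ?scale0r ?scaler0 //.
  by apply: contra i3 => /eqP i3; apply/eqP/val_inj; rewrite /= inordK.
have z0 : {in P, forall p k, (k <= x p)%N -> z p k.+1 * (br k.+1%:R * br ((x p)%:R - k.+1%:R + 1)) = 0}.
  have [_ e0 _] := hu.
  apply: (strings_free hw indep (c := fun p k => z p k.+1 * (br k.+1%:R * br ((x p)%:R - k.+1%:R + 1)))).
  rewrite -[RHS]e0 uE mulmx_sumr; apply: eq_big_seq => p pP.
  rewrite mulmx_sumr big_ord_recr [RHS]big_ord_recl /= -scalemxAr (E0_F0X _ (hw pP)).
  rewrite br0 mul0r scale0r scaler0 add0r.
  (* The last term, k = x p, lies beyond the string of u, but its coefficient contains [0]; so the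
     sum may run over the full range that [strings_free] expects. *)
  have -> : (x p)%:R - (x p).+1%:R + 1 = 0 :> C by rewrite -natr1; ring.
  rewrite br0 !mulr0 scale0r addr0; apply: eq_bigr => k _.
  by rewrite -scalemxAr (E0_F0X _ (hw pP)) scalerA.
have uE0 : u = \sum_(p <- P) z p 0%N *: w p.
  rewrite uE; apply: eq_big_seq => p pP.
  rewrite big_ord_recl /= expr0 -idmxE mul1mx big1 ?addr0 // => k _.
  rewrite /bump /= add1n; have kx : (k < x p)%N := ltn_ord k.
  have /eqP := z0 p pP k (ltnW kx); rewrite mulf_eq0 mulf_eq0 !br_eq0 pnatr_eq0 /=.
  have -> : (x p)%:R - k.+1%:R + 1 = (x p - k)%:R :> C.
    by rewrite natrB ?(ltnW kx) // -natr1; ring.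
  by rewrite pnatr_eq0 subn_eq0 leqNgt kx orbF => /eqP ->; rewrite scale0r.
exists (fun p => z p 0%N); split=> // p pP zp; have [[h0 h1] _ _] := hu.
have eig (H : 'M[F]_d) (t : I -> C) r : {in P, forall q, H *m w q = gc Q (t q) *: w q} ->
    H *m u = gc Q r *: u -> t p = r.
  move=> Hw /eqP; rewrite -subr_eq0 uE0 mulmx_sumr scaler_sumr -sumrB.
  have e q : q \in P -> H *m (z q 0%N *: w q) - gc Q r *: (z q 0%N *: w q) =
      ((gc Q (t q) - gc Q r) * z q 0%N) *: w q.
    by move=> qP; rewrite -scalemxAr Hw // !scalerA mulrC -scalerBl mulrBl.
  rewrite (eq_big_seq _ e) => /eqP/indep/(_ p pP)/eqP.
  by rewrite mulf_eq0 (negPf zp) orbF subr_eq0 => /eqP/gc_inj.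
by split; [apply: (eig H0 (fun q => (x q)%:R) b _ h0) | apply: (eig H1 a c _ h1)] => q qP;
  case: (hw qP) => -[].
Qed.
End Decomposed.

(** * Tensor products *)

Section Tensor.
Variable F : fieldType.

Lemma tensmxDl m n p q (A B : 'M[F]_(m, n)) (C : 'M[F]_(p, q)) :
  (A + B) *t C = A *t C + B *t C.
Proof.
apply/matrixP => i j; case: (mxtens_indexP i) => i0 i1; case: (mxtens_indexP j) => j0 j1.
by rewrite [in RHS]mxE !tensmxE mxE mulrDl.
Qed.

Lemma tensmxDr m n p q (A : 'M[F]_(m, n)) (B C : 'M[F]_(p, q)) :
  A *t (B + C) = A *t B + A *t C.
Proof.
apply/matrixP => i j; case: (mxtens_indexP i) => i0 i1; case: (mxtens_indexP j) => j0 j1.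
by rewrite [in RHS]mxE !tensmxE mxE mulrDr.
Qed.

Lemma tensmxZl m n p q c (A : 'M[F]_(m, n)) (B : 'M[F]_(p, q)) :
  (c *: A) *t B = c *: (A *t B).
Proof.
apply/matrixP => i j; case: (mxtens_indexP i) => i0 i1; case: (mxtens_indexP j) => j0 j1.
by rewrite [in RHS]mxE !tensmxE mxE mulrA.
Qed.

Lemma tensmxZr m n p q c (A : 'M[F]_(m, n)) (B : 'M[F]_(p, q)) :
  A *t (c *: B) = c *: (A *t B).
Proof.
apply/matrixP => i j; case: (mxtens_indexP i) => i0 i1; case: (mxtens_indexP j) => j0 j1.
by rewrite [in RHS]mxE !tensmxE mxE mulrCA.
Qed.

Lemma tensmxNl m n p q (A : 'M[F]_(m, n)) (B : 'M[F]_(p, q)) : (- A) *t B = - (A *t B).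
Proof. by rewrite -scaleN1r tensmxZl scaleN1r. Qed.

Lemma tensmxNr m n p q (A : 'M[F]_(m, n)) (B : 'M[F]_(p, q)) : A *t (- B) = - (A *t B).
Proof. by rewrite -scaleN1r tensmxZr scaleN1r. Qed.

(** The product of two columns has width 1 * 1, which computes to 1; the type given here makes it a
    column again. *)
Definition tensv m n (u : 'cV[F]_m) (v : 'cV[F]_n) : 'cV[F]_(m * n) := u *t v.

Lemma tensv_mul m n p q (A : 'M[F]_(p, m)) (B : 'M[F]_(q, n)) (u : 'cV_m) (v : 'cV_n) :
  (A *t B) *m tensv u v = tensv (A *m u) (B *m v).
Proof. exact (@tensmx_mul F p m q n 1 1 A B u v). Qed.

Lemma tensvDl m n (u u' : 'cV[F]_m) (v : 'cV_n) : tensv (u + u') v = tensv u v + tensv u' v.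
Proof. exact (@tensmxDl m 1 n 1 u u' v). Qed.
Lemma tensvZl m n c (u : 'cV[F]_m) (v : 'cV_n) : tensv (c *: u) v = c *: tensv u v.
Proof. exact (@tensmxZl m 1 n 1 c u v). Qed.
Lemma tensvZr m n c (u : 'cV[F]_m) (v : 'cV_n) : tensv u (c *: v) = c *: tensv u v.
Proof. exact (@tensmxZr m 1 n 1 c u v). Qed.
Lemma tensv0 m n (u : 'cV[F]_m) : tensv u (0 : 'cV_n) = 0.
Proof. exact (@tensmx0 F m 1 n 1 u). Qed.
Lemma tens0v m n (v : 'cV[F]_n) : tensv (0 : 'cV_m) v = 0.
Proof. exact (@tens0mx F m 1 n 1 v). Qed.
Lemma tensv_eq0 m n (u : 'cV[F]_m) (v : 'cV_n) : v != 0 -> tensv u v = 0 -> u = 0.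
Proof.
case/matrix0Pn => i [j vij] /matrixP z; apply/matrixP => a b.
have /eqP := etrans (esym (tensmxE u v a i b j)) (z _ _).
by rewrite !mxE mulf_eq0 (negPf vij) orbF => /eqP.
Qed.

Lemma tensmx11 m n : (1%:M : 'M[F]_m) *t (1%:M : 'M[F]_n) = 1%:M.
Proof.
apply/matrixP => i j; case: (mxtens_indexP i) => i0 i1; case: (mxtens_indexP j) => j0 j1.
rewrite tensmxE !mxE (inj_eq (can_inj (@mxtens_indexK _ _))) xpair_eqE.
by rewrite -natrM mulnb.
Qed.

Lemma invmx_unique n (A B : 'M[F]_n) : A *m B = 1%:M -> invmx A = B.
Proof.
move=> AB; have [uA _] := mulmx1_unit AB.
by rewrite -[B](mulKmx uA) AB mulmx1.
Qed.

Lemma invmx_tens m n (A : 'M[F]_m) (B : 'M[F]_n) : A \in unitmx -> B \in unitmx ->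
  invmx (A *t B) = invmx A *t invmx B.
Proof.
by move=> uA uB; apply: invmx_unique; rewrite tensmx_mul !mulmxV // tensmx11.
Qed.

(** A generator of the tensor product is a sum of two parts that q-commute with each other, with
    exponents given by the Cartan entries 2 and -1. After all mixed products are put in normal
    order, the coefficients of each of the six mixed monomials cancel. This serves both Serre
    relations. *)
Lemma serre_sum n (q : F) (A1 A2 B1 B2 : 'M[F]_n) (c := q + q^-1)
    (S := fun A B : 'M[F]_n => A *m A *m B - c *: (A *m B *m A) + B *m A *m A) :
  q != 0 -> A2 *m A1 = q ^- 2 *: (A1 *m A2) -> A2 *m B1 = q *: (B1 *m A2) ->
  B2 *m A1 = q *: (A1 *m B2) -> S A1 B1 = 0 -> S A2 B2 = 0 -> S (A1 + A2) (B1 + B2) = 0.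
Proof.
rewrite /S => q0 AA AB BA s1 s2.
have e1 : A1 *m A2 *m B1 = q *: (A1 *m B1 *m A2).
  by rewrite -mulmxA AB -scalemxAr mulmxA.
have e2 : A2 *m A1 *m B1 = q^-1 *: (A1 *m B1 *m A2).
  rewrite AA -scalemxAl -mulmxA AB -scalemxAr mulmxA scalerA; congr (_ *: _).
  by field.
have e3 : B1 *m A2 *m A1 = q ^- 2 *: (B1 *m A1 *m A2).
  by rewrite -mulmxA AA -scalemxAr mulmxA.
have e4 : A2 *m B1 *m A1 = q^-1 *: (B1 *m A1 *m A2).
  by rewrite AB -scalemxAl e3 scalerA; congr (_ *: _); field.
have e5 : A2 *m B1 *m A2 = q *: (B1 *m A2 *m A2) by rewrite AB -scalemxAl.
have e6 : A2 *m A2 *m B1 = q ^+ 2 *: (B1 *m A2 *m A2).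
  by rewrite -mulmxA AB -scalemxAr mulmxA e5 scalerA.
have e7 : A1 *m B2 *m A1 = q *: (A1 *m A1 *m B2).
  by rewrite -mulmxA BA -scalemxAr mulmxA.
have e8 : B2 *m A1 *m A1 = q ^+ 2 *: (A1 *m A1 *m B2).
  by rewrite BA -scalemxAl e7 scalerA.
have e9 : A2 *m A1 *m B2 = q ^- 2 *: (A1 *m A2 *m B2) by rewrite AA -scalemxAl.
have e10 : A2 *m B2 *m A1 = q^-1 *: (A1 *m A2 *m B2).
  by rewrite -mulmxA BA -scalemxAr mulmxA e9 scalerA; congr (_ *: _); field.
have e11 : B2 *m A1 *m A2 = q *: (A1 *m B2 *m A2) by rewrite BA -scalemxAl.
have e12 : B2 *m A2 *m A1 = q^-1 *: (A1 *m B2 *m A2).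
  by rewrite -mulmxA AA -scalemxAr mulmxA e11 scalerA; congr (_ *: _); field.
rewrite !(mulmxDl, mulmxDr) e1 e2 e3 e4 e5 e6 e7 e8 e9 e10 e11 e12.
move: s1 s2; move: (A1 *m A1 *m B1) (A1 *m B1 *m A1) (B1 *m A1 *m A1) => X1 X2 X3.
move: (A2 *m A2 *m B2) (A2 *m B2 *m A2) (B2 *m A2 *m A2) => Y1 Y2 Y3 /matrixP sX /matrixP sY.
move: (A1 *m B1 *m A2) (B1 *m A1 *m A2) (B1 *m A2 *m A2) (A1 *m A1 *m B2)
  (A1 *m A2 *m B2) (A1 *m B2 *m A2) => Z1 Z2 Z3 Z4 Z5 Z6.
apply/matrixP => i j; move: (sX i j) (sY i j); rewrite !mxE /c.
move: (X1 i j) (X2 i j) (X3 i j) (Y1 i j) (Y2 i j) (Y3 i j) => x1 x2 x3 y1 y2 y3 sx sy.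
have -> : x1 = (q + q^-1) * x2 - x3 by apply/eqP; rewrite -subr_eq0 -sx; apply/eqP; ring.
have -> : y1 = (q + q^-1) * y2 - y3 by apply/eqP; rewrite -subr_eq0 -sy; apply/eqP; ring.
by field.
Qed.
End Tensor.

(** * Powers of q with a diagonalizable exponent *)

Section QPowMx.
Variables (C : numFieldType) (F : fieldType) (Q : qnum C F).
Local Notation gc := (gc Q).
Local Notation qp := (qp Q).

Definition is_exp_mx d (X Y : 'M[F]_d) : Prop :=
  exists (S : 'M[F]_d) (c : 'I_d -> C),
    [/\ S \in unitmx, X = S *m diag_mx (\row_j gc (c j)) *m invmx S
      & Y = S *m diag_mx (\row_j qp (c j)) *m invmx S].

(** In an eigenbasis of X, the entry (i, j) of Y can only be nonzero if c i = c j + a, by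
    injectivity of [gc]; then q^(c i) = q^a q^(c j). *)
Lemma exp_mx_comm d (X T Y : 'M[F]_d) (a : C) : is_exp_mx X T ->
  X *m Y = Y *m X + gc a *: Y -> T *m Y = qp a *: (Y *m T).
Proof.
case=> S [c [uS -> ->]].
set D := diag_mx _; set D' := diag_mx _ => XY.
have [Z YE] : exists Z, Y = S *m Z *m invmx S.
  by exists (invmx S *m Y *m S); rewrite !mulmxA mulmxV // mul1mx mulmxK.
have DZ : D *m Z = Z *m D + gc a *: Z.
  have := congr1 (fun T => invmx S *m T *m S) XY.
  rewrite YE mulmxDr mulmxDl -scalemxAr -scalemxAl !mulmxA.
  by rewrite !(mulVmx uS, mul1mx, mulmxKV uS, mulmxK uS).
have DZ' : D' *m Z = qp a *: (Z *m D').
  apply/matrixP => i j; move: DZ; rewrite /D /D' !mul_diag_mx !mul_mx_diag.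
  move=> /matrixP/(_ i j); rewrite !mxE => e.
  have [->|z0] := eqVneq (Z i j) 0; first by rewrite mul0r !mulr0.
  have : gc (c i) = gc (c j + a).
    apply: (mulIf z0); rewrite e gcD mulrDl; congr (_ + _); exact: mulrC.
  by move/(@gc_inj _ _ Q) ->; rewrite qpD mulrC [qp (c j) * _]mulrC mulrCA.
rewrite YE !mulmxA mulmxKV // -[S *m D' *m Z]mulmxA DZ' -scalemxAr -scalemxAl.
by rewrite mulmxKV // !mulmxA.
Qed.

Lemma exp_mx_eigen d (X T : 'M[F]_d) (u : 'cV_d) (a : C) : is_exp_mx X T ->
  X *m u = gc a *: u -> T *m u = qp a *: u.
Proof.
case=> S [c [uS -> ->]].
set D := diag_mx _; set D' := diag_mx _ => Xu.
have Du : D *m (invmx S *m u) = gc a *: (invmx S *m u).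
  by rewrite scalemxAr -Xu !mulmxA mulVmx // mul1mx.
suff Du' : D' *m (invmx S *m u) = qp a *: (invmx S *m u).
  by rewrite -!mulmxA Du' -scalemxAr mulKVmx.
apply/matrixP => i j; move: Du; rewrite /D /D' !mul_diag_mx; move: (invmx S *m u) => y.
move=> /matrixP/(_ i j); rewrite !mxE => e.
have [->|z0] := eqVneq (y i j) 0; first by rewrite !mulr0.
by congr (qp _ * _); apply/(@gc_inj _ _ Q)/(mulIf z0).
Qed.

Lemma exp_mx_spectrum d (X T : 'M[F]_d) : is_exp_mx X T ->
  exists c : 'I_d -> C, forall (u : 'cV_d) b, u != 0 ->
    X *m u = gc b *: u -> exists j, c j = b.
Proof.
case=> S [c [uS -> _]]; exists c => u b u0 Xu.
have Du : diag_mx (\row_j gc (c j)) *m (invmx S *m u) =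
    gc b *: (invmx S *m u).
  by rewrite scalemxAr -Xu !mulmxA mulVmx // mul1mx.
have y0 : invmx S *m u != 0.
  by apply: contraNneq u0 => y0; rewrite -[u](mulKVmx uS) y0 mulmx0.
have /matrix0Pn[i [j yij]] := y0; exists i.
move: Du; rewrite mul_diag_mx; move: (invmx S *m u) yij => y yij.
by move=> /matrixP/(_ i j); rewrite !mxE => /(mulIf yij)/gc_inj.
Qed.

Lemma exp_mx_unit d (X T : 'M[F]_d) : is_exp_mx X T -> T \in unitmx.
Proof.
case=> S [c [uS _ ->]]; rewrite !unitmx_mul uS unitmx_inv uS andbT /=.
rewrite unitmxE det_diag unitfE; apply/prodf_neq0 => i _.
by rewrite mxE qp_neq0.
Qed.

Lemma exp_mx_tens d d' (X T : 'M[F]_d) (X' T' : 'M[F]_d') :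
  is_exp_mx X T -> is_exp_mx X' T' ->
  is_exp_mx (X *t 1%:M + 1%:M *t X') (T *t T').
Proof.
case=> S [c [uS -> ->]] [S' [c' [uS' -> ->]]].
exists (S *t S'), (fun k => c (mxtens_unindex k).1 + c' (mxtens_unindex k).2).
rewrite invmx_tens //; split.
- by case: (@mulmx1_unit _ _ (S *t S') (invmx S *t invmx S')); rewrite ?tensmx_mul ?mulmxV ?tensmx11.
  rewrite -[X in _ *t X + _](mulmxV uS') -[X in _ + X *t _](mulmxV uS).
  rewrite -[X in _ *t (X *m _) + _]mulmx1 -[X in _ + (X *m _) *t _]mulmx1.
  rewrite -!tensmx_mul -mulmxDl -mulmxDr; congr (_ *m _ *m _).
  apply/matrixP => i j; case: (mxtens_indexP i) => i0 i1; case: (mxtens_indexP j) => j0 j1.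
  rewrite !mxE !mxtens_indexK /= gcD (inj_eq (can_inj (@mxtens_indexK _ _))).
  rewrite xpair_eqE; case: eqP => _; case: eqP => _ /=;
  by rewrite ?(mulr1n, mulr0n, mulr1, mulr0, mul1r, mul0r, addr0).
rewrite -!tensmx_mul; congr (_ *m _ *m _).
apply/matrixP => i j; case: (mxtens_indexP i) => i0 i1; case: (mxtens_indexP j) => j0 j1.
rewrite !mxE !mxtens_indexK /= qpD (inj_eq (can_inj (@mxtens_indexK _ _))).
rewrite xpair_eqE; case: eqP => _; case: eqP => _ /=;
by rewrite ?(mulr1n, mulr0n, mulr1, mulr0, mul1r, mul0r, addr0).
Qed.
End QPowMx.

Ltac tens_ring :=
  repeat match goal with |- context [?A *t ?B] => let X := fresh in move: (A *t B) => X end;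
  let i := fresh in let j := fresh in
  apply/matrixP => i j; rewrite !mxE; ring.

(** * The coproduct respects the defining relations *)

Section UqRelations.
Variables (C : numFieldType) (F : fieldType) (Q : qnum C F).
Local Notation gc := (gc Q).
Local Notation qp := (qp Q).

(** Stated over any ring because the entries occur both as scalars in F and as exponents of q in
    C. *)
Definition cart (S : pzRingType) (i j : 'I_2) : S :=
  if i == j then (if i == 0 then 2%:R else 0) else - 1.
Local Notation odd i := ((i : 'I_2) == 1).

Definition sbr d (s : bool) (A B : 'M[F]_d) : 'M[F]_d :=
  A *m B - (-1) ^+ s *: (B *m A).

Definition qserre d (A B : 'M[F]_d) : 'M[F]_d :=
  A *m A *m B - (qp 1 + (qp 1)^-1) *: (A *m B *m A) + B *m A *m A.

(* The conditions of is_uq_module, over an arbitrary field. *)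
Record uqrel d (E G h T : 'I_2 -> 'M[F]_d) (p : 'M[F]_d) : Prop := UqRel {
  rel_pK : p *m p = 1%:M;
  rel_pE i : p *m E i = (-1) ^+ odd i *: (E i *m p);
  rel_pF i : p *m G i = (-1) ^+ odd i *: (G i *m p);
  rel_ph i : p *m h i = h i *m p;
  rel_qh i : is_exp_mx Q (h i) (T i);
  rel_hh i j : sbr false (h i) (h j) = 0;
  rel_hE i j : sbr false (h i) (E j) = cart F i j *: E j;
  rel_hF i j : sbr false (h i) (G j) = - cart F i j *: G j;
  rel_EF i j : sbr (odd i && odd j) (E i) (G j) =
    if i == j then (qp 1 - (qp 1)^-1)^-1 *: (T i - invmx (T i)) else 0;
  rel_E2 : E 1 *m E 1 = 0;
  rel_F2 : G 1 *m G 1 = 0;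
  rel_serreE : qserre (E 0) (E 1) = 0;
  rel_serreF : qserre (G 0) (G 1) = 0 }.

Lemma gc_cart i j : gc (cart C i j) = cart F i j.
Proof.
by rewrite /cart; do 2?case: ifP => _; rewrite ?gc2 ?gc0 // -[-1]sub0r gcB gc0 gc1 sub0r.
Qed.

Lemma cart_sym (S : pzRingType) i j : cart S i j = cart S j i.
Proof. by rewrite /cart eq_sym; case: eqP => [->|]. Qed.

Definition kos d (p : 'M[F]_d) (i : 'I_2) : 'M[F]_d := if odd i then p else 1%:M.

Section Consequences.
Variables (d : nat) (E G h T : 'I_2 -> 'M[F]_d) (p : 'M[F]_d).
Hypothesis rel : uqrel E G h T p.
Local Notation K i := (invmx (T i)).
Local Notation s := (kos p).
Local Notation sg i j := ((-1) ^+ (odd i && odd j)).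

Lemma uq_hE' i j : h i *m E j = E j *m h i + cart F i j *: E j.
Proof. by rewrite -(rel_hE rel) /sbr expr0 scale1r addrC subrK. Qed.
Lemma uq_hF' i j : h i *m G j = G j *m h i + (- cart F i j) *: G j.
Proof. by rewrite -(rel_hF rel) /sbr expr0 scale1r addrC subrK. Qed.
Lemma uq_hh' i j : h i *m h j = h j *m h i.
Proof. by have /eqP := rel_hh rel i j; rewrite /sbr expr0 scale1r subr_eq0 => /eqP. Qed.
Lemma uq_EF' i j : E i *m G j = sg i j *: (G j *m E i) +
  (if i == j then (qp 1 - (qp 1)^-1)^-1 *: (T i - K i) else 0).
Proof. by rewrite -(rel_EF rel) /sbr addrC subrK. Qed.

Lemma uq_Tu i : T i \in unitmx. Proof. exact: exp_mx_unit (rel_qh rel i). Qed.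

Lemma uq_TE i j : T i *m E j = qp (cart C i j) *: (E j *m T i).
Proof. by apply: exp_mx_comm (rel_qh rel i) _; rewrite gc_cart uq_hE'. Qed.
Lemma uq_TF i j : T i *m G j = qp (- cart C i j) *: (G j *m T i).
Proof.
apply: exp_mx_comm (rel_qh rel i) _.
by rewrite -[- cart C i j]sub0r gcB gc0 sub0r gc_cart uq_hF'.
Qed.

Lemma uq_Tcomm i (Y : 'M_d) : h i *m Y = Y *m h i -> T i *m Y = Y *m T i.
Proof.
move=> hY; rewrite -[RHS]scale1r -(qp0 Q); apply: exp_mx_comm (rel_qh rel i) _.
by rewrite gc0 scale0r addr0.
Qed.

Lemma uq_Kcomm i (Y : 'M_d) a : T i *m Y = qp a *: (Y *m T i) ->
  K i *m Y = qp (- a) *: (Y *m K i).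
Proof.
move=> TY; have uT := uq_Tu i.
have e : T i *m (Y *m K i) = qp a *: Y by rewrite mulmxA TY -scalemxAl mulmxK.
rewrite -[Y *m K i](mulKmx uT) e -scalemxAr scalerA.
by rewrite qpN mulVf ?qp_neq0 // scale1r.
Qed.

Lemma uq_KE i j : K i *m E j = qp (- cart C i j) *: (E j *m K i).
Proof. exact/uq_Kcomm/uq_TE. Qed.
Lemma uq_KF i j : K i *m G j = qp (cart C i j) *: (G j *m K i).
Proof. by rewrite -[cart C i j]opprK; apply/uq_Kcomm/uq_TF. Qed.
Lemma uq_Kcomm1 i (Y : 'M_d) : h i *m Y = Y *m h i -> K i *m Y = Y *m K i.
Proof.
by move/uq_Tcomm => e; have := @uq_Kcomm i Y 0; rewrite oppr0 qp0 !scale1r; apply.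
Qed.
Lemma uq_hT i j : h i *m T j = T j *m h i.
Proof. by rewrite [RHS]uq_Tcomm // uq_hh'. Qed.
Lemma uq_hK i j : h i *m K j = K j *m h i.
Proof. by rewrite [RHS]uq_Kcomm1 // uq_hh'. Qed.
Lemma uq_TT i j : T i *m T j = T j *m T i.
Proof. by apply: uq_Tcomm; rewrite uq_hT. Qed.

Lemma uq_ss i j : s i *m s j = s j *m s i.
Proof. by rewrite /kos; do 2!case: ifP => _; rewrite ?mul1mx ?mulmx1. Qed.
Lemma uq_s2 i : s i *m s i = 1%:M.
Proof. by rewrite /kos; case: ifP => _; rewrite ?mul1mx // (rel_pK rel). Qed.
Lemma uq_sh i j : s i *m h j = h j *m s i.
Proof. by rewrite /kos; case: ifP => _; rewrite ?mul1mx ?mulmx1 ?(rel_ph rel). Qed.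
Lemma uq_sT i j : s i *m T j = T j *m s i.
Proof. by rewrite [RHS]uq_Tcomm // uq_sh. Qed.
Lemma uq_sK i j : s i *m K j = K j *m s i.
Proof. by rewrite [RHS]uq_Kcomm1 // uq_sh. Qed.
Lemma uq_sE i j : s i *m E j = sg i j *: (E j *m s i).
Proof.
by rewrite /kos; case: ifP => _; rewrite /= ?(rel_pE rel) // mul1mx mulmx1 scale1r.
Qed.
Lemma uq_sF i j : s i *m G j = sg i j *: (G j *m s i).
Proof.
by rewrite /kos; case: ifP => _; rewrite /= ?(rel_pF rel) // mul1mx mulmx1 scale1r.
Qed.
Lemma uq_pK i : p *m K i = K i *m p. Proof. exact: (uq_sK 1 i). Qed.
Lemma uq_pT i : p *m T i = T i *m p. Proof. exact: (uq_sT 1 i). Qed.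
Lemma uq_ps i : p *m s i = s i *m p. Proof. exact: (uq_ss 1 i). Qed.
End Consequences.

Section TensorProduct.
Variables (d1 d2 : nat).
Variables (E G h T : 'I_2 -> 'M[F]_d1) (p : 'M[F]_d1).
Variables (E' G' h' T' : 'I_2 -> 'M[F]_d2) (p' : 'M[F]_d2).
Hypothesis rel : uqrel E G h T p.
Hypothesis rel' : uqrel E' G' h' T' p'.
Local Notation K i := (invmx (T i)).
Local Notation s := (kos p).

Definition tE i := E i *t 1%:M + (K i *m s i) *t E' i.
Definition tG i := G i *t T' i + s i *t G' i.
Definition th i := h i *t 1%:M + 1%:M *t h' i.
Definition tT i := T i *t T' i.
Definition tp := p *t p'.

Let tens := (@tensmx_mul F, mulmx1, mul1mx).
Let dist := (mulmxDl, mulmxDr).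

Lemma invmx_tT i : invmx (tT i) = K i *t invmx (T' i).
Proof. by rewrite invmx_tens ?(uq_Tu rel) ?(uq_Tu rel'). Qed.

Lemma tens_parE i : tp *m tE i = (-1) ^+ odd i *: (tE i *m tp).
Proof.
rewrite !dist !tens scalerDr (rel_pE rel) (rel_pE rel') tensmxZl tensmxZr.
by rewrite mulmxA (uq_pK rel) -mulmxA uq_ps mulmxA.
Qed.

Lemma tens_parF i : tp *m tG i = (-1) ^+ odd i *: (tG i *m tp).
Proof.
rewrite !dist !tens scalerDr (rel_pF rel) (rel_pF rel') tensmxZl tensmxZr.
by rewrite (uq_pT rel') uq_ps.
Qed.

Lemma tens_hh i j : sbr false (th i) (th j) = 0.
Proof.
rewrite /sbr expr0 scale1r !dist !tens (uq_hh' rel j i) (uq_hh' rel' j i).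
tens_ring.
Qed.

Lemma tens_hE i j : sbr false (th i) (tE j) = cart F i j *: tE j.
Proof.
have e : h i *m (K j *m s j) = K j *m s j *m h i.
  by rewrite mulmxA (uq_hK rel) -!mulmxA (uq_sh rel).
rewrite /sbr /tE expr0 scale1r !dist !tens (uq_hE' rel) (uq_hE' rel') e tensmxDl tensmxDr.
rewrite tensmxZl tensmxZr.
tens_ring.
Qed.

Lemma tens_hF i j : sbr false (th i) (tG j) = - cart F i j *: tG j.
Proof.
rewrite /sbr /tG expr0 scale1r !dist !tens (uq_hF' rel) (uq_hF' rel') tensmxDl tensmxDr.
rewrite tensmxZl tensmxZr (uq_hT rel') (uq_sh rel).
tens_ring.
Qed.

(** In each mixed term the reordering costs the Koszul sign, and for E' against F also the same
    power of q on both tensor sides, so the mixed terms cancel. With K the inverse of T, the rest is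
    (T - K) (x) T' + K (x) (T' - K'), which telescopes. *)
Lemma tens_EF i j : sbr (odd i && odd j) (tE i) (tG j) =
  if i == j then (qp 1 - (qp 1)^-1)^-1 *: (tT i - invmx (tT i)) else 0.
Proof.
have e1 : s j *m E i = (-1) ^+ (odd i && odd j) *: (E i *m s j).
  by rewrite (uq_sE rel) andbC.
have e2 : K i *m s i *m G j =
    ((-1) ^+ (odd i && odd j) * qp (cart C i j)) *: (G j *m (K i *m s i)).
  by rewrite -mulmxA (uq_sF rel) -scalemxAr mulmxA (uq_KF rel) -scalemxAl scalerA mulmxA.
have e3 : T' j *m E' i = qp (cart C i j) *: (E' i *m T' j).
  by rewrite (uq_TE rel') cart_sym.
have e4 : s j *m (K i *m s i) = K i *m s i *m s j.
  by rewrite mulmxA (uq_sK rel) -!mulmxA uq_ss.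
rewrite /sbr !dist !tens e1 e2 e3 e4 (uq_EF' rel i j) (uq_EF' rel' i j).
rewrite !tensmxDl !tensmxDr !tensmxZl !tensmxZr.
have [<-|_] := eqVneq i j; last first.
  rewrite tens0mx tensmx0; move: (qp _) => q0; case: (_ && _); rewrite /= ?expr0 ?expr1; tens_ring.
rewrite -mulmxA (uq_s2 rel) mulmx1 invmx_tT /tT tensmxZl tensmxZr.
rewrite !(tensmxDl, tensmxDr, tensmxNl, tensmxNr).
move: (qp (cart _ _ _)) ((qp 1 - _)^-1) => q0 z.
by case: (_ && _); rewrite /= ?expr0 ?expr1; tens_ring.
Qed.

Lemma tens_E2 : tE 1 *m tE 1 = 0.
Proof.
rewrite !dist !tens (rel_E2 rel) (rel_E2 rel') tens0mx tensmx0.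
have e : K 1 *m s 1 *m E 1 = - (E 1 *m (K 1 *m s 1)).
  rewrite -mulmxA (uq_sE rel) -scalemxAr mulmxA (uq_KE rel) -scalemxAl mulmxA.
  by rewrite /cart /= oppr0 qp0 scale1r expr1 scaleN1r.
rewrite e tensmxNl.
tens_ring.
Qed.

Lemma tens_F2 : tG 1 *m tG 1 = 0.
Proof.
rewrite !dist !tens (rel_F2 rel) (rel_F2 rel') tens0mx tensmx0.
have e : s 1 *m G 1 = - (G 1 *m s 1) by rewrite (uq_sF rel) /= expr1 scaleN1r.
have e' : T' 1 *m G' 1 = G' 1 *m T' 1.
  by rewrite (uq_TF rel') /cart /= oppr0 qp0 scale1r.
rewrite e e' tensmxNl.
tens_ring.
Qed.

Lemma tens_serreE : qserre (tE 0) (tE 1) = 0.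
Proof.
rewrite /tE /kos /= mulmx1; apply: serre_sum (qp_neq0 _ _) _ _ _ _ _; rewrite !tens.
- rewrite (uq_KE rel) /cart /= tensmxZl; congr (_ *: _).
  by rewrite qpN -[2%:R]/(1 + 1) qpD expr2.
- rewrite (uq_KE rel) /cart /= opprK tensmxZl.
  by [].
- rewrite -mulmxA (rel_pE rel) /= expr0 scale1r mulmxA (uq_KE rel) /cart /= opprK.
  by rewrite -scalemxAl -mulmxA tensmxZl.
- have := rel_serreE rel; rewrite /qserre -tensmxZl => sE.
  by rewrite -tensmxNl -!tensmxDl sE tens0mx.
have Kp : p *m K 0 = K 0 *m p by rewrite (uq_pK rel).
have KK : K 0 *m K 1 = K 1 *m K 0 by rewrite (uq_Kcomm1 rel) // (uq_hK rel).
have -> : K 0 *m (K 1 *m p) *m K 0 = K 0 *m K 0 *m (K 1 *m p).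
  by rewrite -!mulmxA Kp [K 1 *m (K 0 *m p)]mulmxA -KK !mulmxA.
have -> : K 1 *m p *m K 0 *m K 0 = K 0 *m K 0 *m (K 1 *m p).
  rewrite -[K 1 *m p *m K 0]mulmxA Kp mulmxA -KK -!mulmxA Kp.
  by rewrite [K 1 *m (K 0 *m p)]mulmxA -KK !mulmxA.
have := rel_serreE rel'; rewrite /qserre -tensmxZr => sE.
by rewrite -tensmxNr -!tensmxDr sE tensmx0.
Qed.

Lemma tens_serreF : qserre (tG 0) (tG 1) = 0.
Proof.
(* The summands are exchanged because for F it is the first one that carries the power of q, whereas
   [serre_sum] expects it in the second. *)
rewrite /tG /kos /= [G 0 *t _ + _]addrC [G 1 *t _ + _]addrC.
apply: serre_sum (qp_neq0 _ _) _ _ _ _ _; rewrite !tens.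
- rewrite (uq_TF rel') /cart /= tensmxZr; congr (_ *: _).
  by rewrite qpN -[2%:R]/(1 + 1) qpD expr2.
- by rewrite (uq_TF rel') /cart /= opprK tensmxZr (rel_pF rel) /= expr0 scale1r.
- by rewrite (uq_TF rel') /cart /= opprK tensmxZr.
- have := rel_serreF rel'; rewrite /qserre -tensmxZr => sF.
  by rewrite -tensmxNr -!tensmxDr sF tensmx0.
have TT : T' 1 *m T' 0 = T' 0 *m T' 1 by rewrite (uq_TT rel').
have -> : T' 0 *m T' 1 *m T' 0 = T' 0 *m T' 0 *m T' 1 by rewrite -mulmxA TT mulmxA.
have -> : T' 1 *m T' 0 *m T' 0 = T' 0 *m T' 0 *m T' 1 by rewrite TT -mulmxA TT mulmxA.
have := rel_serreF rel; rewrite /qserre -tensmxZl => sF.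
by rewrite -tensmxNl -!tensmxDl sF tens0mx.
Qed.

Lemma tens_rel : uqrel tE tG th tT tp.
Proof.
split.
- by rewrite tensmx_mul (rel_pK rel) (rel_pK rel') tensmx11.
- exact: tens_parE.
- exact: tens_parF.
- by move=> i; rewrite !dist !tens (rel_ph rel) (rel_ph rel').
- by move=> i; apply: exp_mx_tens; [apply: rel_qh rel i | apply: rel_qh rel' i].
- exact: tens_hh.
- exact: tens_hE.
- exact: tens_hF.
- exact: tens_EF.
- exact: tens_E2.
- exact: tens_F2.
- exact: tens_serreE.
- exact: tens_serreF.
Qed.

End TensorProduct.
End UqRelations.

(** * Highest weight vectors of tensor powers *)

Section OfRelations.
Variables (C : numFieldType) (F : fieldType) (Q : qnum C F) (d : nat).
Local Notation gc := (gc Q).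
Local Notation qp := (qp Q).
Variables (E G h T : 'I_2 -> 'M[F]_d) (p : 'M[F]_d).
Hypothesis rel : uqrel Q E G h T p.

Let EG i (u : 'cV_d) b : h i *m u = gc b *: u ->
  E i *m (G i *m u) = (-1) ^+ (i == 1 :> 'I_2) *: (G i *m (E i *m u)) + br Q b *: u.
Proof.
move=> hu; have Tu := exp_mx_eigen (rel_qh rel i) hu.
have Ku : invmx (T i) *m u = (qp b)^-1 *: u.
  by rewrite -[u in RHS](mulKmx (uq_Tu rel i)) Tu -scalemxAr scalerA mulVf ?qp_neq0 // scale1r.
rewrite mulmxA (uq_EF' rel) andbb eqxx mulmxDl -!scalemxAl mulmxBl Tu Ku -mulmxA.
by rewrite -scalerBl scalerA.
Qed.

(** Kept transparent: later proofs convert the fields of this module to the matrices it is built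
    from. *)
Definition qmod_of : qmod Q d.
Proof.
refine (@QMod _ _ Q d (E 0) (E 1) (G 0) (G 1) (h 0) (h 1) p
  _ _ _ _ _ _ _ _ _ _ _ _ _ _ _ _ _ _ _ _ _ _).
- exact: rel_pK rel.
- by rewrite (rel_pE rel) scale1r.
- by rewrite (rel_pE rel) scaleN1r.
- by rewrite (rel_pF rel) scale1r.
- by rewrite (rel_pF rel) scaleN1r.
- exact: uq_hE' rel 0 0.
- by rewrite (uq_hE' rel) scaleN1r.
- by rewrite (uq_hE' rel) scaleN1r.
- by rewrite (uq_hE' rel) scale0r addr0.
- by rewrite (uq_hF' rel) scaleNr.
- by rewrite (uq_hF' rel) /cart /= opprK scale1r.
- by rewrite (uq_hF' rel) /cart /= opprK scale1r.
- by rewrite (uq_hF' rel) /cart /= oppr0 scale0r addr0.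
- by move=> u b hu; rewrite (EG hu) expr0 scale1r.
- by move=> u b hu; rewrite (EG hu) expr1 scaleN1r.
- by rewrite (uq_EF' rel) /= scale1r addr0.
- by rewrite (uq_EF' rel) /= scale1r addr0.
- exact: rel_E2 rel.
- exact: rel_F2 rel.
- by rewrite br2; exact: rel_serreE rel.
- by rewrite br2; exact: rel_serreF rel.
- exact: exp_mx_spectrum (rel_qh rel 0).
Defined.
End OfRelations.
Arguments qmod_of : simpl never.

Section HwStep.
Variables (C : numFieldType) (F : fieldType) (Q : qnum C F) (d : nat).
Variable M : qmod Q d.
Local Notation br := (br Q).
Local Notation E0 := (E0 M).
Local Notation F0 := (F0 M).
Local Notation F1 := (F1 M).
Local Notation Pa := (Pa M).
Variables (x : nat) (a : C) (w : 'cV[F]_d) (f : F).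
Hypotheses (hw : hwv M x%:R a w) (pw : Pa *m w = f *: w).

(* Vectors killed by E0 that are highest for the even part sl(2): they generate the
   (up to) four sl(2)-components of the module with highest weight (x, a). *)
Definition hw_step (s : bool * bool) : 'cV[F]_d :=
  match s with
  | (false, false) => w
  | (true, false) => F1 *m w
  | (true, true) => OmF M *m w
  | (false, true) => br x%:R *: (F0 *m (F1 *m w)) - br (x%:R + 1) *: (F1 *m (F0 *m w))
  end.

(** For x = 0 the step (false, true) would lead to weight -1, which the truncated subtraction cannot
    express. *)
Lemma hw_step_wt s : (s != (false, true)) || (0 < x)%N ->
  wt M (x + s.1 - s.2)%:R (a + s.2%:R) (hw_step s).
Proof.
have [hwt _ _] := hw; case: s => -[] [] /= x0.
- have := wtF1 (wtF0 (wtF1 hwt)); rewrite OmFE addnK.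
  by have -> : x%:R + 1 - 2%:R + 1 = x%:R :> C by ring.
- by have := wtF1 hwt; rewrite subn0 natrD addr0.
- have e1 : x%:R + 1 - 2%:R = (x - 1)%:R :> C by rewrite natrB //; ring.
  have e2 : x%:R - 2%:R + 1 = (x - 1)%:R :> C by rewrite natrB //; ring.
  have := wtF0 (wtF1 hwt); have := wtF1 (wtF0 hwt); rewrite e1 e2 addn0 => h2 h1.
  rewrite -scaleNr; apply: wt_lin h1 _; rewrite -[_ *: _]addr0; apply: wt_lin h2 _.
  by split; rewrite mulmx0 scaler0.
- by rewrite addn0 subn0 addr0.
Qed.

Lemma hw_step_E0 s : E0 *m hw_step s = 0.
Proof.
have [hwt e0 e1] := hw.
have EF v : E0 *m (F1 *m v) = F1 *m (E0 *m v) by rewrite !mulmxA E0F1.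
have e2 : E0 *m (F0 *m (F1 *m w)) = br (x%:R + 1) *: (F1 *m w).
  by rewrite (E0F0 (wtF1 hwt).1) EF e0 !mulmx0 add0r.
case: s => -[] [] /=.
- by rewrite -OmFE EF e2 -scalemxAr mulmxA F1F1 mul0mx scaler0.
- by rewrite EF e0 mulmx0.
- rewrite mulmxBr -!scalemxAr e2 EF (E0F0 hwt.1) e0 mulmx0 add0r -scalemxAr !scalerA.
  by rewrite mulrC subrr.
- by [].
Qed.

Lemma hw_step_par s : Pa *m hw_step s = ((-1) ^+ (s.1 (+) s.2) * f) *: hw_step s.
Proof.
have P0 v : Pa *m (F0 *m v) = F0 *m (Pa *m v) by rewrite !mulmxA PaF0.
have P1 v : Pa *m (F1 *m v) = - (F1 *m (Pa *m v)) by rewrite !mulmxA PaF1 mulNmx.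
have p1 : Pa *m (F1 *m w) = - f *: (F1 *m w) by rewrite P1 pw -scalemxAr scaleNr.
case: s => -[] [] /=; rewrite ?expr0 ?expr1 ?mul1r ?mulN1r //.
- by rewrite -OmFE P1 P0 p1 -!scalemxAr scaleNr opprK.
- rewrite mulmxBr -!scalemxAr P0 p1 P1 P0 pw -!scalemxAr.
  move: (F0 *m (F1 *m w)) (F1 *m (F0 *m w)) => A B.
  by apply/matrixP => i j; rewrite !mxE; ring.
Qed.
End HwStep.

(* A pair of lattice paths is the word of its pairs of steps (upper step, lower
   step), the last step first; true is M_3. *)
Definition path_A (p : seq (bool * bool)) := count fst p.
Definition path_B (p : seq (bool * bool)) := count snd p.
(** With A and B the heights of the upper and lower path, the attached weight has x = A - B - 1 and
    y = B. Paths that have not met satisfy B < A, so the predecessor loses nothing. *)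
Definition path_x p := (path_A p - path_B p).-1.
Definition path_y p := path_B p.

(** The step (false, true) brings the two paths closer; at x = 0 it would make them meet. *)
Definition steps p : seq (bool * bool) :=
  [:: (false, false); (true, false); (true, true)] ++
  (if (0 < path_x p)%N then [:: (false, true)] else [::]).

(** The words in [paths n] have n + 1 letters, one for each tensor factor. The first step is forced:
    the arcs separate at the origin and the upper one goes up. *)
Fixpoint paths n : seq (seq (bool * bool)) :=
  if n is m.+1 then [seq s :: p | p <- paths m, s <- steps p] else [:: [:: (true, false)]].

Lemma paths_consP n q : reflect (exists2 p, p \in paths n & exists2 s, s \in steps p & q = s :: p)
  (q \in paths n.+1).
Proof.
apply: (iffP allpairsPdep) => [[p [s [pP sP ->]]]|[p pP [s sP ->]]].
  by exists p => //; exists s.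
by exists p, s.
Qed.

Lemma path_facts n p : p \in paths n ->
  [/\ size p = n.+1, (path_B p < path_A p)%N & (path_x p + path_y p <= n)%N].
Proof.
elim: n p => [|n IHn] p; first by rewrite inE => /eqP ->.
case/paths_consP => q /IHn[sq BA xy] [s sS ->].
rewrite /= sq; split=> //; move: sS BA xy;
  rewrite /steps /path_x /path_y /path_A /path_B mem_cat !inE /=;
  case: ifP => xq; rewrite ?inE; case: s => -[] [] //=; lia.
Qed.

Lemma uniq_paths n : uniq (paths n).
Proof.
elim: n => // n IHn; apply: allpairs_uniq_dep => // [p _|[p s] [q t] _ _ /= [-> ->] //].
by rewrite /steps; case: ifP.
Qed.

Lemma path_step n p s : p \in paths n -> s \in steps p ->
  path_x (s :: p) = (path_x p + s.1 - s.2)%N /\ path_y (s :: p) = (path_y p + s.2)%N.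
Proof.
move=> /path_facts[_ BA _]; move: BA.
rewrite /steps /path_x /path_y /path_A /path_B mem_cat !inE /=.
by case: ifP => xq; rewrite ?inE; case: s => -[] [] //=; lia.
Qed.

Section TensorStep.
Variables (C : numFieldType) (F : fieldType) (Q : qnum C F) (d1 d2 : nat).
Local Notation gc := (gc Q).
Local Notation br := (br Q).
Variables (E G h T : 'I_2 -> 'M[F]_d1) (p : 'M[F]_d1).
Variables (E' G' h' T' : 'I_2 -> 'M[F]_d2) (p' : 'M[F]_d2).
Hypothesis rel : uqrel Q E G h T p.
Hypothesis rel' : uqrel Q E' G' h' T' p'.
Let M := qmod_of rel.
Let V := qmod_of rel'.
Let MV := qmod_of (tens_rel rel rel').

Variables (alpha : C) (v : 'cV[F]_d2) (e : F).
Hypotheses (hv : hwv V 0 alpha v) (pv : p' *m v = e *: v).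
Let vl := OmF V *m v.

Let hv0 : hwv V (0%N)%:R alpha v. Proof. by []. Qed.

Lemma wt_vl : wt V 0 (alpha + 1) vl.
Proof. exact: (hw_step_wt hv0 (s := (true, true)) isT). Qed.

Lemma E0_vl : E0 V *m vl = 0.
Proof. exact: (hw_step_E0 hv0 (true, true)). Qed.

(* Since vl is killed by E0, m |-> m (x) vl keeps the vectors killed by E0, and Om
   makes them highest weight vectors. *)
Definition new_hw (m : 'cV[F]_d1) : 'cV[F]_(d1 * d2) := Om MV *m (tensv m vl).

Lemma new_hwD m1 m2 : new_hw (m1 + m2) = new_hw m1 + new_hw m2.
Proof. by rewrite /new_hw tensvDl mulmxDr. Qed.
Lemma new_hwZ c m : new_hw (c *: m) = c *: new_hw m.
Proof. by rewrite /new_hw tensvZl -scalemxAr. Qed.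
Lemma new_hw0 : new_hw 0 = 0.
Proof. by rewrite -(scale0r 0) new_hwZ scale0r. Qed.

Lemma new_hwP m b c : wt M b c m -> E0 M *m m = 0 -> hwv MV b (c + alpha) (new_hw m).
Proof.
move=> hm em; have hl := wt_vl.
have tw : wt MV b (c + (alpha + 1)) (tensv m vl).
  split.
    rewrite -[H0 MV]/(H0 M *t 1%:M + 1%:M *t H0 V) mulmxDl !tensv_mul !mul1mx.
    by rewrite hm.1 hl.1 gc0 scale0r tensv0 addr0 tensvZl.
  rewrite -[H1 MV]/(H1 M *t 1%:M + 1%:M *t H1 V) mulmxDl !tensv_mul !mul1mx.
  by rewrite hm.2 hl.2 tensvZl tensvZr -scalerDl -gcD.
split.
- have := wtE1 (wtE0 (wtE1 tw)).
  have -> : b - 1 + 2%:R - 1 = b by ring.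
  have -> : c + (alpha + 1) - 1 = c + alpha by ring.
  by rewrite !mulmxA.
- rewrite /new_hw mulmxA E0Om -mulmxA.
  have -> : E0 MV *m (tensv m vl) = 0; last by rewrite mulmx0.
  rewrite -[E0 MV]/(tE E T p E' 0) mulmxDl !tensv_mul mul1mx.
  by rewrite -[E 0]/(E0 M) -[E' 0]/(E0 V) em E0_vl tens0v tensv0 addr0.
by rewrite /new_hw mulmxA E1Om mul0mx.
Qed.

Lemma new_hw_par m f : p *m m = f *: m -> tp p p' *m new_hw m = (f * e) *: new_hw m.
Proof.
move=> pm; have pl : p' *m vl = e *: vl.
  by have := hw_step_par 0 (pv : Pa V *m v = e *: v) (true, true); rewrite mul1r.
have PO : tp p p' *m Om MV = Om MV *m tp p p'.
  have P0 := PaE0 MV; have P1 := PaE1 MV; rewrite -[tp p p']/(Pa MV) in P0 P1 *.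
  rewrite /Om 2!mulmxA P1 2!mulNmx -[E1 MV *m Pa MV *m _]mulmxA P0 mulmxA.
  by rewrite -[E1 MV *m E0 MV *m Pa MV *m _]mulmxA P1 mulmxN opprK mulmxA.
by rewrite /new_hw mulmxA PO -mulmxA tensv_mul pm pl tensvZl tensvZr scalerA -scalemxAr.
Qed.

Variable Pv : 'M[F]_d2.
Hypotheses (Pv0 : Pv *m v = v) (Pv1 : Pv *m (F1 V *m v) = 0)
  (Pv2 : Pv *m (F0 V *m (F1 V *m v)) = 0) (Pv3 : Pv *m vl = 0).
Hypotheses (v0 : v != 0) (F0v : F0 V *m v = 0).
Hypotheses (alpha0 : alpha != 0) (alpha1 : alpha + 1 != 0).

(* Only the term of Om *m (m (x) vl) with Om acting on vl alone has a component
   along v, and it is an invertible operator applied to m. *)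
Lemma new_hw_inj m : new_hw m = 0 -> m = 0.
Proof.
move=> /(congr1 (mulmx (1%:M *t Pv))); rewrite mulmx0.
have [hw e0 e1] := hv.
pose k1 := invmx (T 1) *m kos p 1; pose k0 := invmx (T 0) *m kos p 0.
have tE1 (a : 'cV_d1) (b : 'cV_d2) :
    E1 MV *m (tensv a b) = tensv (E1 M *m a) b + tensv (k1 *m a) (E1 V *m b).
  by rewrite -[E1 MV]/(tE E T p E' 1) mulmxDl !tensv_mul mul1mx.
have tE0 (a : 'cV_d1) (b : 'cV_d2) :
    E0 MV *m (tensv a b) = tensv (E0 M *m a) b + tensv (k0 *m a) (E0 V *m b).
  by rewrite -[E0 MV]/(tE E T p E' 0) mulmxDl !tensv_mul mul1mx.
have E1l : E1 V *m vl = br (alpha + 1) *: (F0 V *m (F1 V *m v)).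
  by rewrite (E1_OmF hw e1) F0v mulmx0 scaler0 subr0.
have E0l : E0 V *m (F0 V *m (F1 V *m v)) = F1 V *m v.
  rewrite (E0F0 (wtF1 hw).1) add0r br1 scale1r [E0 V *m (F1 V *m v)]mulmxA E0F1 -mulmxA e0 !mulmx0.
  by rewrite add0r.
have E1f : E1 V *m (F1 V *m v) = br alpha *: v.
  by rewrite (E1F1 hw.2) e1 mulmx0 oppr0 add0r.
have E1ff : E1 V *m (F0 V *m (F1 V *m v)) = 0.
  by rewrite [LHS]mulmxA E1F0 -mulmxA E1f -scalemxAr F0v scaler0.
rewrite /new_hw -2!mulmxA tE1 E1l tensvZr mulmxDr -scalemxAr !tE0 E0_vl tensv0 addr0 E0l.
rewrite !(mulmxDr, =^~ scalemxAr, scalerDr) !tE1 E1l E1f E1ff.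
rewrite !(mulmxDr, =^~ scalemxAr, scalerDr, tensv_mul, mul1mx) ?mulmx0.
rewrite !(Pv0, Pv1, Pv2, Pv3, mulmx0, scaler0, tensv0, addr0, add0r).
(* What survives is [alpha] [alpha + 1] (k1 k0 k1 m) (x) v, with both brackets nonzero and [k1],
   [k0] invertible. *)
rewrite tensvZr scalerA => /eqP; rewrite scaler_eq0 mulf_eq0 !br_eq0.
rewrite (negPf alpha0) (negPf alpha1) /= => /eqP z.
have z0 := tensv_eq0 v0 z.
have ku k : (kos p k) \in unitmx.
  by case: (mulmx1_unit (uq_s2 rel k)).
have k1u : k1 \in unitmx by rewrite unitmx_mul unitmx_inv (uq_Tu rel) ku.
have k0u : k0 \in unitmx by rewrite unitmx_mul unitmx_inv (uq_Tu rel) ku.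
by rewrite -(mulKmx k1u m) -(mulKmx k0u (k1 *m m)) -(mulKmx k1u (k0 *m _)) z0 !mulmx0.
Qed.
End TensorStep.

(** * The module V(0, alpha) *)

Section FourDimensional.
Variables (C : numFieldType) (F : fieldType) (Q : qnum C F) (d : nat).
Variable V : qmod Q d.
Variables (alpha : C) (v : 'cV[F]_d) (e : F).
Hypotheses (hv : hwv V 0 alpha v) (pv : Pa V *m v = e *: v) (v0 : v != 0).
Hypotheses (alpha0 : alpha != 0) (alpha1 : alpha + 1 != 0).
Hypothesis gen_v : forall U : {vspace 'cV[F]_d},
  (forall X u, u \in U -> op V X *m u \in U) -> v \in U -> (fullv <= U)%VS.

Let P := [:: tt].
Let hw : {in P, forall p : unit, hwv V 0%:R alpha v}. Proof. by []. Qed.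
Let typ : {in P, forall p : unit, (alpha != 0) && (0%:R + alpha + 1 != 0)}.
Proof. by move=> ? _; rewrite add0r alpha0. Qed.
Let indep (c : unit -> F) : \sum_(p <- P) c p *: v = 0 -> {in P, forall p, c p = 0}.
Proof.
rewrite big_seq1 => /eqP; rewrite scaler_eq0 (negPf v0) orbF => /eqP c0.
by move=> [].
Qed.

Lemma F0_lowest : F0 V *m v = 0.
Proof. by rewrite -[F0 V]expr1; exact: F0X_eq0 (hw (mem_head tt [::])) _. Qed.

(** Since F0 v = 0, only the four vectors [kv V i 0 v] remain. They are free by typicality, and by
    [act_kv] their span is stable, hence everything. *)
Lemma dim4 : d = 4.
Proof.
pose b (i : nat) := kv V i 0 v; pose X := [tuple b i | i < 4].
have Xb (i : 'I_4) : X`_i = b i by rewrite -tnth_nth tnth_mktuple.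
have frX : free X.
  apply/freeP => k s0 i.
  suff: k (inord i) = 0 by rewrite inord_val.
  apply: (kv_free (x := fun=> 0%N) hw indep typ (c := fun _ _ j => k (inord j)) _
    (mem_head tt [::]) (leqnn 0) (ltn_ord i)).
  rewrite big_seq1 big_ord1 -[RHS]s0; apply: eq_bigr => j _.
  by rewrite inord_val Xb.
have spX : (fullv <= <<X>>)%VS.
  have bX i : (i < 4)%N -> b i \in <<X>>%VS.
    by move=> i4; apply: memv_span; rewrite -(Xb (Ordinal i4)) mem_nth ?size_tuple.
  apply: gen_v => [op' u /coord_span ->|]; last first.
    by have := bX 0%N isT; rewrite /b /= expr0 -idmxE mul1mx.
  rewrite mulmx_sumr rpred_sum // => i _; rewrite -scalemxAr rpredZ // Xb.
  have z j k : (0 < k)%N -> kv V j k v = 0.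
    by move=> k0; have := F0X_eq0 (hw (mem_head tt [::])) k0; case: j => [|[|[|j]]] /= ->; rewrite ?mulmx0.
  rewrite (act_kv op' 0 hv pv (ltn_ord i)) big_seq rpred_sum // => t tX.
  rewrite rpredZ //; have [k0|k0] := posnP t.2.2; last by rewrite z // rpred0.
  rewrite k0; apply: bX; move: tX.
  by case: op'; case: i => [] [|[|[|[|//]]]] i4 //=; rewrite !inE; do ?[case/orP]; move=> /eqP ->.
have := dimvS spX; rewrite (eqnP frX) size_tuple dimvf /dim /= muln1.
have := dimvS (subvf <<X>>); rewrite (eqnP frX) size_tuple dimvf /dim /= muln1.
by move=> h1 h2; apply/eqP; rewrite eqn_leq h1 h2.
Qed.

Lemma exists_top_projector : exists Pv : 'M[F]_d,
  [/\ Pv *m v = v, Pv *m (F1 V *m v) = 0, Pv *m (F0 V *m (F1 V *m v)) = 0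
    & Pv *m (OmF V *m v) = 0].
Proof.
have dimP : (\sum_(p <- P) 4 * 0.+1 = d)%N by rewrite big_seq1 dim4.
have [_ ext] := kv_basis (P := P) (x := fun=> 0%N) isT hw indep typ dimP d.
have [f fE] := ext (fun _ _ i => if i is 0%N then v else 0).
exists f; have fi i i4 := fE tt (mem_head _ _) 0%N i (leqnn 0) i4.
have k0 u : F0 V ^+ 0 *m u = u by rewrite expr0 -idmxE mul1mx.
split; [have := fi 0%N isT|have := fi 1%N isT|have := fi 2%N isT|have := fi 3%N isT];
  by rewrite /kv k0 ?OmFE.
Qed.
End FourDimensional.

Section Decomposition.
Variables (C : numFieldType) (F : fieldType) (Q : qnum C F).
Variables (alpha : C) (e : F).
Hypothesis alpha_gen : forall n m : nat, n.+1%:R * alpha + m%:R != 0.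

(** The induction hypothesis on the number of factors. The parity sign is recorded as a function of
    x and n alone, so that components of equal weight are isomorphic as graded modules and the
    matrix units commute with the parity operator. *)
Definition decomposed d (E G h T : 'I_2 -> 'M[F]_d) p (rel : uqrel Q E G h T p) n
    (w : seq (bool * bool) -> 'cV[F]_d) : Prop :=
  [/\ {in paths n, forall q,
        hwv (qmod_of rel) (path_x q)%:R (n.+1%:R * alpha + (path_y q)%:R) (w q)},
      {in paths n, forall q, p *m w q = (e ^+ n.+1 * (-1) ^+ path_x q) *: w q},
      forall c : seq (bool * bool) -> F,
        \sum_(q <- paths n) c q *: w q = 0 -> {in paths n, forall q, c q = 0}
    & (\sum_(q <- paths n) 4 * (path_x q).+1 = d)%N].

Lemma typical_weights n : {in paths n, forall q, (n.+1%:R * alpha + (path_y q)%:R != 0) &&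
  ((path_x q)%:R + (n.+1%:R * alpha + (path_y q)%:R) + 1 != 0)}.
Proof.
move=> q _; rewrite alpha_gen /=.
have -> : (path_x q)%:R + (n.+1%:R * alpha + (path_y q)%:R) + 1 =
    n.+1%:R * alpha + (path_x q + path_y q + 1)%:R by rewrite !natrD; ring.
exact: alpha_gen.
Qed.

(** Written in the basis [kv], the vectors of the four steps involve disjoint sets of basis vectors,
    and that of (false, true) contains F0 F1 w with coefficient [x], nonzero exactly when this step
    is allowed. *)
Lemma hw_steps_free d (M : qmod Q d) n (w : seq (bool * bool) -> 'cV[F]_d) a :
  {in paths n, forall q, hwv M (path_x q)%:R (a q) (w q)} ->
  (forall c : seq (bool * bool) -> F,
    \sum_(q <- paths n) c q *: w q = 0 -> {in paths n, forall q, c q = 0}) ->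
  {in paths n, forall q, (a q != 0) && ((path_x q)%:R + a q + 1 != 0)} ->
  forall c : seq (bool * bool) -> F,
  \sum_(q <- paths n) \sum_(s <- steps q) c (s :: q) *: hw_step M (path_x q) (w q) s = 0 ->
  {in paths n, forall q, {in steps q, forall s, c (s :: q) = 0}}.
Proof.
move=> hw indep typ c s0.
pose ft q := if (0 < path_x q)%N then c ((false, true) :: q) else 0.
pose y q k i : F := match k, i with
  | 0, 0 => c ((false, false) :: q) | 0, 1 => c ((true, false) :: q)
  | 0, 2 => ft q * br Q (path_x q)%:R | 0, 3 => c ((true, true) :: q)
  | 1, 1 => - (ft q * br Q ((path_x q)%:R + 1)) | _, _ => 0 end.
have y0 : {in paths n, forall q k i, (k <= path_x q)%N -> (i < 4)%N -> y q k i = 0}.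
  apply: (kv_free hw indep typ); rewrite -[RHS]s0; apply: eq_bigr => q _.
  have k0 u : F0 M ^+ 0 *m u = u by rewrite expr0 -idmxE mul1mx.
  have first4 : \sum_(i < 4) y q 0%N i *: kv M i 0 (w q) =
      c ((false, false) :: q) *: w q + (c ((true, false) :: q) *: (F1 M *m w q) +
      ((ft q * br Q (path_x q)%:R) *: (F0 M *m (F1 M *m w q)) +
       c ((true, true) :: q) *: (OmF M *m w q))).
    by rewrite !big_ord_recl big_ord0 /= !k0 OmFE addr0.
  rewrite /steps big_cat !big_cons big_nil /= addr0.
  case xq: (path_x q) => [|x].
    by rewrite big_ord1 first4 /ft xq /= big_nil addr0 mul0r scale0r add0r.
  rewrite big_seq1 2!big_ord_recl first4 /ft xq /= [X in _ + (_ + X)]big1 => [|k _]; last first.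
    by rewrite big1 // => i _; rewrite /y /= scale0r.
  rewrite /y /ft xq /=.
  rewrite !big_ord_recl big_ord0 /= !scale0r !(addr0, add0r) expr1 natr1.
  rewrite scalerBr !scalerA scaleNr.
  move: (_ *: _) (_ *: _) (_ *: _) (_ *: _) (_ *: _) => A1 A2 A3 A4 A5.
  by apply/matrixP => i j; rewrite !mxE; ring.
move=> q qP s; have := y0 q qP; rewrite /steps mem_cat !inE => {}y0.
case/orP => [/or3P[]/eqP->|]; [exact: y0 0%N 0%N _ _|exact: y0 0%N 1%N _ _
  |exact: y0 0%N 3%N _ _|].
case: ifP => // x0; rewrite inE => /eqP->.
have /eqP := y0 0%N 2%N isT isT; rewrite /y /ft x0 mulf_eq0 br_eq0 pnatr_eq0.
by rewrite eqn0Ngt x0 orbF => /eqP.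
Qed.

Variables (d2 : nat) (E' G' h' T' : 'I_2 -> 'M[F]_d2) (p' : 'M[F]_d2).
Hypothesis rel' : uqrel Q E' G' h' T' p'.
Let V := qmod_of rel'.
Variable v : 'cV[F]_d2.
Hypotheses (hv : hwv V 0 alpha v) (pv : p' *m v = e *: v) (v0 : v != 0).
Hypothesis gen_v : forall U : {vspace 'cV[F]_d2},
  (forall X u, u \in U -> op V X *m u \in U) -> v \in U -> (fullv <= U)%VS.

Let alpha0 : alpha != 0. Proof. by have := alpha_gen 0 0; rewrite mul1r addr0. Qed.
Let alpha1 : alpha + 1 != 0. Proof. by have := alpha_gen 0 1; rewrite mul1r. Qed.

Lemma decomposed_base : decomposed rel' 0 (fun=> v).
Proof.
split.
- by move=> q; rewrite inE => /eqP-> /=; rewrite mul1r addr0.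
- by move=> q; rewrite inE => /eqP-> /=; rewrite pv !expr1 expr0 mulr1.
- move=> c; rewrite big_seq1 => /eqP; rewrite scaler_eq0 (negPf v0) orbF => /eqP c0 q.
  by rewrite inE => /eqP->.
by rewrite big_seq1 (dim4 hv (pv : Pa V *m v = e *: v) v0 alpha0 alpha1 gen_v).
Qed.

Lemma decomposed_step d (E G h T : 'I_2 -> 'M[F]_d) p (rel : uqrel Q E G h T p) n w :
  decomposed rel n w -> decomposed (tens_rel rel rel') n.+1
    (fun q => if q is s :: q' then
       new_hw rel rel' v (hw_step (qmod_of rel) (path_x q') (w q') s) else 0).
Proof.
case=> hw par indep dimP.
have pv' : Pa V *m v = e *: v by [].
have d4 := dim4 hv pv' v0 alpha0 alpha1 gen_v.
have [Pv [Pv0 Pv1 Pv2 Pv3]] := exists_top_projector hv pv' v0 alpha0 alpha1 gen_v.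
have F0v := F0_lowest hv.
have ft q s : s \in steps q -> (s != (false, true)) || (0 < path_x q)%N.
  by case: s => -[] [] //=; rewrite /steps mem_cat; case: ifP.
split.
- move=> q' /paths_consP[q qP [s sS ->]]; have [-> ->] := path_step qP sS.
  have := new_hwP hv (hw_step_wt (hw q qP) (ft q s sS)) (hw_step_E0 (hw q qP) s).
  congr (hwv _ _ _ _); rewrite natrD -[n.+2%:R]natr1; ring.
- move=> q' /paths_consP[q qP [s sS ->]]; have [-> _] := path_step qP sS.
  have := new_hw_par rel rel' pv (hw_step_par (path_x q) (par q qP : Pa (qmod_of rel) *m _ = _) s).
  have <- : (-1) ^+ (s.1 (+) s.2) * (-1) ^+ path_x q = (-1) ^+ (path_x q + s.1 - s.2) :> F.
    rewrite -[(-1) ^+ path_x q]signr_odd -[in RHS]signr_odd -signr_addb.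
    congr (_ ^+ _); have := ft q s sS; case: s {sS} => -[] [] /=; case: (path_x q) => [|x] //=;
      by rewrite ?addn0 ?subn0 ?addn1 ?subn1 ?addTb ?negbK.
  rewrite /tp => ->; congr (_ *: _); rewrite [e ^+ n.+2]exprSr.
  by move: (e ^+ n.+1) ((-1) ^+ (_ (+) _)) ((-1) ^+ path_x q) => A1 A2 A3; ring.
- move=> c; rewrite big_allpairs_dep => s0 q' /paths_consP[q qP [s sS ->]].
  (* Since [new_hw] is linear and injective, a relation among the new vectors pulls back to one
     among the step vectors of the smaller module. *)
  have key := hw_steps_free hw indep (@typical_weights n).
  apply: (key c _ q qP s sS).
  apply: (new_hw_inj (rel := rel) hv Pv0 Pv1 Pv2 Pv3 v0 F0v alpha0 alpha1); rewrite -[RHS]s0.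
  have sumD (J : Type) (r : seq J) (f : J -> 'cV_d) :
      new_hw rel rel' v (\sum_(j <- r) f j) = \sum_(j <- r) new_hw rel rel' v (f j).
    apply: (big_morph _ (new_hwD rel rel' v) (new_hw0 rel rel' v)).
  rewrite sumD; apply: eq_bigr => t _; rewrite sumD; apply: eq_bigr => u _.
  by rewrite new_hwZ.
(* The steps contribute (x + 1) + (x + 2) + (x + 1) + x = 4 (x + 1), matching the factor dim V = 4.
   The last summand belongs to (false, true) and is 0 exactly when that step is missing. *)
rewrite big_allpairs_dep -dimP d4 mulnC big_distrr /=; apply: eq_big_seq => q qP.
rewrite /steps; have st s := path_step (s := s) qP.
rewrite (eq_big_seq (fun s : bool * bool => (4 * (path_x q + s.1 - s.2).+1)%N)) => [|s /st[-> _] //].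
rewrite big_cat !big_cons big_nil /=; case: ifP => x0; rewrite ?big_seq1 ?big_nil /=; lia.
Qed.
End Decomposition.

(** * Curves and pairs of half-paths *)

Section LatticePaths.
Local Open Scope nat_scope.

(** The recursive choice of allowed steps amounts to a ballot condition on every nonempty initial
    part of the walk; these parts are the [drop k q], the last step coming first. *)
Lemma paths_ballot n q : reflect
  (size q = n.+1 /\ forall k, k <= n -> path_B (drop k q) < path_A (drop k q))
  (q \in paths n).
Proof.
elim: n q => [|n IHn] q.
  rewrite inE; apply: (iffP eqP) => [->|[]]; first by split=> // -[|k].
  by case: q => [|[[] []] []] //= _ /(_ 0 isT).
apply: (iffP (paths_consP _ _)) => [[p pP [s sS ->]]|[]].
  have [sp bp] := IHn p pP; split=> [|[|k] kn]; rewrite /= ?sp //; last exact: bp.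
  have spP : s :: p \in paths n.+1 by apply/paths_consP; exists p => //; exists s.
  by have [_ ? _] := path_facts spP.
case: q => // s p [sp] bq; have pP : p \in paths n.
  by apply/IHn; split=> // k kn; have := bq k.+1 kn.
exists p => //; exists s => //; have := bq 0 isT; have [_ BA _] := path_facts pP.
rewrite drop0 /steps mem_cat /path_x; move: BA; rewrite /path_A /path_B /=.
by case: s {bq} => -[] [] //= BA BA'; rewrite ifT ?inE //; lia.
Qed.

Section Words.
Implicit Types w a b : seq bool.

Lemma count_negb w : count negb w = size w - count id w.
Proof. by rewrite -(count_predC id w) addKn. Qed.

Lemma count_id_le w : count id w <= size w. Proof. exact: count_size. Qed.

Lemma reflect_cat a b : reflect_path (a ++ b) = reflect_path b ++ reflect_path a.
Proof. by rewrite /reflect_path map_cat rev_cat. Qed.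

Lemma reflect_pathK : involutive reflect_path.
Proof. by move=> w; rewrite /reflect_path map_rev revK mapK //; exact: negbK. Qed.

Lemma size_reflect w : size (reflect_path w) = size w.
Proof. by rewrite size_rev size_map. Qed.

(** Reflection turns the last k steps of w, reversed and exchanged, into the first k. The additive
    form avoids truncated subtraction. *)
Lemma count_take_reflect w k : k <= size w ->
  count id (take k (reflect_path w)) + count id w = k + count id (take (size w - k) w).
Proof.
move=> kw; rewrite /reflect_path take_rev size_map count_rev -map_drop count_map.
rewrite (eq_count (a2 := negb)) => [|b //]; rewrite count_negb size_drop.
have := cat_take_drop (size w - k) w => /(congr1 (count id)); rewrite count_cat.
have := count_id_le (drop (size w - k) w); rewrite size_drop; lia.
Qed.

(** The reversal puts the last step first, as in [paths]. *)
Definition half_word (ab : seq bool * seq bool) := rev (zip ab.1 ab.2).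

Lemma half_word_drop a b k : size a = size b ->
  (path_A (drop k (half_word (a, b))) = count id (take (size a - k) a)) *
  (path_B (drop k (half_word (a, b))) = count id (take (size a - k) b)).
Proof.
move=> sab; rewrite /half_word drop_rev size_zip sab minnn /path_A /path_B !count_rev.
have c1 (s : seq (bool * bool)) : count fst s = count id (unzip1 s) by rewrite count_map.
have c2 (s : seq (bool * bool)) : count snd s = count id (unzip2 s) by rewrite count_map.
by rewrite c1 c2 /unzip1 /unzip2 !map_take -/unzip1 -/unzip2 unzip1_zip ?unzip2_zip ?sab.
Qed.

Lemma half_word_inj N a b a' b' : size a = N -> size b = N -> size a' = N -> size b' = N ->
  (half_word (a, b) == half_word (a', b')) = ((a, b) == (a', b')).
Proof.
move=> sa sb sa' sb'; apply/eqP/eqP => [/(can_inj revK) e|[-> ->] //].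
have := congr1 unzip1 e; have := congr1 unzip2 e.
by rewrite /= !unzip1_zip ?unzip2_zip ?sa ?sb ?sa' ?sb' // => -> ->.
Qed.
End Words.

(** Every point of the simplex is reached, so no family of symmetric curves attached to such a point
    is empty. *)
Lemma path_with n x y : x + y <= n -> exists2 q, q \in paths n & path_x q = x /\ path_y q = y.
Proof.
elim: n x y => [|m IHm] x y xy.
  by exists [:: (true, false)] => //; move: xy; case: x => //; case: y.
have ext q s : q \in paths m -> s \in steps q -> s :: q \in paths m.+1.
  by move=> qP sS; apply/paths_consP; exists q => //; exists s.
have [xy'|xy'] := leqP (x + y) m.
  have [q qP [qx qy]] := IHm x y xy'; exists ((false, false) :: q); first exact: ext.
  by have [-> ->] := path_step (s := (false, false)) qP isT; rewrite qx qy !addn0 subn0.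
case: x xy xy' => [|x] xy xy'.
  have [q qP [qx qy]] := IHm 0 y.-1 ltac:(lia); exists ((true, true) :: q); first exact: ext.
  by have [-> ->] := path_step (s := (true, true)) qP isT; rewrite qx qy /=; lia.
have [q qP [qx qy]] := IHm x y ltac:(lia); exists ((true, false) :: q); first exact: ext.
by have [-> ->] := path_step (s := (true, false)) qP isT; rewrite qx qy /=; lia.
Qed.

Section CurvePaths.
Variable n : nat.
Local Notation N := n.+1.
Implicit Types s t : curve N.

Lemma size_upper s : size (upper s) = N.*2. Proof. exact: size_tuple. Qed.
Lemma size_lower s : size (lower s) = N.*2. Proof. exact: size_tuple. Qed.

Lemma count_full (w : seq bool) : size w = N.*2 -> point w N.*2 = (N, N) -> count id w = N.
Proof. by move=> sw; rewrite /point take_oversize ?sw // => -[_ ->]. Qed.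

Lemma count_upper s : count id (upper s) = N.
Proof. by have [_ p _ _] := curveP s; apply: count_full (size_upper s) p. Qed.
Lemma count_lower s : count id (lower s) = N.
Proof. by have [_ _ p _] := curveP s; apply: count_full (size_lower s) p. Qed.

(** The height difference is 1 after the first step, changes by at most 1 at each step and never
    vanishes strictly between the ends, so it stays positive. *)
Lemma lower_lt_upper s k : 0 < k < N.*2 ->
  count id (take k (lower s)) < count id (take k (upper s)).
Proof.
have [hd _ _ neq] := curveP s; have su := size_upper s; have sl := size_lower s.
have neq_count j : 0 < j < N.*2 -> count id (take j (upper s)) != count id (take j (lower s)).
  move=> jN; apply: contra (neq j jN) => /eqP e.
  by rewrite /point !count_negb e !size_take su sl.
have takeS (w : seq bool) j : size w = N.*2 -> j < N.*2 ->
    count id (take j.+1 w) = count id (take j w) + nth false w j.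
  by move=> sw jN; rewrite (take_nth false) ?sw // -cats1 count_cat /= addn0.
elim: k => // -[_|k IHk] kN.
  have := neq_count 1 kN; have k1 : 0 < N.*2 by lia.
  by rewrite !takeS // !take0 /= !add0n nth0 hd; case: (nth _ _ _).
have kN2 : k.+1 < N.*2 by lia.
have := neq_count k.+2 kN; have := IHk kN2.
rewrite (takeS _ k.+1 su) ?(takeS _ k.+1 sl); lia.
Qed.

Definition lword s := half_word (lhalf s).
Definition rword s := half_word (rhalf s).

Lemma size_lhalf s : (size (lhalf s).1 = N) * (size (lhalf s).2 = N).
Proof. by rewrite /lhalf /= !size_takel ?size_upper ?size_lower //; lia. Qed.
Lemma size_rhalf s : (size (rhalf s).1 = N) * (size (rhalf s).2 = N).
Proof.
by rewrite /rhalf /= !size_takel ?size_reflect ?size_upper ?size_lower //; lia.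
Qed.

Lemma rword_eq_lword s t : (rword s == lword t) = (rhalf s == lhalf t).
Proof.
have := size_rhalf s; have := size_lhalf t; rewrite /rword /lword.
case: (rhalf s) => a b; case: (lhalf t) => a' b' /= [sa' sb'] [sa sb].
exact: (half_word_inj sa sb sa' sb').
Qed.

Lemma lword_eq_rword s : (lword s == rword s) = symmetric_curve s.
Proof. by rewrite eq_sym rword_eq_lword symmetric_halves eq_sym. Qed.

Lemma words_inj s t : lword s = lword t -> rword s = rword t -> s = t.
Proof.
move=> el er; apply: half_inj; apply/eqP.
  have := size_lhalf s; have := size_lhalf t; move/eqP: el; rewrite /lword.
  case: (lhalf s) => a b; case: (lhalf t) => a' b' e /= [sa' sb'] [sa sb].
  by rewrite -(half_word_inj sa sb sa' sb').
have := size_rhalf s; have := size_rhalf t; move/eqP: er; rewrite /rword.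
case: (rhalf s) => a b; case: (rhalf t) => a' b' e /= [sa' sb'] [sa sb].
by rewrite -(half_word_inj sa sb sa' sb').
Qed.

Lemma lword_AB s : (path_A (lword s) = count id (take N (upper s))) *
                   (path_B (lword s) = count id (take N (lower s))).
Proof.
have [s1 s2] := size_lhalf s.
have e := half_word_drop 0 (etrans s1 (esym s2)).
by move: e; rewrite -surjective_pairing drop0 subn0 !s1 -/(lword s) /= !take_takel.
Qed.

Lemma reflect_half (w : seq bool) j : size w = N.*2 -> count id w = N -> j <= N ->
  count id (take j (reflect_path w)) + N = j + count id (take (N.*2 - j) w).
Proof. by move=> sw cw jN; have := @count_take_reflect w j; rewrite sw cw; apply; lia. Qed.

(** The reflection fixes the points of the secondary diagonal, so both halves end at the same two
    points. *)
Lemma rword_AB s : (path_A (rword s) = path_A (lword s)) * (path_B (rword s) = path_B (lword s)).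
Proof.
have [s1 s2] := size_rhalf s.
have e := half_word_drop 0 (etrans s1 (esym s2)).
rewrite !lword_AB; move: e; rewrite -surjective_pairing drop0 subn0 !s1 -/(rword s) /= !take_takel //.
have := reflect_half (size_upper s) (count_upper s) (leqnn N).
have := reflect_half (size_lower s) (count_lower s) (leqnn N).
have -> : N.*2 - N = N by lia.
by move=> el eu [-> ->]; split; lia.
Qed.

Lemma lword_paths s : lword s \in paths n.
Proof.
have [s1 s2] := size_lhalf s; apply/paths_ballot; split.
  by rewrite size_rev size_zip s1 s2 minnn.
move=> k kn; have := half_word_drop k (etrans s1 (esym s2)).
rewrite -surjective_pairing -/(lword s) s1 => -[-> ->].
by rewrite /= !take_takel ?leq_subr //; apply: lower_lt_upper; lia.
Qed.

Lemma rword_paths s : rword s \in paths n.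
Proof.
have [s1 s2] := size_rhalf s; apply/paths_ballot; split.
  by rewrite size_rev size_zip s1 s2 minnn.
move=> k kn; have := half_word_drop k (etrans s1 (esym s2)).
rewrite -surjective_pairing -/(rword s) s1 => -[-> ->].
rewrite /= !take_takel ?leq_subr //.
have := reflect_half (size_upper s) (count_upper s) (leq_subr k N).
have := reflect_half (size_lower s) (count_lower s) (leq_subr k N).
have := @lower_lt_upper s (N.*2 - (N - k)); lia.
Qed.

(** Together with [words_inj], this identifies curves with pairs of half-paths having the same end
    points, that is, with positions of matrix entries. *)
Lemma exists_curve g h : g \in paths n -> h \in paths n ->
  path_x g = path_x h -> path_y g = path_y h -> exists s, lword s = g /\ rword s = h.
Proof.
move=> gP hP exy ey; have [_ BAg _] := path_facts gP; have [_ BAh _] := path_facts hP.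
have eB : path_B g = path_B h by [].
have eA : path_A g = path_A h by move: exy; rewrite /path_x; lia.
have /paths_ballot[sg bg] := gP; have /paths_ballot[sh bh] := hP.
pose a1 := unzip1 (rev g); pose b1 := unzip2 (rev g).
pose a2 := unzip1 (rev h); pose b2 := unzip2 (rev h).
have [sa1 sb1 sa2 sb2] : [/\ size a1 = N, size b1 = N, size a2 = N & size b2 = N].
  by rewrite !size_map !size_rev sg sh.
have gE : half_word (a1, b1) = g by rewrite /half_word zip_unzip revK.
have hE : half_word (a2, b2) = h by rewrite /half_word zip_unzip revK.
have ballot a b q j : size a = N -> size b = N -> half_word (a, b) = q ->
    (forall k, k <= n -> path_B (drop k q) < path_A (drop k q)) -> 0 < j <= N ->
    count id (take j b) < count id (take j a).
  move=> sa sb <- bq /andP[j0 jN]; have := bq (N - j) ltac:(lia).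
  by rewrite !(half_word_drop _ (etrans sa (esym sb))) sa subKn.
have total a b q : size a = N -> size b = N -> half_word (a, b) = q ->
    (count id a = path_A q) * (count id b = path_B q).
  move=> sa sb <-; have := half_word_drop 0 (etrans sa (esym sb)).
  by rewrite drop0 subn0 sa => -[-> ->]; rewrite !take_oversize ?sa ?sb.
have [ca1 cb1] := total _ _ _ sa1 sb1 gE; have [ca2 cb2] := total _ _ _ sa2 sb2 hE.
have glue_point a a' : size a = N -> size a' = N -> count id a = count id a' ->
    point (a ++ reflect_path a') N.*2 = (N, N).
  move=> sa sa' ca; rewrite /point take_oversize; last by rewrite size_cat size_reflect sa sa'; lia.
  have := @count_take_reflect a' N; rewrite sa' leqnn subnn take0 /= take_oversize ?size_reflect ?sa' //.
  move=> /(_ isT) cr; rewrite count_negb !count_cat size_cat size_reflect sa sa'.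
  have := count_id_le a'; rewrite sa' => c'.
  by congr (_, _); lia.
have glue_count a a' j : size a = N -> size a' = N -> count id a = count id a' -> N <= j <= N.*2 ->
    count id (take j (a ++ reflect_path a')) = j - N + count id (take (N.*2 - j) a').
  move=> sa sa' ca /andP[Nj jN]; rewrite take_cat sa ltnNge Nj /= count_cat.
  have := @count_take_reflect a' (j - N); rewrite sa' ca => /(_ ltac:(lia)).
  have -> : N - (j - N) = N.*2 - j by lia.
  by lia.
have [||||||s [us ls]] := @mk_curve N (a1 ++ reflect_path a2) (b1 ++ reflect_path b2).
- by rewrite size_cat size_reflect sa1 sa2; lia.
- by rewrite size_cat size_reflect sb1 sb2; lia.
- have := ballot _ _ _ 1 sa1 sb1 gE bg isT; case: a1 {gE ballot glue_point glue_count ca1} sa1 => //= -[] //= l _.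
  by rewrite take0 /= ltn0.
- by apply: glue_point => //; rewrite ca1 ca2.
- by apply: glue_point => //; rewrite cb1 cb2.
- move=> k kN; suff lt : count id (take k (b1 ++ reflect_path b2)) <
      count id (take k (a1 ++ reflect_path a2)).
    by apply/eqP => -[_ e]; rewrite e ltnn in lt.
  have [kN'|Nk] := leqP k N.
    by rewrite !takel_cat ?sa1 ?sb1 //; apply: ballot gE bg _ => //; lia.
  rewrite !glue_count ?ca1 ?ca2 ?cb1 ?cb2 //; try lia.
  rewrite ltn_add2l; apply: ballot hE bh _ => //; lia.
exists s; rewrite /lword /rword /lhalf /rhalf us ls.
by rewrite !reflect_cat !reflect_pathK !take_size_cat.
Qed.

(** The cut points are given as an unordered pair; B < A decides which one lies on the upper arc. *)
Lemma cuts_lword x y s :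
  cuts (x + y + 1) y s = (path_x (lword s) == x) && (path_y (lword s) == y).
Proof.
have [_ BA _] := path_facts (lword_paths s).
have su : size (take N (upper s)) = N := (size_lhalf s).1.
have sl : size (take N (lower s)) = N := (size_lhalf s).2.
rewrite /cuts /point !count_negb su sl -!lword_AB /path_x /path_y.
move: (path_A _) (path_B _) BA => A B BA.
apply/idP/andP => [/perm_mem e|[/eqP ex /eqP ey]].
  have := e (N - A, A); have := e (N - B, B); rewrite !inE !eqxx !orbT /=.
  rewrite !xpair_eqE => /esym/orP eB /esym/orP eA.
  by case: eA => /andP[_ /eqP eA]; case: eB => /andP[_ /eqP eB]; split; apply/eqP; lia.
have -> : A = x + y + 1 by lia.
by rewrite ey.
Qed.

End CurvePaths.

End LatticePaths.

(** * Intertwiners as matrices indexed by curves *)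

Section CurveUnits.
Variables (C : numFieldType) (F : fieldType) (Q : qnum C F).
Variables (alpha : C) (e : F).
Hypothesis alpha_gen : forall n m : nat, n.+1%:R * alpha + m%:R != 0.
Variables (d : nat) (E G h T : 'I_2 -> 'M[F]_d) (p0 : 'M[F]_d) (rel : uqrel Q E G h T p0).
Variables (n : nat) (w : seq (bool * bool) -> 'cV[F]_d).
Hypothesis dec : decomposed alpha e rel n w.
Local Notation M := (qmod_of rel).
Local Notation P := (paths n).
Local Notation a q := (n.+1%:R * alpha + (path_y q)%:R).
Implicit Types (q r : seq (bool * bool)) (s t : curve n.+1) (f : 'M[F]_d).

Definition compat q r := (path_x q == path_x r) && (path_y q == path_y r).
Definition equivariant f := forall X, f *m op M X = op M X *m f.

Let hw : {in P, forall q, hwv M (path_x q)%:R (a q) (w q)}. Proof. by case: dec. Qed.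
Let par : {in P, forall q, Pa M *m w q = (e ^+ n.+1 * (-1) ^+ path_x q) *: w q}.
Proof. by case: dec. Qed.
Let indep : forall c : seq (bool * bool) -> F,
  \sum_(q <- P) c q *: w q = 0 -> {in P, forall q, c q = 0}.
Proof. by case: dec. Qed.
Let dimP : (\sum_(q <- P) 4 * (path_x q).+1 = d)%N. Proof. by case: dec. Qed.
Let typ := @typical_weights _ _ alpha_gen n.
Let uP := uniq_paths n.

Lemma exists_mu : exists mu : seq (bool * bool) -> seq (bool * bool) -> 'M[F]_d,
  forall q r, q \in P -> r \in P -> compat q r -> equivariant (mu q r) /\
  {in P, forall p k i, (i < 4)%N ->
    mu q r *m kv M i k (w p) = (p == r)%:R *: kv M i k (w q)}.
Proof.
pose good qr f := qr.1 \in P -> qr.2 \in P -> compat qr.1 qr.2 -> equivariant f /\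
  {in P, forall p k i, (i < 4)%N ->
    f *m kv M i k (w p) = (p == qr.2)%:R *: kv M i k (w qr.1)}.
have : forall qr, exists f, good qr f.
  move=> [q r]; have [[qP rP c]|nc] := pselect ([/\ q \in P, r \in P & compat q r]); last first.
    by exists 0 => qP rP c; case: nc.
  have /andP[/eqP cx /eqP cy] := c.
  have := exists_matrix_unit uP hw par indep typ dimP qP rP cx.
  by rewrite cx cy => /(_ erefl erefl)[f fP]; exists f => _ _ _.
by move=> /choice[mu muP]; exists (fun q r => mu (q, r)) => q r; apply: (muP (q, r)).
Qed.

Lemma hw_neq0 q : q \in P -> w q != 0.
Proof.
move=> qP; apply/eqP => w0; suff /eqP : (q == q)%:R = 0 :> F by rewrite eqxx oner_eq0.
apply: (@indep (fun r => (r == q)%:R) _ q qP).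
rewrite big_seq big1 // => r _; case: eqP => [->|_]; last by rewrite scale0r.
by rewrite w0 scaler0.
Qed.

Lemma equivariant_hwv f b c u : equivariant f -> hwv M b c u -> hwv M b c (f *m u).
Proof.
move=> fX [[h0 h1] e0 e1]; split; [split| |].
- by rewrite mulmxA -(fX gH0) -mulmxA h0 scalemxAr.
- by rewrite mulmxA -(fX gH1) -mulmxA h1 scalemxAr.
- by rewrite mulmxA -(fX gE0) -mulmxA e0 mulmx0.
- by rewrite mulmxA -(fX gE1) -mulmxA e1 mulmx0.
Qed.

Lemma hwv_paths (x y : nat) u : hwv M x%:R (n.+1%:R * alpha + y%:R) u ->
  exists c : seq (bool * bool) -> F, u = \sum_(q <- P) c q *: w q /\
    {in P, forall q, c q != 0 -> path_x q = x /\ path_y q = y}.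
Proof.
move=> hu; have [|c [uE cP]] := hwv_span uP hw indep typ dimP hu (alpha_gen n y).
  have -> : x%:R + (n.+1%:R * alpha + y%:R) + 1 = n.+1%:R * alpha + (x + y + 1)%:R :> C.
    by rewrite !natrD; ring.
  exact: alpha_gen.
exists c; split=> // q qP /(cP q qP)[/eqP ex /addrI/eqP ey].
by move: ex ey; rewrite !eqr_nat => /eqP-> /eqP->.
Qed.

(** Column r of the matrix: curves with right half r correspond to the paths with the weight of
    r. *)
Lemma sum_lword (V : nmodType) r (H : seq (bool * bool) -> V) : r \in P ->
  \sum_(s : curve n.+1 | rword s == r) H (lword s) = \sum_(q <- P | compat q r) H q.
Proof.
move=> rP; rewrite -[RHS]big_filter -[LHS]big_filter -(big_map _ xpredT H).
apply: perm_big; apply: uniq_perm.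
- rewrite map_inj_in_uniq ?filter_uniq ?index_enum_uniq // => s t.
  rewrite !mem_filter => /andP[/eqP rs _] /andP[/eqP rt _] lst.
  by apply: words_inj; rewrite // rs rt.
- by rewrite filter_uniq.
move=> q; rewrite mem_filter; apply/mapP/andP => [[s + ->]|[/andP[/eqP cx /eqP cy] qP]].
  rewrite mem_filter => /andP[/eqP <- _]; rewrite lword_paths; split=> //.
  by rewrite /compat /path_x /path_y !rword_AB !eqxx.
have [s [<- rs]] := exists_curve qP rP cx cy.
by exists s => //; rewrite mem_filter rs eqxx mem_index_enum.
Qed.

Variable mu : seq (bool * bool) -> seq (bool * bool) -> 'M[F]_d.
Hypothesis muP : forall q r, q \in P -> r \in P -> compat q r -> equivariant (mu q r) /\
  {in P, forall p k i, (i < 4)%N ->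
    mu q r *m kv M i k (w p) = (p == r)%:R *: kv M i k (w q)}.

Definition unit_of s := mu (lword s) (rword s).

Lemma compat_words s : compat (lword s) (rword s).
Proof. by rewrite /compat /path_x /path_y !rword_AB !eqxx. Qed.

Lemma unit_equivariant s : equivariant (unit_of s).
Proof. by case: (muP (lword_paths s) (rword_paths s) (compat_words s)). Qed.

Lemma unit_kv s p k i : p \in P -> (i < 4)%N ->
  unit_of s *m kv M i k (w p) = (p == rword s)%:R *: kv M i k (w (lword s)).
Proof. by move=> pP i4; have [_ H] := muP (lword_paths s) (rword_paths s) (compat_words s); exact: H. Qed.

Lemma unit_w s p : p \in P -> unit_of s *m w p = (p == rword s)%:R *: w (lword s).
Proof. by move=> pP; have := unit_kv s 0 pP (isT : (0 < 4)%N); rewrite /= expr0 -idmxE !mul1mx. Qed.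

Lemma equivariant_eq f g : equivariant f -> equivariant g ->
  {in P, forall p, f *m w p = g *m w p} -> f = g.
Proof. exact: (equivariant_ext uP hw indep typ dimP). Qed.

Lemma equivariant1 : equivariant 1%:M.
Proof. by move=> X; rewrite mul1mx mulmx1. Qed.
Lemma equivariantM f g : equivariant f -> equivariant g -> equivariant (f *m g).
Proof. by move=> fX gX X; rewrite -mulmxA gX mulmxA fX mulmxA. Qed.
Lemma equivariant0 : equivariant 0.
Proof. by move=> X; rewrite mul0mx mulmx0. Qed.
Lemma equivariant_sum (J : Type) (r : seq J) (A : pred J) (c : J -> F) (f : J -> 'M[F]_d) :
  (forall j, equivariant (f j)) -> equivariant (\sum_(j <- r | A j) c j *: f j).
Proof.
move=> fX X; rewrite mulmx_suml mulmx_sumr; apply: eq_bigr => j _.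
by rewrite -scalemxAl -scalemxAr fX.
Qed.

Definition psi (g : curve n.+1 -> F) := \sum_s g s *: unit_of s.

Lemma psi_w g p : p \in P ->
  psi g *m w p = \sum_(s | rword s == p) g s *: w (lword s).
Proof.
move=> pP; rewrite mulmx_suml [RHS]big_mkcond; apply: eq_bigr => s _.
by rewrite -scalemxAl unit_w // eq_sym; case: eqP => _; rewrite ?scale1r // scale0r scaler0.
Qed.

(** An intertwiner sends w r to a highest weight vector of the same weight, hence to a combination
    of the w q with q compatible with r. Its coefficients are column r, and the images of the w r
    determine the intertwiner. *)
Lemma psi_surj f : equivariant f -> exists g, f = psi g.
Proof.
move=> fX; have : forall r, exists c : seq (bool * bool) -> F, r \in P ->
    f *m w r = \sum_(q <- P) c q *: w q /\
    {in P, forall q, c q != 0 -> path_x q = path_x r /\ path_y q = path_y r}.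
  move=> r; have [rP|] := boolP (r \in P); last by exists (fun=> 0).
  by have [c cP] := hwv_paths (equivariant_hwv fX (hw rP)); exists c.
move=> /choice[c cP]; exists (fun s => c (rword s) (lword s)).
apply: equivariant_eq => [//||p pP]; first exact: equivariant_sum unit_equivariant.
rewrite psi_w // (eq_bigr (fun s => c p (lword s) *: w (lword s))) => [|s /eqP-> //].
rewrite (sum_lword (fun q => c p q *: w q) pP) [RHS]big_mkcond.
have [-> cz] := cP p pP; apply: eq_big_seq => q qP.
have [c0|/(cz q qP)[cx cy]] := eqVneq (c p q) 0; first by rewrite c0 scale0r; case: ifP.
by rewrite /compat cx cy !eqxx.
Qed.

Lemma psi_inj g : psi g = 0 -> forall s, g s = 0.
Proof.
move=> g0 s; have rP := rword_paths s.
(* With the right word fixed, a curve is determined by its left word, so the coefficients become a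
   function of paths, to which [indep] applies. *)
pose c q := if [pick t | (lword t == q) && (rword t == rword s)] is Some t then g t else 0.
have ct t : rword t = rword s -> c (lword t) = g t.
  move=> rt; rewrite /c; case: pickP => [t' /andP[/eqP l /eqP r]|/(_ t)].
    by congr g; apply: words_inj; rewrite ?l // r rt.
  by rewrite rt !eqxx.
have := psi_w g rP; rewrite g0 mul0mx => /esym.
rewrite (eq_bigr (fun t => c (lword t) *: w (lword t))) => [|t /eqP rt]; last by rewrite ct.
rewrite (sum_lword (fun q => c q *: w q) rP) big_mkcond => s0.
rewrite -(ct s erefl).
have := @indep (fun q => if compat q (rword s) then c q else 0) _ (lword s) (lword_paths s).
rewrite compat_words; apply; rewrite -[RHS]s0; apply: eq_bigr => q _.
by case: ifP; rewrite ?scale0r.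
Qed.

Lemma unit_mul s t : unit_of s *m unit_of t =
  if rhalf s == lhalf t then unit_of (glue s t) else 0.
Proof.
apply: equivariant_eq => [||p pP]; first by apply: equivariantM; exact: unit_equivariant.
  by case: ifP => _; [exact: unit_equivariant | exact: equivariant0].
rewrite -mulmxA unit_w // -scalemxAr unit_w ?lword_paths // [lword t == _]eq_sym rword_eq_lword.
case: (rhalf s =P lhalf t) => [e1|_]; last by rewrite scale0r scaler0 mul0mx.
have [eg1 eg2] := glueP e1; rewrite unit_w // scale1r.
by rewrite /rword /lword eg1 eg2.
Qed.

(** A symmetric curve has equal left and right words, so these units are the diagonal ones. *)
Definition diag_sum (A : pred (seq (bool * bool))) :=
  \sum_(s | symmetric_curve s && A (lword s)) unit_of s.

Lemma diag_sum_equivariant A : equivariant (diag_sum A).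
Proof.
have -> : diag_sum A = \sum_(s | symmetric_curve s && A (lword s)) 1 *: unit_of s.
  by apply: eq_bigr => s _; rewrite scale1r.
exact: equivariant_sum unit_equivariant.
Qed.

Lemma diag_sum_w A p : p \in P -> diag_sum A *m w p = (A p)%:R *: w p.
Proof.
move=> pP; rewrite mulmx_suml; have [s0 [l0 r0]] := exists_curve pP pP erefl erefl.
have z s : s != s0 -> symmetric_curve s -> unit_of s *m w p = 0.
  move=> ns; rewrite -lword_eq_rword unit_w // => /eqP ls.
  case: eqP => [rs|_]; last by rewrite scale0r.
  by case/eqP: ns; apply: words_inj; rewrite ?l0 ?r0 ?ls -rs.
have sym0 : symmetric_curve s0 by rewrite -lword_eq_rword l0 r0.
have [Ap|nAp] := boolP (A p); last first.
  rewrite scale0r big1 // => s /andP[ss As]; apply: z ss.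
  by apply: contraNneq nAp => es; rewrite -l0 -es.
rewrite (bigD1 s0) /= ?sym0 ?l0 // big1 => [|s /andP[/andP[ss _] ns]]; last exact: z.
by rewrite addr0 unit_w // r0 eqxx l0.
Qed.

Lemma diag_sum1 : diag_sum xpredT = 1%:M.
Proof.
apply: equivariant_eq (@diag_sum_equivariant _) equivariant1 _ => p pP.
by rewrite diag_sum_w // mul1mx scale1r.
Qed.

Lemma diag_sum_idem A : diag_sum A *m diag_sum A = diag_sum A.
Proof.
apply: equivariant_eq => [||p pP]; [apply: equivariantM| |]; try exact: diag_sum_equivariant.
by rewrite -mulmxA diag_sum_w // -scalemxAr diag_sum_w //; case: (A p);
  rewrite ?scale1r ?scale0r.
Qed.

Definition weight_pred x y : pred (seq (bool * bool)) :=
  fun q => (path_x q == x) && (path_y q == y).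

Lemma diag_sum_hwv x y u : hwv M x%:R (n.+1%:R * alpha + y%:R) u ->
  diag_sum (weight_pred x y) *m u = u.
Proof.
move=> /hwv_paths[c [-> cP]]; rewrite mulmx_sumr; apply: eq_big_seq => q qP.
rewrite -scalemxAr diag_sum_w //; have [->|/(cP q qP)[cx cy]] := eqVneq (c q) 0.
  by rewrite !scale0r.
by rewrite /weight_pred cx cy !eqxx scale1r.
Qed.

(** Centrality, by which the isotypic projector will be shown to be unique. *)
Lemma diag_sum_comm x y f : equivariant f ->
  f *m diag_sum (weight_pred x y) = diag_sum (weight_pred x y) *m f.
Proof.
move=> fX; have dX := @diag_sum_equivariant (weight_pred x y).
apply: equivariant_eq => [||p pP]; try exact: equivariantM.
rewrite -!mulmxA diag_sum_w // -scalemxAr.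
have [c [-> cP]] := hwv_paths (equivariant_hwv fX (hw pP)).
rewrite mulmx_sumr scaler_sumr; apply: eq_big_seq => q qP.
rewrite -scalemxAr diag_sum_w //; have [->|/(cP q qP)[cx cy]] := eqVneq (c q) 0.
  by rewrite !scale0r scaler0.
by rewrite /weight_pred cx cy !scalerA mulrC.
Qed.

Lemma unit_image s u : exists c : nat -> nat -> F, unit_of s *m u =
  \sum_(k < (path_x (lword s)).+1) \sum_(i < 4) c k i *: kv M i k (w (lword s)).
Proof.
have [sp _] := kv_basis uP hw indep typ dimP 0; have [c ->] := sp u.
exists (c (rword s)); rewrite mulmx_sumr (bigD1_seq _ (rword_paths s) uP) /= [X in _ + X]big1_seq.
  have /andP[/eqP cx _] := compat_words s.
  rewrite addr0 cx mulmx_sumr; apply: eq_bigr => k _; rewrite mulmx_sumr.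
  apply: eq_bigr => i _; rewrite -scalemxAr unit_kv ?rword_paths // eqxx.
  by rewrite scale1r.
move=> p /andP[np pP]; rewrite mulmx_sumr big1 // => k _; rewrite mulmx_sumr big1 // => i _.
by rewrite -scalemxAr unit_kv // (negPf np) scale0r scaler0.
Qed.

Lemma unit_image_gen (U : {vspace 'cV[F]_d}) s u :
  (forall X v, v \in U -> op M X *m v \in U) -> w (lword s) \in U -> unit_of s *m u \in U.
Proof.
move=> sU wU; have [c ->] := unit_image s u; rewrite rpred_sum // => k _.
by rewrite rpred_sum // => i _; rewrite rpredZ // kv_stable.
Qed.

Lemma unit_image_simple (U : {vspace 'cV[F]_d}) s u :
  (forall X v, v \in U -> op M X *m v \in U) -> unit_of s *m u \in U ->
  unit_of s *m u != 0 -> w (lword s) \in U.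
Proof.
have lP := lword_paths s; have [c ->] := unit_image s u.
exact: (hw_in_stable (hw lP) (typ lP) (hw_neq0 lP)).
Qed.

Lemma psi_linear (c : F) (g g' : curve_alg F n.+1) :
  psi (c *: g + g') = c *: psi g + psi g'.
Proof.
rewrite scaler_sumr -big_split; apply: eq_bigr => s _ /=.
by rewrite scalerA -scalerDl !ffunE.
Qed.

Lemma psi_mul (g g' : curve_alg F n.+1) : psi (g * g') = psi g *m psi g'.
Proof.
have -> : psi g *m psi g' =
    \sum_s \sum_(t | rhalf s == lhalf t) (g s * g' t) *: unit_of (glue s t).
  rewrite mulmx_suml; apply: eq_bigr => s _; rewrite mulmx_sumr [RHS]big_mkcond.
  apply: eq_bigr => t _; rewrite -scalemxAl -scalemxAr scalerA unit_mul //.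
  by case: ifP; rewrite ?scaler0.
(* Passing to entries makes the sums scalar, as [sum_curve_mul] requires. *)
apply/matrixP => i j; rewrite summxE.
transitivity (\sum_u (curve_mul g g') u * (unit_of u i j)).
  by apply: eq_bigr => u _; rewrite mxE.
rewrite sum_curve_mul summxE; apply: eq_bigr => s _; rewrite summxE.
by apply: eq_bigr => t _; rewrite mxE.
Qed.

Lemma psi_sum_star (A : pred (curve n.+1)) :
  psi (\sum_(s | A s) star F s) = \sum_(s | A s) unit_of s.
Proof.
rewrite [RHS]big_mkcond; apply: eq_bigr => s _; rewrite sum_ffunE.
have [As|nAs] := boolP (A s); last first.
  rewrite big1 ?scale0r // => t At; rewrite ffunE; case: eqP => // es.
  by rewrite es At in nAs.
rewrite (bigD1 s) //= ffunE eqxx big1 ?addr0 ?scale1r // => t /andP[_ nt].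
by rewrite ffunE eq_sym (negPf nt).
Qed.

Lemma psi_star s : psi (star F s) = unit_of s.
Proof. by have := psi_sum_star (pred1 s); rewrite !big_pred1_eq. Qed.

Lemma psi1 : psi (1 : curve_alg F n.+1) = 1%:M.
Proof.
by rewrite -diag_sum1 [LHS]psi_sum_star; apply: eq_bigl => s; rewrite andbT.
Qed.

Lemma psi_Sref x y :
  psi (\sum_(s in Sref n.+1 (x + y + 1) y) star F s) = diag_sum (weight_pred x y).
Proof.
by rewrite psi_sum_star; apply: eq_bigl => s; rewrite inE cuts_lword.
Qed.
End CurveUnits.

(** The sums are compared at a symmetric curve with both halves over (x, y), which [path_with]
    provides. *)
Lemma sum_Sref_inj (F : fieldType) n x y x' y' : (x + y <= n)%N ->
  \sum_(s in Sref n.+1 (x + y + 1) y) star F s =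
  \sum_(s in Sref n.+1 (x' + y' + 1) y') star F s -> x = x' /\ y = y'.
Proof.
move=> xy; have [q qP [qx qy]] := path_with xy.
have [s [ls rs]] := exists_curve qP qP erefl erefl.
have sumE (A : {set curve n.+1}) : (\sum_(t in A) star F t) s = (s \in A)%:R.
  rewrite sum_ffunE; have [sA|sA] := boolP (s \in A).
    rewrite (bigD1 s) //= ffunE eqxx big1 ?addr0 // => t /andP[_ nt].
    by rewrite ffunE eq_sym (negPf nt).
  rewrite big1 // => t tA; rewrite ffunE; case: eqP => // es.
  by rewrite es tA in sA.
move=> /(congr1 (fun f : curve_alg F n.+1 => f s)); rewrite !sumE !inE !cuts_lword.
rewrite -lword_eq_rword ls rs qx qy !eqxx /=.
case: andP => [[/eqP -> /eqP ->] //|_] /eqP; by rewrite oner_eq0.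
Qed.

(** * The field of Laurent series *)

Section QNumbers.
Variable R : realType.
Local Notation C := R[i].
Local Notation K := (ground_field R).

Let tofracE (f g : fps C) : tofrac f = tofrac g -> f = g.
Proof. by move=> e; apply/eqP; rewrite -tofrac_eq e. Qed.

Lemma ground_constD (b c : C) : ground_const (b + c) = ground_const b + ground_const c.
Proof.
rewrite /ground_const -tofracD; congr tofrac; apply/funext => -[|m] //.
by rewrite /GRing.add /= /fps_add addr0.
Qed.

Lemma ground_const1 : ground_const (1 : C) = 1.
Proof.
by rewrite /ground_const -tofrac1; congr tofrac; apply/funext => -[|m].
Qed.

Lemma ground_const_inj : injective (@ground_const R).
Proof. by move=> b c /tofracE/(congr1 (fun f : fps C => f 0%N)). Qed.

Lemma qpowD (b c : C) : qpow (b + c) = qpow b * qpow c.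
Proof.
rewrite /qpow -tofracM; congr tofrac; apply/funext => m.
rewrite [RHS]/GRing.mul /= /fps_mul mulrDl exprDn mulr_suml.
rewrite (reindex_inj rev_ord_inj) /=; apply: eq_bigr => i _.
have im : (i <= m)%N by rewrite -ltnS.
rewrite subSS subKn // bin_sub //.
have f0 k : k`!%:R != 0 :> C by rewrite pnatr_eq0 -lt0n fact_gt0.
rewrite -mulr_natr -(bin_fact im) !natrM.
have b0 : 'C(m, i)%:R != 0 :> C by rewrite pnatr_eq0 -lt0n bin_gt0.
rewrite !invfM; field.
by rewrite ?b0 ?f0 ?pnatr_eq0.
Qed.

Lemma qpow0 : qpow (0 : C) = 1.
Proof.
rewrite /qpow -tofrac1; congr tofrac; apply/funext => -[|m].
  by rewrite expr0 fact0 divr1.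
by rewrite mul0r expr0n /= mul0r.
Qed.

(** The coefficient of hbar in q^c is c / 2. *)
Lemma qpow_inj : injective (@qpow R).
Proof.
move=> b c /tofracE/(congr1 (fun f : fps C => f 1%N)).
by rewrite !expr1 !divr1; apply: mulIf; rewrite invr_eq0 pnatr_eq0.
Qed.

End QNumbers.

Section Concrete.
Variable R : realType.
Local Notation K := (ground_field R).

Definition hbar_qnum : qnum R[i] K :=
  QNum (@ground_constD R) (@ground_const1 R) (@ground_const_inj R)
    (@qpowD R) (@qpow0 R) (@qpow_inj R).

Definition module_rel (M : uq_data R) :=
  uqrel hbar_qnum (uq_E M) (uq_F M) (uq_h M) (uq_q M) (uq_par M).

Lemma module_uqrel (M : uq_data R) : is_uq_module M -> module_rel M.
Proof. by case=> *; split. Qed.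

Lemma ord2P (i : 'I_2) : i = 0 \/ i = 1.
Proof. by case: i => -[|[|//]] i; [left|right]; apply: val_inj. Qed.

Section Module.
Variables (M : uq_data R) (rel : module_rel M).

Lemma stableP (W : {vspace 'cV[K]_(uq_dim M)}) :
  submodule W <-> forall X u, u \in W -> op (qmod_of rel) X *m u \in W.
Proof.
split=> [sW X u /sW[p e f h]|sW u uW].
  by case: X; [exact: e|exact: e|exact: f|exact: f|exact: h|exact: h|exact: p].
split=> [|i|i|i]; first exact: (sW gPa).
- by case: (ord2P i) => ->; [exact: (sW gE0)|exact: (sW gE1)].
- by case: (ord2P i) => ->; [exact: (sW gF0)|exact: (sW gF1)].
- by case: (ord2P i) => ->; [exact: (sW gH0)|exact: (sW gH1)].
Qed.

Lemma equivariantE (f : 'M[K]_(uq_dim M)) : f \in uq_equivariant (M := M) <-> equivariant rel f.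
Proof.
split=> [/uq_equivariantP[p e g h]|fX].
  by case; [exact: e|exact: e|exact: g|exact: g|exact: h|exact: h|exact: p].
apply/uq_equivariantP; split=> [|i|i|i]; first exact: (fX gPa).
- by case: (ord2P i) => ->; [exact: (fX gE0)|exact: (fX gE1)].
- by case: (ord2P i) => ->; [exact: (fX gF0)|exact: (fX gF1)].
- by case: (ord2P i) => ->; [exact: (fX gH0)|exact: (fX gH1)].
Qed.

Lemma hwvP (b c : R[i]) (u : 'cV[K]_(uq_dim M)) :
  highest_weight_vector (M := M) (fun i => if i == 0 then b else c) u <->
  [/\ u != 0, uq_par M *m u = u \/ uq_par M *m u = - u & hwv (qmod_of rel) b c u].
Proof.
split=> [[u0 pu hu eu]|[u0 pu [[h0 h1] e0 e1]]].
  by split=> //; split; [split; [exact: (hu 0)|exact: (hu 1)]|exact: (eu 0)|exact: (eu 1)].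
by split=> // i; case: (ord2P i) => ->.
Qed.

Lemma uq_imageP (f : uqEnd M) u : reflect (exists v, u = val f *m v) (u \in uq_image f).
Proof.
apply: (iffP memv_imgP) => [[v _ ->]|[v ->]]; first by exists v; rewrite lfunE.
by exists v; rewrite ?memvf // lfunE.
Qed.

Lemma uq_image_submodule (f : uqEnd M) : submodule (uq_image f).
Proof.
apply/stableP => X u /uq_imageP[v ->]; apply/uq_imageP; exists (op (qmod_of rel) X *m v).
by have /equivariantE/(_ X) fX := valP f; rewrite mulmxA -fX -mulmxA.
Qed.
End Module.
End Concrete.

Lemma irrational_affine_neq0 (R : realType) (alpha : R[i]) :
  (forall r : rat, alpha != ratr r) -> forall n m : nat, n.+1%:R * alpha + m%:R != 0.
Proof.
move=> irr n m; have n0 : n.+1%:R != 0 :> R[i] by rewrite pnatr_eq0.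
apply: contra (irr (- (m%:R / n.+1%:R))); rewrite addr_eq0 => /eqP e.
rewrite rmorphN fmorph_div !rmorph_nat; apply/eqP/(mulfI n0).
by rewrite e mulrN mulrCA mulfV ?mulr1.
Qed.

Lemma tpow_decomposed (R : realType) (alpha : R[i]) (V : uq_data R) :
  (forall n m : nat, n.+1%:R * alpha + m%:R != 0) -> is_uq_module V ->
  is_V 0 alpha (fullv : {vspace 'cV_(uq_dim V)}) ->
  exists2 e : ground_field R, e = 1 \/ e = - 1 &
  forall n, exists (rel : module_rel (uq_tpow V n)) w, decomposed alpha e rel n w.
Proof.
move=> alpha_gen /module_uqrel relV [_ [v [_ /(hwvP relV)[v0 pv hv] gen]]].
have gen' (U : {vspace 'cV_(uq_dim V)}) :
    (forall X u, u \in U -> op (qmod_of relV) X *m u \in U) -> v \in U -> (fullv <= U)%VS.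
  by move=> /(stableP relV); apply: gen.
have [e e1 pe] : exists2 e : ground_field R, e = 1 \/ e = - 1 & uq_par V *m v = e *: v.
  by case: pv => pv; [exists 1|exists (-1)]; rewrite ?scale1r ?scaleN1r; auto.
exists e => // n; elim: n => [|n [rel [w dec]]].
  by exists relV, (fun=> v); apply: decomposed_base.
by eexists _, _; exact: (decomposed_step alpha_gen hv pe v0 gen' dec).
Qed.

(** * The algebra isomorphism and the isotypic projectors *)

Section Correspondence.
Variables (R : realType) (alpha : R[i]) (e : ground_field R).
Local Notation K := (ground_field R).
Hypothesis alpha_gen : forall n m : nat, n.+1%:R * alpha + m%:R != 0.
Hypothesis e1 : e = 1 \/ e = - 1.
Variables (n : nat) (M : uq_data R) (rel : module_rel M).
Variable w : seq (bool * bool) -> 'cV[K]_(uq_dim M).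
Hypothesis dec : decomposed alpha e rel n w.
Variable mu : seq (bool * bool) -> seq (bool * bool) -> 'M[K]_(uq_dim M).
Hypothesis muP : forall q r, q \in paths n -> r \in paths n -> compat q r ->
  equivariant rel (mu q r) /\
  {in paths n, forall p k i, (i < 4)%N ->
    mu q r *m kv (qmod_of rel) i k (w p) = (p == r)%:R *: kv (qmod_of rel) i k (w q)}.
Local Notation LG := (uqEnd M).
Local Notation CA := (curve_alg K n.+1).

Lemma psi_in (g : CA) : psi mu g \in uq_equivariant (M := M).
Proof. exact/(equivariantE rel)/equivariant_sum/(unit_equivariant muP). Qed.

Definition Psi (g : CA) : LG := exist _ (psi mu g) (psi_in g).

Lemma Psi_inj : injective Psi.
Proof.
move=> g g' /(congr1 val) /= eg; apply/ffunP => s; apply/eqP; rewrite -subr_eq0.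
have z : psi mu ((-1) *: g' + g) = 0.
  by rewrite psi_linear eg scaleN1r addNr.
have /eqP := psi_inj dec muP z s.
by rewrite !ffunE mulN1r addrC.
Qed.

Lemma Psi_surj f : exists g, Psi g = f.
Proof.
have /(equivariantE rel) fX := valP f.
have [g fE] := psi_surj alpha_gen dec muP fX.
exists [ffun s => g s]; apply: val_inj; rewrite /= fE.
by apply: eq_bigr => s _; rewrite ffunE.
Qed.

Lemma Psi_linear (a : K) g g' : Psi (a *: g + g') = a *: Psi g + Psi g'.
Proof. by apply: val_inj; exact: psi_linear. Qed.

Lemma Psi_mul g g' : Psi (g * g') = Psi g * Psi g'.
Proof. by apply: val_inj; exact: (psi_mul alpha_gen dec muP). Qed.

Lemma Psi1 : Psi 1 = 1.
Proof. by apply: val_inj; exact: (psi1 alpha_gen dec muP). Qed.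

(** The image is generated by w (lword s), and every nonzero vector of it leads back to w (lword s)
    inside any stable subspace. *)
Lemma unit_is_V (f : LG) (s : curve n.+1) : val f = unit_of mu s ->
  is_V (path_x (lword s))%:R (n.+1%:R * alpha + (path_y (lword s))%:R) (uq_image f).
Proof.
move=> fE; have lP := lword_paths s; have rP := rword_paths s.
have w0 := hw_neq0 dec lP; have [hw par _ _] := dec.
have wim : w (lword s) \in uq_image f.
  apply/uq_imageP; exists (w (rword s)).
  by rewrite fE (unit_w muP) // eqxx scale1r.
have gen U : submodule U -> w (lword s) \in U -> (uq_image f <= U)%VS.
  move=> /(stableP rel) sU wU; apply/subvP => u /uq_imageP[v ->]; rewrite fE.
  exact: (unit_image_gen alpha_gen dec muP).
split.
  split; first exact: uq_image_submodule.
    by apply: contraNneq w0 => im0; rewrite im0 memv0 in wim.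
  move=> U sU Uf; have [U0|[u uU u0]] : U = 0%VS \/ exists2 u, u \in U & u != 0.
  - have [->|U0] := eqVneq U 0%VS; [by left | right].
    by exists (vpick U); rewrite ?memv_pick ?vpick0.
  - by left.
  right; apply/eqP; rewrite eqEsubv Uf gen //=.
  have /uq_imageP[v uE] := subvP Uf u uU; rewrite fE in uE; rewrite uE in uU u0.
  exact: (unit_image_simple alpha_gen dec muP (proj1 (stableP rel U) sU) uU u0).
exists (w (lword s)); split=> //; apply/(hwvP rel); split=> //; last exact: hw.
have pw : uq_par M *m w (lword s) = (e ^+ n.+1 * (-1) ^+ path_x (lword s)) *: w (lword s).
  exact: par.
rewrite pw; have [->|->] : e ^+ n.+1 * (-1) ^+ path_x (lword s) = 1 \/
    e ^+ n.+1 * (-1) ^+ path_x (lword s) = -1 :> K.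
- case: e1 => ->; rewrite ?expr1n ?mul1r -?exprD -signr_odd; case: (odd _); rewrite ?expr0 ?expr1; auto.
- by left; rewrite scale1r.
- by right; rewrite scaleN1r.
Qed.

(** The highest weight vector of a copy W is fixed by the diagonal sum, so the image contains W.
    Conversely the image lies in the sum of the images of the diagonal units over (x, y), each of
    them a copy. *)
Lemma diag_sum_isotypic x y (f : LG) : val f = diag_sum n mu (weight_pred x y) ->
  is_isotypic_component x%:R (n.+1%:R * alpha + y%:R) (uq_image f).
Proof.
move=> fE; split=> [W [_ [u [_ /(hwvP rel)[_ _ hu] gen]]]|U' sub].
  apply: gen; first exact: uq_image_submodule.
  by apply/uq_imageP; exists u; rewrite fE (diag_sum_hwv alpha_gen dec muP hu).
apply/subvP => u /uq_imageP[v ->]; rewrite fE /diag_sum mulmx_suml rpred_sum //.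
move=> s /andP[_ /andP[/eqP sx /eqP sy]].
pose fs := Psi (star K s).
have fsE : val fs = unit_of mu s by exact: psi_star.
have := unit_is_V fsE; rewrite sx sy => /sub/subvP; apply.
by apply/uq_imageP; exists v; rewrite fsE.
Qed.

(** Two idempotents f and g with the same image satisfy g f = f and f g = g; as the diagonal sum g
    commutes with f, they are equal. *)
Lemma isotypic_projectorP x y (f : LG) :
  is_isotypic_projector x%:R (n.+1%:R * alpha + y%:R) f <->
  val f = diag_sum n mu (weight_pred x y).
Proof.
split=> [[ff [subf minf]]|fE]; last first.
  split; last exact: diag_sum_isotypic.
  by apply: val_inj; rewrite -[val (f * f)]/(val f *m val f) fE; exact: (diag_sum_idem alpha_gen dec muP).
have [g gE] : exists g : LG, val g = diag_sum n mu (weight_pred x y).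
  by exists (Psi (\sum_(s in Sref n.+1 (x + y + 1) y) star K s)); exact: psi_Sref.
have [subg ming] := diag_sum_isotypic gE.
have fg : (uq_image g <= uq_image f)%VS := ming _ subf.
have gf : (uq_image f <= uq_image g)%VS := minf _ subg.
have idem (k : LG) : k * k = k -> forall u, u \in uq_image k -> val k *m u = u.
  move=> /(congr1 val) kk u /uq_imageP[v ->]; rewrite mulmxA; congr (_ *m _).
  exact: kk.
have gg : g * g = g.
  by apply: val_inj; rewrite -[val (g * g)]/(val g *m val g) gE; exact: (diag_sum_idem alpha_gen dec muP).
have absorb (k l : LG) : k * k = k -> (uq_image l <= uq_image k)%VS -> val k *m val l = val l.
  move=> kk lk; apply/matrixP => i j.
  have lj : val l *m delta_mx j 0 \in uq_image k.
    by apply: (subvP lk); apply/uq_imageP; exists (delta_mx j 0).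
  have := congr1 (fun v : 'cV_(uq_dim M) => v i 0) (idem k kk _ lj).
  by rewrite mulmxA -!colE !mxE.
rewrite -(absorb g f gg gf) -gE -[RHS](absorb f g ff fg) gE.
by rewrite (diag_sum_comm alpha_gen dec muP) //; apply/(equivariantE rel); exact: valP.
Qed.
End Correspondence.

Theorem theorem3 (R : realType) (alpha : R[i])
    (alpha_irrational : forall r : rat, alpha != ratr r) (n : nat)
    (V : uq_data R) (V_module : is_uq_module V)
    (V_0_alpha : is_V 0 alpha (fullv : {vspace 'cV_(uq_dim V)})) :
  let LG := uqEnd (uq_tpow V n) in
  let p (x y : nat) : LG -> Prop :=
    is_isotypic_projector x%:R (n.+1%:R * alpha + y%:R) in
  let sum_ref (x y : nat) : curve_alg (ground_field R) n.+1 :=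
    \sum_(s in Sref n.+1 (x + y + 1) y) star (ground_field R) s in
  exists phi : LG -> curve_alg (ground_field R) n.+1,
    [/\ [/\ bijective phi, linear phi & monoid_morphism phi],
        forall (s : curve n.+1) (f : LG), phi f = star (ground_field R) s ->
          (exists x y : nat, [/\ (x + y <= n)%N, cuts (x + y + 1) y s
             & is_V x%:R (n.+1%:R * alpha + y%:R) (uq_image f)])
          /\ (symmetric_curve s -> f * f = f),
        forall x y : nat, (x + y <= n)%N ->
          forall f : LG, p x y f <-> phi f = sum_ref x y
      & forall x y x' y' : nat, (x + y <= n)%N -> (x' + y' <= n)%N ->
          sum_ref x y = sum_ref x' y' -> x = x' /\ y = y'].
Proof.
move=> LG p sum_ref.
have alpha_gen := irrational_affine_neq0 alpha_irrational.
have [e e1 tdec] := tpow_decomposed alpha_gen V_module V_0_alpha.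
have [rel [w dec]] := tdec n; have [mu muP] := exists_mu alpha_gen dec.
have /choice[phi phiK] := Psi_surj alpha_gen dec muP.
have PsiK g : phi (Psi muP g) = g by exact: (Psi_inj dec (phiK (Psi muP g))).
have phiE f g : phi f = g <-> val f = psi mu g.
  split=> [<-|fE]; first by rewrite -[in LHS](phiK f).
  by rewrite -(PsiK g); congr phi; apply: val_inj.
exists phi; split.
- split; first by exists (Psi muP).
    move=> a f g; rewrite -[RHS]PsiK; congr phi.
    by rewrite Psi_linear !phiK.
  split; first by rewrite -[RHS]PsiK (Psi1 alpha_gen dec muP).
  by move=> f g; rewrite -[RHS]PsiK (Psi_mul alpha_gen dec muP) !phiK.
- move=> s f fs; split.
    exists (path_x (lword s)), (path_y (lword s)); split.
    + by have [_ _] := path_facts (lword_paths s).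
    + by rewrite cuts_lword !eqxx.
    + by apply: (unit_is_V alpha_gen e1 dec muP); have /phiE -> := fs; exact: psi_star.
  rewrite symmetric_halves => /eqP sh; rewrite -(phiK f) fs -(Psi_mul alpha_gen dec muP) star_mul.
  rewrite sh eqxx; congr (Psi _ (star _ _)).
  (* For a symmetric s, the curve s itself has the halves required of [glue s s]. *)
  by apply/esym/eqP; rewrite -glue_unique // !eqxx.
- move=> x y xy f; rewrite phiE; rewrite psi_Sref.
  exact: (isotypic_projectorP alpha_gen e1 dec muP).
by move=> x y x' y' xy _; apply: sum_Sref_inj.
Qed.
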